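(* Let $A$ be a commutative $C^*$-algebra with character space $X=\widehat A$, so that $A\cong C_0(X)$; let $E_A$ be a countably generated Hilbert $A$-module, let $p\ge1$, and let $T\in\mathcal L^p(E_A)$ with $0\le T\le1$. Then the map $z\mapsto\zeta(z,T)$ is holomorphic, as an $A$-valued function, on the half-plane $\mathbb C_{\Re z>p}=\{z\in\mathbb C\mid\Re z>p\}$. Moreover, for all compact subsets $K\subset\mathbb C_{\Re z>p}$, all $x\in X$ and all $\epsilon>0$, there is a neighbourhood $U$ of $x$ such that $$\sup_{z\in K}|\zeta(z,T)(y)-\zeta(z,T)(x)|<\epsilon\qquad\text{for all }y\in U.$$
   Context: $\mathcal L(E_A)$ is the $C^*$-algebra of adjointable operators. For $\chi\in\widehat A$, $\chi_*E_A:=E_A\otimes_A\mathbb C$ (with $A$ acting on $\mathbb C$ via $\chi$), and $\chi_*T:=T\otimes1$ for $T\in\mathcal L(E_A)$. For $1\le p<\infty$, $\mathcal L^p(E_A)$ is the set of $T\in\mathcal L(E_A)$ for which $\operatorname{tr}|T|^p\colon\chi\mapsto\operatorname{tr}|\chi_*T|^p$ lies in $A\cong C_0(\widehat A)$. The trace $\operatorname{tr}\colon\mathcal L^1(E_A)\to A$ is the linear map characterized by $\chi(\operatorname{tr}R)=\operatorname{tr}(\chi_*R)$ for all characters $\chi$ of $A$ (the right-hand side being the usual Hilbert space trace). For $p\ge1$, $T\in\mathcal L^p(E_A)$ with $0\le T\le1$ and $\Re z>p$, the operator $T^z$ is defined by continuous functional calculus in $\mathcal L(E_A)$ (with $0^z=0$),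 and the zeta function is $\zeta(z,T):=\operatorname{tr}T^z\in A$. Holomorphic means holomorphic as a Banach space-valued function. *)

(* Defs.v *)
From HB Require Import structures.
From mathcomp Require Import all_boot all_order all_algebra finmap.
From mathcomp Require Import all_classical all_reals all_analysis.
From mathcomp Require Import complex.
From mathcomp Require summability.

Set Implicit Arguments.
Unset Strict Implicit.
Unset Printing Implicit Defensive.

Import Order.TTheory GRing.Theory Num.Theory numFieldNormedType.Exports.

Local Open Scope classical_set_scope.
Local Open Scope ring_scope.
Local Open Scope complex_scope.

(* The complex numbers are [R[i]] for an arbitrary [R : realType]; as a normed
   space over itself it is written [R[i]^o].  The norm of a normed space over
   [R[i]] takes its values in (the nonnegative reals of) [R[i]]. *)

(* Algebras are not assumed to be unital, so the product [cmul] is not the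
   product of a MathComp ring structure. *)
HB.mixin Record isCommCstar (R : realType) A & CompleteNormedModule R[i] A := {
  cmul : A -> A -> A;
  cstar : A -> A;
  cmulA : forall a b c, cmul a (cmul b c) = cmul (cmul a b) c;
  cmulC : forall a b, cmul a b = cmul b a;
  cmulDr : forall a b c, cmul a (b + c) = cmul a b + cmul a c;
  cmulZr : forall (l : R[i]) a b, cmul a (l *: b) = l *: cmul a b;
  cstarK : forall a, cstar (cstar a) = a;
  cstarD : forall a b, cstar (a + b) = cstar a + cstar b;
  cstarZ : forall (l : R[i]) a, cstar (l *: a) = conjc l *: cstar a;
  cstarM : forall a b, cstar (cmul a b) = cmul (cstar b) (cstar a);
  cnormM : forall a b, `|cmul a b| <= `|a| * `|b|;
  cstar_identity : forall a, `|cmul (cstar a) a| = `|a| ^+ 2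
}.

#[short(type="commCstarType")]
HB.structure Definition CommCstar (R : realType) :=
  {A of isCommCstar R A & CompleteNormedModule R[i] A}.

(* Right Hilbert A-modules: the inner product is conjugate-linear in the first
   and A-linear in the second variable.  An element of a C*-algebra is positive
   iff it is of the form b^* b. *)
HB.mixin Record isHilbertMod (R : realType) (A : commCstarType R) E
    & CompleteNormedModule R[i] E := {
  act : E -> A -> E;
  hip : E -> E -> A;
  actDl : forall x y a, act (x + y) a = act x a + act y a;
  actDr : forall x a b, act x (a + b) = act x a + act x b;
  actZl : forall (l : R[i]) x a, act (l *: x) a = l *: act x a;
  actZr : forall (l : R[i]) x a, act x (l *: a) = l *: act x a;
  actA : forall x a b, act (act x a) b = act x (cmul a b);
  hipDr : forall x y z, hip x (y + z) = hip x y + hip x z;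
  hipZr : forall (l : R[i]) x y, hip x (l *: y) = l *: hip x y;
  hip_act : forall x y a, hip x (act y a) = cmul (hip x y) a;
  hip_star : forall x y, cstar (hip x y) = hip y x;
  hip_ge0 : forall x, exists b, hip x x = cmul (cstar b) b;
  hip_norm : forall x, `|x| ^+ 2 = `|hip x x|
}.

#[short(type="hilbertModType")]
HB.structure Definition HilbertMod (R : realType) (A : commCstarType R) :=
  {E of isHilbertMod R A E & CompleteNormedModule R[i] E}.

HB.mixin Record isHilbert (R : realType) H & CompleteNormedModule R[i] H := {
  ip : H -> H -> R[i];
  ipDr : forall x y z, ip x (y + z) = ip x y + ip x z;
  ipZr : forall (l : R[i]) x y, ip x (l *: y) = l * ip x y;
  ip_conj : forall x y, conjc (ip x y) = ip y x;
  ip_norm : forall x, ip x x = `|x| ^+ 2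
}.

#[short(type="hilbertType")]
HB.structure Definition Hilbert (R : realType) :=
  {H of isHilbert R H & CompleteNormedModule R[i] H}.

(* Stated for an arbitrary pairing [form], so as to apply both to Hilbert
   A-modules ([form := hip]) and to Hilbert spaces ([form := ip]).  Adjointable
   operators are automatically linear and bounded, and the adjoint is unique. *)
Section Operators.
Context {R : realType} {V : completeNormedModType R[i]} {W : Type}.
Variable form : V -> V -> W.
Implicit Types (T S : V -> V) (f g : R[i] -> R[i]).

Definition is_adjoint T S := forall x y, form (T x) y = form x (S y).

Definition adjointable T := exists S, is_adjoint T S.

Definition adjoint T : V -> V := get (is_adjoint T).

(* T >= 0 in the C*-algebra of adjointable operators: T = S^* S. *)
Definition op_pos T := exists S S', is_adjoint S S' /\ T = S' \o S.

Definition spectrum T : set R[i] :=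
  [set l | ~ exists S, [/\ adjointable S,
                           forall x, S (T x - l *: x) = x &
                           forall x, T (S x) - l *: S x = x]].

Definition continuous_on_spectrum T f :=
  {within (spectrum T : set R[i]^o), continuous (f : R[i]^o -> R[i]^o)}.

(* [Phi] is the continuous functional calculus of T: the unital
   *-homomorphism from C(spectrum T) to the adjointable operators that sends
   the inclusion of the spectrum in the complex numbers to T. *)
Record is_calculus T (Phi : (R[i] -> R[i]) -> V -> V) : Prop := IsCalculus {
  calculus_ext : forall f g,
    continuous_on_spectrum T f -> continuous_on_spectrum T g ->
    {in spectrum T, f =1 g} -> Phi f = Phi g;
  calculusD : forall f g,
    continuous_on_spectrum T f -> continuous_on_spectrum T g ->
    forall x, Phi (fun t => f t + g t) x = Phi f x + Phi g x;
  calculusZ : forall (l : R[i]) f, continuous_on_spectrum T f ->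
    forall x, Phi (fun t => l * f t) x = l *: Phi f x;
  calculusM : forall f g,
    continuous_on_spectrum T f -> continuous_on_spectrum T g ->
    forall x, Phi (fun t => f t * g t) x = Phi f (Phi g x);
  calculus_star : forall f, continuous_on_spectrum T f ->
    is_adjoint (Phi f) (Phi (fun t => conjc (f t)));
  calculus1 : forall x, Phi (fun _ => 1) x = x;
  calculus_id : forall x, Phi (fun t => t) x = T x
}.

Definition calculus T f : V -> V :=
  get [set S | exists2 Phi, is_calculus T Phi & S = Phi f].

Definition op_abs T : V -> V :=
  calculus (adjoint T \o T) (fun t => (Num.sqrt (complex.Re t))%:C).

Definition op_abs_pow T (p : R) : V -> V :=
  calculus (op_abs T) (fun t => (complex.Re t `^ p)%:C).

(* t^z = exp (z ln t) for t > 0, and 0^z = 0 *)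
Definition cpow (z t : R[i]) : R[i] :=
  let s := ln (complex.Re t) in
  if 0 < complex.Re t then
    (expR (complex.Re z * s))%:C * (cos (complex.Im z * s) +i* sin (complex.Im z * s))
  else 0.

Definition op_cpow T (z : R[i]) : V -> V := calculus T (cpow z).

End Operators.

Section HilbertTrace.
Context {R : realType} {H : hilbertType R}.

Definition orthonormal_basis (I : choiceType) (e : I -> H) :=
  (forall i j, ip (e i) (e j) = (i == j)%:R) /\
  (forall x, (forall i, ip (e i) x = 0) -> x = 0).

(* The series of the <e_i, S e_i> converges unconditionally to t for every
   orthonormal basis e. *)
Definition is_trace (S : H -> H) (t : R[i]) :=
  forall (I : choiceType) (e : I -> H), orthonormal_basis e ->
    summability.partial_sum (fun i => ip (e i) (S (e i)) : R[i]^o)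
      @ summability.totally --> (t : R[i]^o).

End HilbertTrace.

Section Characters.
Context {R : realType}.
Variable A : commCstarType R.

Definition is_character (chi : {ptws A -> R[i]^o}) : Prop :=
  [/\ forall (l : R[i]) a b, chi (l *: a + b) = l * chi a + chi b,
      forall a b, chi (cmul a b) = chi a * chi b,
      forall a, chi (cstar a) = conjc (chi a) &
      exists a, chi a != 0].

(* The topology inherited from {ptws A -> R[i]^o} is the weak-* topology. *)
Definition charspace : topologicalType := [set chi | is_character chi].

Definition gelfand (a : A) (chi : charspace) : R[i] := set_val chi a.

End Characters.

Section HilbertModules.
Context {R : realType} {A : commCstarType R}.
Variable E : hilbertModType A.
Implicit Types (T : E -> E) (chi : charspace A) (p : R).

Definition countably_generated :=
  exists e : nat -> E, forall M : set E,
    closed M -> (forall n, M (e n)) ->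
    (forall x y, M x -> M y -> M (x + y)) ->
    (forall (l : R[i]) x, M x -> M (l *: x)) ->
    (forall x a, M x -> M (act x a)) ->
    M = setT.

(* A model of the interior tensor product of E with the complex numbers along
   chi, i.e. a Hausdorff completion of the algebraic balanced tensor product
   for <x (x) l, y (x) m> = l^* chi(<x, y>) m.  It is unique up to a unique
   unitary operator compatible with [tens]. *)
Record localization chi := Localization {
  loc_space :> hilbertType R;
  tens : E -> R[i] -> loc_space;
  tensDl : forall x y l, tens (x + y) l = tens x l + tens y l;
  tensDr : forall x l m, tens x (l + m) = tens x l + tens x m;
  tensZl : forall (c : R[i]) x l, tens (c *: x) l = c *: tens x l;
  tensZr : forall (c : R[i]) x l, tens x (c * l) = c *: tens x l;
  tens_balanced : forall x a l, tens (act x a) l = tens x (gelfand a chi * l);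
  tens_ip : forall x y l m,
    ip (tens x l) (tens y m) = conjc l * gelfand (hip x y) chi * m;
  tens_dense : forall M : set loc_space,
    closed M -> (forall x l, M (tens x l)) ->
    (forall u v, M u -> M v -> M (u + v)) ->
    M = setT
}.

(* chi_* T = T (x) 1, in the model L of chi_* E *)
Definition push_op chi (L : localization chi) T : L -> L :=
  get [set S : L -> L | adjointable ip S /\
                        forall x l, S (tens L x l) = tens L (T x) l].
Arguments push_op {chi} L T _.

(* tr |chi_* T|^p is finite and equal to t *)
Definition is_tr_abs_pow p T chi (t : R[i]) :=
  exists L : localization chi, is_trace (op_abs_pow ip (push_op L T) p) t.

(* tr (chi_* T) = t.  By uniqueness of localizations and unitary invariance of
   traces, the choice of the model is immaterial here and above. *)
Definition is_tr T chi (t : R[i]) :=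
  exists L : localization chi, is_trace (push_op L T) t.

(* A is identified with a space of functions on [charspace A] by [gelfand]. *)
Definition schatten p : set (E -> E) :=
  [set T | adjointable hip T /\
           exists a : A, forall chi, is_tr_abs_pow p T chi (gelfand a chi)].

(* The unique a : A with chi(a) = tr (chi_* T) for all chi, if T is in the
   Schatten class L^1 (uniqueness: characters separate the points of A). *)
Definition tr T : A :=
  get [set a | schatten 1 T /\ forall chi, is_tr T chi (gelfand a chi)].

Definition zeta (z : R[i]) T : A := tr (op_cpow hip T z).

End HilbertModules.

Definition holomorphic_on (R : realType) (B : normedModType R[i])
    (U : set R[i]) (f : R[i] -> B) :=
  forall z, U z -> derivable (f : R[i]^o -> B) z 1.

(* Main.v *)
Require Import Defs.
From HB Require Import structures.
From mathcomp Require Import all_boot all_order all_algebra finmap.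
From mathcomp Require Import all_classical all_reals all_analysis.
From mathcomp Require Import complex.
From mathcomp Require Import ring lra.

Set Implicit Arguments.
Unset Strict Implicit.
Unset Printing Implicit Defensive.

Import Order.TTheory GRing.Theory Num.Theory numFieldNormedType.Exports.

Local Open Scope classical_set_scope.
Local Open Scope ring_scope.
Local Open Scope complex_scope.

(** For a positive operator P on the localization of E at a character chi, the
trace is the supremum of the sums of the [Re chi<x_i, P x_i>] over the finite
families x in E whose Gram matrix at chi is at most 1; a small perturbation of
chi changes such a sum little, so the trace is lower semicontinuous in chi.  If
[0 <= f(t) <= c t^p] on [0,1], then [tr f(T)] and [tr (c T^p - f(T))] are both
lower semicontinuous and add up to the continuous function [c tr T^p]; hence
[tr f(T)] is continuous, and being dominated by an element of A it lies in A, by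
Stone-Weierstrass on the space of characters completed by 0.  By linearity every
continuous f with [|f(t)| <= c t^p] has a trace in A of norm at most
[6 c |tr T^p|].  For [p < Re z] this applies to [f(t) = t^z], and also to the
Taylor remainder [t^(z+h) - t^z - h t^z ln t], which is [O(|h|^2) t^p] uniformly
in t; this gives holomorphy.  The zeta function is thus norm continuous in z, so
that on a compact set of z finitely many values control the others.

Hilbert modules and Hilbert spaces are treated at once, as Banach spaces whose
squared norm is a supremum of scalar products that is attained; the continuous
functional calculus of a self-adjoint operator is the closure of the polynomial
one, by the bound of [q(T)] by the maximum of |q| on the spectrum. *)

(** * Complex norms and semi-inner products *)

(** The algebra A is neither unital nor given as an algebra of functions, so its characters have to
    be constructed. A minimal seminorm N with N(x x) = N(x)^2 for which a given a0 multiplies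
    exactly turns out to be multiplicative, and then every b acts as a scalar up to N; this scalar
    is the value at b of a character that attains the norm of a0. The attainment is what makes the
    norm of a Hilbert module a maximum of scalar seminorms. [calculus], [push_op] and [tr] select an
    object by [get]. Each is tied to a property that does not depend on the selection: [fcalc], the
    agreement with T on elementary tensors, and [trof]. For the calculus this rests on the fact that
    a purely algebraic functional calculus is automatically contractive. Traces are defined by
    orthonormal bases of some localization. The supremum mentions neither bases nor localizations,
    and so shows that both choices are immaterial. *)

Section ComplexNorm.
Context {R : realType}.
Local Notation C := R[i].

(** The norm of a space over [R[i]] is itself a complex number; its real part gives access to
    suprema, square roots and linear arithmetic over [R]. *)
Definition nrm {V : normedZmodType C} (x : V) : R := complex.Re `|x|.

Lemma nrmE {V : normedZmodType C} (x : V) : `|x| = (nrm x)%:C.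
Proof.
rewrite /nrm; have : 0 <= `|x| by [].
by case: (`|x|) => a b; rewrite lecE /= => /andP[/eqP-> _].
Qed.

Lemma nrm_ge0 {V : normedZmodType C} (x : V) : 0 <= nrm x.
Proof. by rewrite -ler0c -nrmE. Qed.

Lemma nrm0 {V : normedZmodType C} : nrm (0 : V) = 0.
Proof. by rewrite /nrm normr0. Qed.

Lemma nrm_eq0 {V : normedZmodType C} (x : V) : (nrm x == 0) = (x == 0).
Proof. by rewrite -[RHS]normr_eq0 nrmE eq_complex /= eqxx andbT. Qed.

Lemma nrm_gt0 {V : normedZmodType C} (x : V) : (0 < nrm x) = (x != 0).
Proof. by rewrite lt_neqAle nrm_ge0 andbT eq_sym nrm_eq0. Qed.

Lemma nrmN {V : normedZmodType C} (x : V) : nrm (- x) = nrm x.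
Proof. by rewrite /nrm normrN. Qed.

Lemma nrm_subC {V : normedZmodType C} (x y : V) : nrm (x - y) = nrm (y - x).
Proof. by rewrite /nrm distrC. Qed.

Lemma nrmD {V : normedZmodType C} (x y : V) : nrm (x + y) <= nrm x + nrm y.
Proof. by rewrite -lecR rmorphD /= -!nrmE ler_normD. Qed.

Lemma nrmB {V : normedZmodType C} (x y : V) : nrm (x - y) <= nrm x + nrm y.
Proof. by rewrite -(nrmN y) nrmD. Qed.

Lemma nrm_tri {V : normedZmodType C} (y x z : V) :
  nrm (x - z) <= nrm (x - y) + nrm (y - z).
Proof. by have := nrmD (x - y) (y - z); rewrite addrA subrK. Qed.

Lemma nrmM (x y : C) : nrm (x * y) = nrm x * nrm y.
Proof. by apply: complexI; rewrite rmorphM /= -!nrmE normrM. Qed.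

Lemma nrmX (x : C) n : nrm (x ^+ n) = nrm x ^+ n.
Proof.
elim: n => [|n IH]; last by rewrite !exprS nrmM IH.
by rewrite !expr0 /nrm normr1.
Qed.

Lemma nrmV (x : C) : nrm x^-1 = (nrm x)^-1.
Proof. by apply: complexI; rewrite fmorphV /= -!nrmE normfV. Qed.

Lemma nrmZ {V : normedModType C} (c : C) (x : V) : nrm (c *: x) = nrm c * nrm x.
Proof. by apply: complexI; rewrite rmorphM /= -!nrmE normrZ. Qed.

Lemma nrmR (x : R) : nrm x%:C = `|x|.
Proof. by rewrite /nrm normc_def /= expr0n /= addr0 sqrtr_sqr. Qed.

Lemma nrm_sqr (x : C) : nrm x ^+ 2 = complex.Re x ^+ 2 + complex.Im x ^+ 2.
Proof.
by case: x => a b; rewrite /nrm normc_def /= sqr_sqrtr // addr_ge0 ?sqr_ge0.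
Qed.

Lemma nrm_conj (x : C) : nrm (conjc x) = nrm x.
Proof. by case: x => a b; rewrite /nrm !normc_def /= sqrrN. Qed.

Lemma ler_Re_nrm (x : C) : `|complex.Re x| <= nrm x.
Proof.
rewrite -(@ler_pXn2r _ 2) ?nnegrE ?nrm_ge0 // nrm_sqr real_normK ?num_real //.
by rewrite lerDl sqr_ge0.
Qed.

Lemma Re_le_nrm (x : C) : complex.Re x <= nrm x.
Proof. exact: le_trans (ler_norm _) (ler_Re_nrm x). Qed.

Lemma ler_Im_nrm (x : C) : `|complex.Im x| <= nrm x.
Proof.
rewrite -(@ler_pXn2r _ 2) ?nnegrE ?nrm_ge0 // nrm_sqr real_normK ?num_real //.
by rewrite lerDr sqr_ge0.
Qed.

Lemma nrm_le_ReIm (x : C) : nrm x <= `|complex.Re x| + `|complex.Im x|.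
Proof.
rewrite -(@ler_pXn2r _ 2) ?nnegrE ?nrm_ge0 ?addr_ge0 // nrm_sqr sqrrD.
rewrite !real_normK ?num_real // lerD2r lerDl.
by rewrite mulrn_wge0 // mulr_ge0.
Qed.

Lemma mul_conj (x : C) : conjc x * x = (nrm x ^+ 2)%:C.
Proof.
rewrite nrm_sqr; case: x => a b; rewrite /= -!complexr0.
by apply/eqP; rewrite eq_complex /= !expr2; apply/andP; split; apply/eqP; ring.
Qed.

Lemma ReDc (x y : C) : complex.Re (x + y) = complex.Re x + complex.Re y.
Proof. by case: x; case: y. Qed.

Lemma ImDc (x y : C) : complex.Im (x + y) = complex.Im x + complex.Im y.
Proof. by case: x; case: y. Qed.

Lemma ReNc (x : C) : complex.Re (- x) = - complex.Re x.
Proof. by case: x. Qed.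

Lemma ImNc (x : C) : complex.Im (- x) = - complex.Im x.
Proof. by case: x. Qed.

Lemma Re_sum (I : Type) (r : seq I) (P : pred I) (F : I -> C) :
  complex.Re (\sum_(i <- r | P i) F i) = \sum_(i <- r | P i) complex.Re (F i).
Proof. by apply: (big_morph _ ReDc). Qed.

Lemma ReMc (a : R) (x : C) : complex.Re (a%:C * x) = a * complex.Re x.
Proof. by case: x => b c /=; rewrite mul0r subr0. Qed.

Lemma nrm_sum (V : normedZmodType C) (I : Type) (r : seq I) (P : pred I) (F : I -> V) :
  nrm (\sum_(i <- r | P i) F i) <= \sum_(i <- r | P i) nrm (F i).
Proof.
apply: (big_ind2 (fun (x : V) (y : R) => nrm x <= y)) => //; first by rewrite nrm0.
by move=> x1 y1 x2 y2 h1 h2; apply: le_trans (nrmD _ _) _; apply: lerD.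
Qed.

Lemma gtc0P (e : C) : 0 < e -> exists2 r : R, 0 < r & e = r%:C.
Proof.
by case: e => a b; rewrite ltcE /= => /andP[/eqP-> ha]; exists a.
Qed.

Lemma cvg_nrmP {V : normedModType C} (T : Type) (F : set_system T) {FF : Filter F}
  (f : T -> V) (l : V) :
  (f @ F --> l) <-> (forall e : R, 0 < e -> \forall t \near F, nrm (l - f t) <= e).
Proof.
split.
  move=> /cvgrPdist_le h e e0.
  have := h e%:C; rewrite ltcR => /(_ e0); apply: filterS => t.
  by rewrite nrmE lecR.
move=> h; apply/cvgrPdist_le => _ /gtc0P[e e0 ->].
by apply: filterS (h e e0) => t; rewrite nrmE lecR.
Qed.

Lemma nbhs_nrmP {V : normedModType C} (x : V) (P : set V) :
  nbhs x P <-> (exists2 e : R, 0 < e & forall y, nrm (x - y) < e -> P y).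
Proof.
split.
  move=> /nbhs_normP [_ /= /gtc0P[e e0 ->] h].
  by exists e => // y hy; apply: h => /=; rewrite nrmE ltcR.
move=> [e e0 h]; apply/nbhs_normP; exists e%:C; first by rewrite /= ltcR.
by move=> y /=; rewrite nrmE ltcR; apply: h.
Qed.

(** The limit comes with the same rate as the Cauchy estimate. All later constructions of vectors by
    limits use this explicit form. *)
Lemma complete_rate (V : completeNormedModType C) (u : nat -> V) (r : nat -> R) :
  (forall e, 0 < e -> exists N, r N <= e) ->
  (forall n m, (n <= m)%N -> nrm (u m - u n) <= r n) ->
  exists l, forall n, nrm (l - u n) <= r n.
Proof.
move=> r0 hu.
have cu : cvg (u @ \oo).
  apply/cauchy_cvgP/cauchy_exP => _ /gtc0P[e e0 ->].
  have [N hN] := r0 (e / 2) (divr_gt0 e0 (ltr0Sn _ 1)).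
  exists (u N), N => // n /= Nn.
  rewrite -ball_normE /ball_ /= nrmE ltcR nrm_subC.
  by apply: le_lt_trans (hu _ _ Nn) _; apply: le_lt_trans hN _; lra.
exists (limn u) => n; rewrite leNgt; apply/negP => hlt.
have /cvg_nrmP h : u @ \oo --> limn u := cu.
have e0 : 0 < (nrm (limn u - u n) - r n) / 2 by lra.
have [N _ hN] := h _ e0.
have h1 := hN (maxn N n) (leq_maxl _ _).
have h2 := hu n (maxn N n) (leq_maxr _ _).
have h3 := nrm_tri (u (maxn N n)) (limn u) (u n).
by move: h1 h2 h3 hlt => /=; lra.
Qed.

Definition harm (n : nat) : R := n.+1%:R^-1.

Lemma harm_gt0 n : 0 < harm n.
Proof. by rewrite /harm invr_gt0 ltr0Sn. Qed.

Lemma harm_small (e : R) : 0 < e -> exists N, harm N <= e.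
Proof.
move=> e0; exists (Num.truncn e^-1); rewrite /harm -[leRHS]invrK lef_pV2 ?posrE ?invr_gt0 //.
by apply: ltW; rewrite truncnS_gt.
Qed.

Lemma harm_mono m n : (m <= n)%N -> harm n <= harm m.
Proof. by move=> mn; rewrite /harm lef_pV2 ?posrE ?ltr0Sn // ler_nat. Qed.

Lemma harm_le (x C0 : R) : 0 <= C0 -> (forall n, x <= C0 * harm n) -> x <= 0.
Proof.
move=> C0ge h; rewrite leNgt; apply/negP => x0.
have C1 : 0 < C0 + 1 by lra.
have [N hN] := harm_small (divr_gt0 x0 C1).
have := h N; have := harm_gt0 N.
move: hN; rewrite ler_pdivlMr // => hN; lra.
Qed.

Lemma harm_small_mul (c e : R) : 0 < e -> exists N, c * harm N <= e.
Proof.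
move=> e0; have [c0|c0] := leP c 0.
  by exists 0%N; apply: le_trans (ltW e0); rewrite mulr_le0_ge0 // ltW ?harm_gt0.
have [N hN] := harm_small (divr_gt0 e0 c0).
by exists N; rewrite mulrC -ler_pdivlMr.
Qed.

End ComplexNorm.

Section SemiInner.
Context {R : realType}.
Local Notation C := R[i].

(** Definiteness is left out: for a fixed character chi, the scalar chi<x, x> can vanish at a
    nonzero x. *)
Record sip (V : lmodType C) (phi : V -> V -> C) : Prop := Sip {
  sipDr : forall x y z, phi x (y + z) = phi x y + phi x z;
  sipZr : forall (c : C) x y, phi x (c *: y) = c * phi x y;
  sip_conj : forall x y, conjc (phi x y) = phi y x;
  sip_ge0 : forall x, 0 <= phi x x }.

Variables (V : lmodType C) (phi : V -> V -> C) (H : sip phi).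
Let q x := complex.Re (phi x x).

Lemma sipDl x y z : phi (x + y) z = phi x z + phi y z.
Proof. by rewrite -(sip_conj H) (sipDr H) rmorphD /= !(sip_conj H). Qed.

Lemma sipZl c x y : phi (c *: x) y = conjc c * phi x y.
Proof. by rewrite -(sip_conj H) (sipZr H) rmorphM /= !(sip_conj H). Qed.

Lemma sip0r x : phi x 0 = 0.
Proof. by rewrite -(scale0r (0 : V)) (sipZr H) mul0r. Qed.

Lemma sip0l x : phi 0 x = 0.
Proof. by rewrite -(sip_conj H) sip0r conjc0. Qed.

Lemma sipNr x y : phi x (- y) = - phi x y.
Proof. by rewrite -scaleN1r (sipZr H) mulN1r. Qed.

Lemma sipNl x y : phi (- x) y = - phi x y.
Proof. by rewrite -(sip_conj H) sipNr rmorphN /= (sip_conj H). Qed.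

Lemma sip_q x : phi x x = (q x)%:C.
Proof.
have := sip_ge0 H x; rewrite /q; case: (phi x x) => a b.
by rewrite lecE /= => /andP[/eqP-> _].
Qed.

Lemma sip_q_ge0 x : 0 <= q x.
Proof. by rewrite -ler0c -sip_q sip_ge0. Qed.

Lemma sip_Re_sym x y : complex.Re (phi x y) = complex.Re (phi y x).
Proof. by rewrite -(sip_conj H); case: (phi y x). Qed.

Lemma sip_nrm_sym x y : nrm (phi x y) = nrm (phi y x).
Proof. by rewrite -(sip_conj H) nrm_conj. Qed.

Lemma sip_qD x y : q (x + y) = q x + q y + 2 * complex.Re (phi x y).
Proof.
rewrite /q sipDl !(sipDr H) !ReDc (sip_Re_sym y x); ring.
Qed.

Lemma sip_qZ c x : q (c *: x) = nrm c ^+ 2 * q x.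
Proof. by rewrite /q sipZl (sipZr H) mulrA mul_conj ReMc. Qed.

Lemma sip_qN x : q (- x) = q x.
Proof. by rewrite /q sipNl sipNr opprK. Qed.

Lemma sip_q0 : q 0 = 0.
Proof. by rewrite /q sip0r. Qed.

Lemma sip_CS x y : nrm (phi x y) ^+ 2 <= q x * q y.
Proof.
set N := nrm (phi x y) ^+ 2.
(* This is q at x - t phi(y, x) y; the factor phi(y, x) makes the cross term real, equal to - 2 t
   N. *)
have key t : 0 <= q x - 2 * t * N + t ^+ 2 * N * q y.
  have := sip_q_ge0 (x + (- (t%:C * phi y x)) *: y).
  rewrite sip_qD sip_qZ (sipZr H) mulNr ReNc nrmN nrmM nrmR -(sip_nrm_sym x).
  rewrite -(mulrA t%:C) -(sip_conj H x y) mul_conj ReMc /= exprMn.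
  rewrite real_normK ?num_real // -/N.
  by congr (_ <= _); ring.
have N0 : 0 <= N by rewrite sqr_ge0.
have [qy0|qy0] := eqVneq (q y) 0.
  rewrite qy0 mulr0 leNgt; apply/negP => N1.
  have := key ((q x + 1) / (2 * N)); rewrite qy0 mulr0 addr0.
  rewrite (_ : 2 * _ * N = q x + 1); first by lra.
  by field; rewrite lt0r_neq0.
have qy1 : 0 < q y by rewrite lt_neqAle eq_sym qy0 sip_q_ge0.
have := key (q y)^-1.
rewrite (_ : q x - _ + _ = (q x * q y - N) / q y); last by field.
by rewrite pmulr_lge0 ?invr_gt0 // subr_ge0.
Qed.

Definition sn x : R := Num.sqrt (q x).

Lemma sn_ge0 x : 0 <= sn x.
Proof. exact: sqrtr_ge0. Qed.

Lemma sn_sqr x : sn x ^+ 2 = q x.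
Proof. by rewrite sqr_sqrtr // sip_q_ge0. Qed.

Lemma sn_CS x y : nrm (phi x y) <= sn x * sn y.
Proof.
rewrite -(@ler_pXn2r _ 2) ?nnegrE ?nrm_ge0 ?mulr_ge0 ?sn_ge0 //.
by rewrite exprMn !sn_sqr sip_CS.
Qed.

Lemma snD x y : sn (x + y) <= sn x + sn y.
Proof.
rewrite -(@ler_pXn2r _ 2) ?nnegrE ?addr_ge0 ?sn_ge0 //.
rewrite sn_sqr sip_qD sqrrD !sn_sqr.
have := sn_CS x y; have := Re_le_nrm (phi x y).
by rewrite mulr2n; lra.
Qed.

Lemma snZ c x : sn (c *: x) = nrm c * sn x.
Proof.
by rewrite /sn sip_qZ sqrtrM ?sqr_ge0 // sqrtr_sqr ger0_norm ?nrm_ge0.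
Qed.

Lemma snN x : sn (- x) = sn x.
Proof. by rewrite /sn sip_qN. Qed.

Lemma sn_le x (c : R) : 0 <= c -> (sn x <= c) = (q x <= c ^+ 2).
Proof. by move=> c0; rewrite -sn_sqr ler_pXn2r ?nnegrE ?sn_ge0. Qed.

End SemiInner.
Arguments sn {R V} phi x.

(** * Geometric convergence, affine fixed points and the uniform boundedness principle *)

Section UniformBoundedness.
Context {R : realType}.
Local Notation C := R[i].

Lemma bernoulli (t : R) n : 0 <= t -> 1 + n%:R * t <= (1 + t) ^+ n.
Proof.
move=> t0; elim: n => [|n IH]; first by rewrite mul0r addr0 expr0.
rewrite exprS -natr1.
have : (1 + t) * (1 + n%:R * t) <= (1 + t) * (1 + t) ^+ n.
  by rewrite ler_wpM2l // addr_ge0.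
apply: le_trans; have : 0 <= n%:R * t ^+ 2 by rewrite mulr_ge0 ?sqr_ge0.
rewrite expr2; lra.
Qed.

Lemma expr_unbounded (t M : R) : 1 < t -> exists N, forall n, (N <= n)%N -> M < t ^+ n.
Proof.
move=> t1; have d0 : 0 < t - 1 by lra.
exists (Num.truncn (`|M| / (t - 1))).+1 => n hn.
have := bernoulli n (ltW d0); rewrite [1 + (t - 1)]addrC subrK; apply: lt_le_trans.
have h1 : `|M| / (t - 1) < n%:R.
  by apply: lt_le_trans (truncnS_gt _) _; rewrite ler_nat.
move: h1; rewrite ltr_pdivrMr //; have := ler_norm M; lra.
Qed.

Lemma expr_small (k e : R) : 0 <= k < 1 -> 0 < e -> exists N, k ^+ N <= e.
Proof.
move=> /andP[k0 k1] e0; have [->|kn0] := eqVneq k 0.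
  by exists 1%N; rewrite expr1 ltW.
have kp : 0 < k by rewrite lt_neqAle eq_sym kn0.
have [|N hN] := @expr_unbounded k^-1 e^-1; first by rewrite invf_gt1.
exists N; have := hN N (leqnn N).
by rewrite exprVn ltf_pV2 ?posrE ?exprn_gt0 // => /ltW.
Qed.

(** If a > b, the powers of a / b along the exponents 2^k exceed every constant M. Such exponents
    arise from repeated squaring of an inequality, and M is the price of its last step. *)
Lemma le_of_pow (a b M : R) : 0 <= b ->
  (forall n, a ^+ (2 ^ n.+1) <= M * b ^+ (2 ^ n.+1)) -> a <= b.
Proof.
move=> b0 h; rewrite leNgt; apply/negP => ab.
have a0 : 0 < a by apply: le_lt_trans ab.
have [b00|bn0] := eqVneq b 0.
  have := h 0%N; rewrite b00 expr0n /= mulr0 leNgt => /negP; apply.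
  by rewrite exprn_gt0.
have bp : 0 < b by rewrite lt_neqAle eq_sym bn0.
have [|N hN] := @expr_unbounded (a / b) M; first by rewrite ltr_pdivlMr ?mul1r.
have := h N; rewrite -ler_pdivrMr ?exprn_gt0 // -expr_div_n leNgt => /negP; apply.
by apply: hN; rewrite ltnW // (leq_trans (ltnSn N)) // ltnW // ltn_expl.
Qed.

(** Used for the Neumann series of operators and, in an algebra without unit, for solving b = a + a
    b when |a| < 1. *)
Lemma affine_fixpoint (V : completeNormedModType C) (D : V -> V) (c : R) (x : V) :
  0 <= c < 1 -> (forall y z, D (y - z) = D y - D z) ->
  (forall y, nrm (D y) <= c * nrm y) -> exists y, y = x + D y.
Proof.
move=> c01 DB nD; have c0 : 0 <= c by case/andP: c01.
have c1 : 0 < 1 - c by case/andP: c01 => _; rewrite subr_gt0.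
have D0 : D 0 = 0 by have := DB 0 0; rewrite !subrr.
pose u n := iter n (fun y => x + D y) 0.
(* The sum of the geometric series that bounds all increments; its tail from n on is c^n K. *)
pose K := nrm x / (1 - c).
have K0 : 0 <= K by rewrite divr_ge0 ?nrm_ge0 // ltW.
have eK : nrm x = (1 - c) * K by rewrite /K mulrC divfK // gt_eqF.
have uS n : u n.+1 = x + D (u n) by rewrite /u iterS.
have u1 n : nrm (u n.+1 - u n) <= c ^+ n * nrm x.
  elim: n => [|n IH]; first by rewrite /u /= D0 addr0 subr0 mul1r.
  rewrite uS {2}uS opprD addrACA subrr add0r -DB.
  apply: le_trans (nD _) _; rewrite exprS -mulrA ler_wpM2l //.
have um j n : nrm (u (n + j)%N - u n) <= (c ^+ n - c ^+ (n + j)) * K.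
  elim: j => [|j IH]; first by rewrite addn0 !subrr nrm0 mul0r.
  apply: le_trans (nrm_tri (u (n + j)%N) _ _) _.
  rewrite addnS; apply: le_trans (lerD (u1 _) IH) _.
  by rewrite eK exprS; rewrite le_eqVlt; apply/orP; left; apply/eqP; ring.
have [e e0|n m nm|l hl] := @complete_rate _ _ u (fun n => c ^+ n * K).
- have [K00|Kn0] := eqVneq K 0; first by exists 0%N; rewrite K00 mulr0 ltW.
  have Kp : 0 < K by rewrite lt_neqAle eq_sym Kn0.
  have [N hN] := expr_small c01 (divr_gt0 e0 Kp).
  by exists N; rewrite -ler_pdivlMr.
- rewrite -(subnKC nm); apply: le_trans (um _ _) _.
  by rewrite ler_wpM2r // gerBl exprn_ge0.
exists l; apply/eqP; rewrite -subr_eq0 -nrm_eq0 eq_le nrm_ge0 andbT.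
apply/ler_addgt0Pl => e e0; rewrite addr0.
have [N hN] : exists N, c ^+ N * (2 * K + 1) <= e.
  have Kp : 0 < 2 * K + 1 by lra.
  have [N hN] := expr_small c01 (divr_gt0 e0 Kp).
  by exists N; rewrite -ler_pdivlMr.
have h1 := hl N; have h2 := hl N.+1.
have h3 : nrm (u N.+1 - (x + D l)) <= c * (c ^+ N * K).
  rewrite uS opprD addrACA subrr add0r -DB.
  by apply: le_trans (nD _) _; rewrite ler_wpM2l // nrm_subC.
have := nrm_tri (u N.+1) l (x + D l).
have cN : 0 <= c ^+ N by rewrite exprn_ge0.
have : c * (c ^+ N * K) <= c ^+ N * K.
  have cle1 : c <= 1 by case/andP: c01 => _ /ltW.
  by rewrite ler_piMl // mulr_ge0.
move: h2; rewrite exprS -mulrA; lra.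
Qed.

(* A gliding hump: [f] is large on the ball of radius [2 r'] around [x'], and
   these balls are nested. *)
Lemma uniform_boundedness (V : completeNormedModType C) (F : set (V -> R)) :
  (forall f, F f -> [/\ forall x y, f (x + y) <= f x + f y,
     forall x, f (- x) = f x,
     forall (c : R) x, 0 <= c -> f (c%:C *: x) = c * f x &
     exists M, forall x, f x <= M * nrm x]) ->
  (forall x, exists M, forall f, F f -> f x <= M) ->
  exists2 M, 0 <= M & forall f, F f -> forall x, f x <= M * nrm x.
Proof.
move=> HF Hpt; apply: contrapT => Hn.
have big M : 0 <= M -> exists f z, F f /\ M * nrm z < f z.
  move=> M0; apply: contrapT => Hno; apply: Hn; exists M => // f Ff x.
  by rewrite leNgt; apply/negP => h; apply: Hno; exists f, x.
have step (s : nat * (V * {posnum R})) : exists s' : V * {posnum R},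
    [/\ nrm (s'.1 - s.2.1) <= s.2.2%:num, s'.2%:num <= s.2.2%:num / 2 &
     exists2 f, F f &
       forall y, nrm (y - s'.1) <= 2 * s'.2%:num -> s.1.+1%:R <= f y].
  case: s => n [x r] /=.
  have M0 : 0 <= n.+2%:R / r%:num by rewrite divr_ge0.
  have [f [z [Ff fz]]] := big _ M0; have [fD fN fZ [K hK]] := HF f Ff.
  have nz0 : 0 < nrm z.
    rewrite lt_neqAle nrm_ge0 andbT eq_sym; apply/eqP => z0.
    by have := hK z; move: fz; rewrite z0 !mulr0; lra.
  pose w := (r%:num / nrm z)%:C *: z.
  have nw : nrm w = r%:num.
    by rewrite nrmZ nrmR ger0_norm ?divr_ge0 ?nrm_ge0 // divfK // gt_eqF.
  have fw : n.+2%:R <= f w.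
    rewrite fZ ?divr_ge0 ?nrm_ge0 // mulrAC ler_pdivlMr //.
    by move: fz; rewrite mulrAC ltr_pdivrMr // => /ltW; rewrite (mulrC (f z)).
  (* Since f is even and subadditive, 2 f(w) <= f(x + w) + f(x - w), so one of the two points x + w
     and x - w will do. *)
  have [x' hx' fx'] : exists2 x', nrm (x' - x) <= r%:num & n.+2%:R <= f x'.
    have h2 : 2 * f w <= f (x + w) + f (x - w).
      rewrite -(fN (x - w)) -fZ //; apply: le_trans (fD _ _).
      rewrite opprB [w - x]addrC addrACA subrr add0r.
      by rewrite rmorph_nat scaler_nat mulr2n.
    have [h|h] := leP (f w) (f (x + w)).
      by exists (x + w); [rewrite addrC addKr nw | apply: le_trans h].
    exists (x - w); first by rewrite addrC addKr nrmN nw.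
    by lra.
  (* On a ball of radius 1 / K1 the value of f drops by at most 1, from n + 2 to n + 1; the new
     radius is at most half of that. *)
  pose K1 := Num.max K 1; have K10 : 0 < K1 by rewrite lt_max ltr01 orbT.
  have r'0 : 0 < Num.min (r%:num / 2) (2 * K1)^-1.
    by rewrite lt_min divr_gt0 //= invr_gt0 mulr_gt0.
  exists (x', PosNum r'0) => /=; split=> //; first by rewrite ge_min lexx.
  exists f => // y hy.
  have h1 : f x' <= f y + f (y - x').
    by rewrite -(fN (y - x')); apply: le_trans (fD _ _); rewrite opprB addrC subrK.
  have h2 : f (y - x') <= K1 * nrm (y - x').
    by apply: le_trans (hK _) _; rewrite ler_wpM2r ?nrm_ge0 // le_max lexx.
  have h3 : K1 * nrm (y - x') <= 1.
    rewrite -ler_pdivlMl // mulr1; apply: le_trans hy _.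
    rewrite -ler_pdivlMl //; apply: le_trans (_ : _ <= (2 * K1)^-1) _.
      by rewrite ge_min lexx orbT.
    by rewrite invfM.
  move: fx'; rewrite -natr1; lra.
have [g Hg] := choice step.
pose fix s n := if n is m.+1 then g (m, s m) else (0 : V, PosNum (@ltr01 R)).
have sS n : s n.+1 = g (n, s n) by [].
have rS n : (s n.+1).2%:num <= (s n).2%:num / 2.
  by rewrite sS; have [] := Hg (n, s n).
have rh n : (s n).2%:num <= harm n :> R.
  elim: n => [|n IH]; first by rewrite /harm invr1.
  apply: le_trans (rS n) _; apply: le_trans (_ : harm n / 2 <= _).
    by rewrite ler_pM2r.
  rewrite /harm -invfM lef_pV2 ?posrE ?mulr_gt0 // -natrM ler_nat.
  by rewrite muln2 -addnn addSn !ltnS leq_addl.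
(* The radii at least halve, so the displacements of the centres sum to at most twice the current
   radius. Hence the factor 2 in the choice of the balls. *)
have dist k n : nrm ((s (n + k)%N).1 - (s n).1) <= 2 * (s n).2%:num.
  elim: k n => [|k IH] n; first by rewrite addn0 subrr nrm0 mulr_ge0.
  apply: le_trans (nrm_tri (s n.+1).1 _ _) _.
  have := IH n.+1; rewrite addSnnS => h1.
  have [h2 _ _] := Hg (n, s n); rewrite -sS /= in h2.
  by have := rS n; lra.
have [l hl] : exists l, forall n, nrm (l - (s n).1) <= 2 * (s n).2%:num.
  apply: (@complete_rate _ _ (fun n => (s n).1) (fun n => 2 * (s n).2%:num)).
    move=> e e0; have [N hN] := harm_small_mul 2 e0.
    by exists N; apply: le_trans hN; rewrite ler_wpM2l.
  by move=> n m nm; rewrite -(subnKC nm).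
have [M hM] := Hpt l.
have [_ _ [f Ff hf]] := Hg (Num.truncn M, s (Num.truncn M)).
have := hf l; rewrite -sS => /(_ (hl _)) /=.
by rewrite leNgt => /negP; apply; apply: le_lt_trans (hM _ Ff) (truncnS_gt _).
Qed.

End UniformBoundedness.

(** * Adjointable operators *)

Section InnerFamily.
Context {R : realType}.
Local Notation C := R[i].

(* Covers at once the scalar product of a Hilbert space (a one-element family)
   and the A-valued product of a Hilbert module (the family of its images
   under the characters of A). *)
Record ipfam (V : completeNormedModType C) (W : Type) (form : V -> V -> W)
    (X : Type) (phi : X -> V -> V -> C) : Prop := IpFam {
  fam_sip : forall k, sip (phi k);
  fam_le : forall k x, complex.Re (phi k x x) <= nrm x ^+ 2;
  fam_attain : forall x, x != 0 -> exists k, complex.Re (phi k x x) = nrm x ^+ 2;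
  fam_form : forall x y x' y',
    form x y = form x' y' <-> forall k, phi k x y = phi k x' y' }.

Context {V : completeNormedModType C} {W : Type} {form : V -> V -> W}.
Context {X : Type} {phi : X -> V -> V -> C}.
Hypothesis H : ipfam form phi.
Implicit Types (T S B P : V -> V) (k : X) (x y z : V).

Local Notation adj := (is_adjoint form).
Local Notation sipk := (fam_sip H _).

Lemma adjP T S : adj T S <-> forall k x y, phi k (T x) y = phi k x (S y).
Proof.
split=> [h k x y|h x y]; first by have /(fam_form H) := h x y.
by apply/(fam_form H) => k.
Qed.

Lemma fam_eq x y : (forall k z, phi k z x = phi k z y) -> x = y.
Proof.
move=> h; apply/eqP; rewrite -subr_eq0 -nrm_eq0.
have [//|n0] := boolP (nrm (x - y) == 0).
have [k] : exists k, complex.Re (phi k (x - y) (x - y)) = nrm (x - y) ^+ 2.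
  by apply: (fam_attain H); rewrite -nrm_eq0.
rewrite (sipDr sipk) (sipNr sipk) h subrr => /esym/eqP.
by rewrite sqrf_eq0 (negbTE n0).
Qed.

Lemma adj_sym T S : adj T S -> adj S T.
Proof.
move=> /adjP h; apply/adjP => k x y.
by rewrite -(sip_conj sipk) -h (sip_conj sipk).
Qed.

Lemma adj_uniq T S S' : adj T S -> adj T S' -> S = S'.
Proof.
move=> /adjP h /adjP h'; apply/funext => x; apply: fam_eq => k z.
by rewrite -h -h'.
Qed.

Lemma adjD_arg T S x y : adj T S -> T (x + y) = T x + T y.
Proof.
move=> /adj_sym/adjP h; apply: fam_eq => k z.
by rewrite (sipDr sipk) -!h (sipDr sipk).
Qed.

Lemma adjZ_arg T S (c : C) x : adj T S -> T (c *: x) = c *: T x.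
Proof.
move=> /adj_sym/adjP h; apply: fam_eq => k z.
by rewrite (sipZr sipk) -!h (sipZr sipk).
Qed.

Lemma adj0_arg T S : adj T S -> T 0 = 0.
Proof. by move=> h; rewrite -(scale0r (0 : V)) (adjZ_arg _ _ h) !scale0r. Qed.

Lemma adjN_arg T S x : adj T S -> T (- x) = - T x.
Proof. by move=> h; rewrite -scaleN1r (adjZ_arg _ _ h) scaleN1r. Qed.

Lemma adjB_arg T S x y : adj T S -> T (x - y) = T x - T y.
Proof. by move=> h; rewrite (adjD_arg _ _ h) (adjN_arg _ h). Qed.

Lemma adj_id : adj id id.
Proof. by move=> x y. Qed.

Lemma adjD T S T' S' : adj T T' -> adj S S' ->
  adj (fun x => T x + S x) (fun x => T' x + S' x).
Proof.
move=> /adjP h /adjP h'; apply/adjP => k x y.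
by rewrite (sipDl sipk) (sipDr sipk) h h'.
Qed.

Lemma adjZ T T' (c : C) : adj T T' -> adj (fun x => c *: T x) (fun x => conjc c *: T' x).
Proof.
move=> /adjP h; apply/adjP => k x y.
by rewrite (sipZl sipk) (sipZr sipk) h.
Qed.

Lemma adjN T T' : adj T T' -> adj (fun x => - T x) (fun x => - T' x).
Proof.
move=> /adjP h; apply/adjP => k x y.
by rewrite (sipNl sipk) (sipNr sipk) h.
Qed.

Lemma adj_comp T S T' S' : adj T T' -> adj S S' -> adj (T \o S) (S' \o T').
Proof.
move=> /adjP h /adjP h'; apply/adjP => k x y /=.
by rewrite h h'.
Qed.

(** A bound for every seminorm of the family separately. Unlike a bound for the norm, it can be read
    at a single character and so passes to localizations. *)
Definition bnd T (M : R) := forall k x, sn (phi k) (T x) <= M * sn (phi k) x.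

Lemma sn_nrm k x : sn (phi k) x <= nrm x.
Proof. by rewrite (sn_le sipk) ?nrm_ge0 // (fam_le H). Qed.

Lemma nrm_attain x : x != 0 -> exists k, nrm x = sn (phi k) x.
Proof.
move=> /(fam_attain H)[k hk]; exists k.
by rewrite /sn hk sqrtr_sqr ger0_norm ?nrm_ge0.
Qed.

Lemma nrm_le_sn x (c : R) : 0 <= c -> (forall k, sn (phi k) x <= c) -> nrm x <= c.
Proof.
move=> c0 h; have [->|/nrm_attain[k ->]] := eqVneq x 0; first by rewrite nrm0.
exact: h.
Qed.

Lemma fam_eq0 x : (forall k, sn (phi k) x <= 0) -> x = 0.
Proof.
move=> h; apply/eqP; rewrite -nrm_eq0.
by rewrite eq_le nrm_ge0 andbT nrm_le_sn.
Qed.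

Lemma bnd_nrm T M x : 0 <= M -> bnd T M -> nrm (T x) <= M * nrm x.
Proof.
move=> M0 h; apply: nrm_le_sn => [|k]; first by rewrite mulr_ge0 ?nrm_ge0.
by apply: le_trans (h k x) _; rewrite ler_wpM2l // sn_nrm.
Qed.

Lemma bnd_weak T M M' : M <= M' -> bnd T M -> bnd T M'.
Proof.
move=> MM h k x; apply: le_trans (h k x) _.
by rewrite ler_wpM2r ?sn_ge0.
Qed.

Lemma bnd_ext T S M : T =1 S -> bnd T M -> bnd S M.
Proof. by move=> e h k x; rewrite -e. Qed.

Lemma bndD T S M N : bnd T M -> bnd S N -> bnd (fun x => T x + S x) (M + N).
Proof.
move=> h h' k x; apply: le_trans (snD sipk _ _) _.
by rewrite mulrDl lerD.
Qed.

Lemma bndZ T M (c : C) : bnd T M -> bnd (fun x => c *: T x) (nrm c * M).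
Proof. by move=> h k x; rewrite (snZ sipk) -mulrA ler_wpM2l ?nrm_ge0. Qed.

Lemma bnd_comp T S M N : 0 <= M -> bnd T M -> bnd S N -> bnd (T \o S) (M * N).
Proof.
move=> M0 h h' k x /=; apply: le_trans (h _ _) _.
by rewrite -mulrA ler_wpM2l.
Qed.

Lemma adj_nrm T T' M : 0 <= M -> adj T T' ->
  (forall x, nrm (T x) <= M * nrm x) -> forall x, nrm (T' x) <= M * nrm x.
Proof.
move=> M0 /adjP a h x.
have [->|T'x0] := eqVneq (T' x) 0; first by rewrite nrm0 mulr_ge0 ?nrm_ge0.
have [k hk] := fam_attain H T'x0.
have n0 : 0 < nrm (T' x) by rewrite nrm_gt0.
rewrite -(ler_pM2l n0) -expr2 -hk -a.
apply: le_trans (Re_le_nrm _) _; apply: le_trans (sn_CS sipk _ _) _.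
apply: le_trans (ler_pM _ _ (sn_nrm k _) (sn_nrm k _)) _; rewrite ?sn_ge0 //.
by rewrite mulrCA mulrA ler_wpM2r ?nrm_ge0.
Qed.

(* Iterating the Cauchy-Schwarz inequality for [B = T' T] removes the defect
   between the norm of x and its seminorm at k. *)
Lemma nrm_bnd T T' M : 0 <= M -> adj T T' ->
  (forall x, nrm (T x) <= M * nrm x) -> bnd T M.
Proof.
move=> M0 a h; have h' := adj_nrm M0 a h.
have aB := adj_comp (adj_sym a) a; set B := T' \o T in aB.
have nB n x : nrm (iter n B x) <= (M ^+ 2) ^+ n * nrm x.
  elim: n => [|n IH]; first by rewrite expr0 mul1r.
  rewrite iterS exprS -mulrA; apply: le_trans (h' _) _.
  rewrite expr2 -mulrA ler_wpM2l //; apply: le_trans (h _) _.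
  by rewrite ler_wpM2l.
have aBn n : adj (iter n B) (iter n B).
  elim: n => [|n IH] x y; first by [].
  by rewrite iterS iterSr aB IH.
move=> k x; rewrite -(@ler_pXn2r _ 2) ?nnegrE ?mulr_ge0 ?sn_ge0 //.
rewrite exprMn; set Q := sn _ x ^+ 2; set s0 := sn _ (T x) ^+ 2.
have Q0 : 0 <= Q by rewrite sqr_ge0.
have s00 : 0 <= s0 by rewrite sqr_ge0.
pose c n := sn (phi k) (iter (2 ^ n)%N B x) ^+ 2.
have c0 n : 0 <= c n by rewrite sqr_ge0.
have step0 : s0 ^+ 2 <= Q * c 0%N.
  rewrite /Q /c /s0 expn0 -exprMn -(@ler_pXn2r _ 2) ?nnegrE ?exprn_ge0 ?mulr_ge0 ?sn_ge0 //.
  rewrite ler_pXn2r ?nnegrE ?exprn_ge0 ?mulr_ge0 ?sn_ge0 //.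
  rewrite ler_pXn2r ?nnegrE ?exprn_ge0 ?mulr_ge0 ?sn_ge0 //.
  rewrite (sn_sqr sipk); have /adjP -> := a.
  by apply: le_trans (Re_le_nrm _) _; apply: sn_CS sipk _ _.
have step n : c n ^+ 2 <= Q * c n.+1.
  rewrite /Q /c -exprMn ler_pXn2r ?nnegrE ?exprn_ge0 ?mulr_ge0 ?sn_ge0 //.
  rewrite (sn_sqr sipk); have /adjP -> := aBn (2 ^ n)%N.
  rewrite -iterD addnn -mul2n -expnS.
  by apply: le_trans (Re_le_nrm _) _; apply: sn_CS sipk _ _.
have [Q00|Qn0] := eqVneq Q 0.
  have : s0 ^+ 2 <= 0 by apply: le_trans step0 _; rewrite Q00 mul0r.
  rewrite Q00 mulr0 le_eqVlt ltNge sqr_ge0 orbF sqrf_eq0 => /eqP->.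
  by [].
have Qp : 0 < Q by rewrite lt_neqAle eq_sym Qn0.
rewrite -ler_pdivrMr //.
apply: (@le_of_pow _ _ _ (nrm x ^+ 2 / Q)); first by rewrite exprn_ge0.
have cn n : (s0 / Q) ^+ (2 ^ n.+1) <= c n / Q.
  elim: n => [|n IH].
    by rewrite expr_div_n [Q ^+ 2]expr2 invfM mulrA ler_pM2r ?invr_gt0 // ler_pdivrMr // mulrC.
  rewrite expnS mulnC exprM; apply: le_trans (_ : (c n / Q) ^+ 2 <= _).
    by rewrite ler_pXn2r ?nnegrE ?exprn_ge0 ?divr_ge0.
  by rewrite expr_div_n [Q ^+ 2]expr2 invfM mulrA ler_pM2r ?invr_gt0 // ler_pdivrMr // mulrC.
move=> n; apply: le_trans (cn n) _.
rewrite [leRHS]mulrAC ler_pM2r ?invr_gt0 //.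
apply: le_trans (_ : nrm (iter (2 ^ n)%N B x) ^+ 2 <= _).
  by rewrite ler_pXn2r ?nnegrE ?sn_ge0 ?nrm_ge0 // sn_nrm.
rewrite expnS mulnC exprM -exprMn mulrC ler_pXn2r ?nnegrE ?mulr_ge0 ?nrm_ge0 ?exprn_ge0 //.
Qed.

(** Hellinger-Toeplitz: each functional |phi k (y, T x)| with y in a unit ball is bounded, because T
    can be moved to y, and together they are bounded by |T x| at every x. Uniform boundedness gives
    a common constant. *)
Lemma adjointable_bnd T : adjointable form T -> exists2 M, 0 <= M & bnd T M.
Proof.
move=> [T' a].
suff [M M0 h] : exists2 M, 0 <= M & forall x, nrm (T x) <= M * nrm x.
  by exists M => //; apply: nrm_bnd a h.
pose F := [set f : V -> R | exists k y, sn (phi k) y <= 1 /\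
  f = fun x => nrm (phi k y (T x))].
have /adjP aP := a; have /adj_sym/adjP aS := a.
have [f [k [y [_ ->]]]|x|M M0 hM] := @uniform_boundedness _ V F.
- split.
  + by move=> x z; rewrite (adjD_arg _ _ a) (sipDr sipk) nrmD.
  + by move=> x; rewrite (adjN_arg _ a) (sipNr sipk) nrmN.
  + move=> c x c0; rewrite (adjZ_arg _ _ a) (sipZr sipk) nrmM nrmR ger0_norm //.
  + exists (sn (phi k) (T' y)) => x; rewrite -aS.
    apply: le_trans (sn_CS sipk _ _) _.
    by rewrite ler_wpM2l ?sn_ge0 ?sn_nrm.
- exists (nrm (T x)) => _ [k [y [y1 ->]]].
  apply: le_trans (sn_CS sipk _ _) _; apply: le_trans (sn_nrm k _).
  by rewrite ler_piMl ?sn_ge0.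
exists M => // x.
have [->|Tx0] := eqVneq (T x) 0; first by rewrite nrm0 mulr_ge0 ?nrm_ge0.
have [k hk] := nrm_attain Tx0.
have n0 : 0 < nrm (T x) by rewrite nrm_gt0.
(* The test vector is T x, normalized at an index k where its norm is attained. *)
have := hM (fun z => nrm (phi k ((nrm (T x))^-1%:C *: T x) (T z))).
move=> /(_ _ x); rewrite (sipZl sipk) nrmM nrm_conj nrmR ger0_norm ?invr_ge0 ?nrm_ge0 //.
rewrite (sip_q sipk) nrmR ger0_norm ?(sip_q_ge0 sipk) // -(sn_sqr sipk) -hk expr2 mulKf ?gt_eqF //.
apply; exists k, ((nrm (T x))^-1%:C *: T x); split=> //.
by rewrite (snZ sipk) nrmR ger0_norm ?invr_ge0 ?nrm_ge0 // -hk mulVf ?gt_eqF.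
Qed.

Lemma adj_bnd T T' M : 0 <= M -> adj T T' -> bnd T M -> bnd T' M.
Proof.
move=> M0 a h; apply: nrm_bnd (adj_sym a) _ => //; apply: adj_nrm a _ => // x.
exact: bnd_nrm.
Qed.

Definition op_invertible T := exists S,
  [/\ adjointable form S, forall x, S (T x) = x & forall x, T (S x) = x].

Lemma spectrumP T (l : C) : spectrum form T l <-> ~ op_invertible (fun x => T x - l *: x).
Proof. by []. Qed.

Lemma op_inv_ext T S : T =1 S -> op_invertible T -> op_invertible S.
Proof. by move=> /funext ->. Qed.

Lemma op_inv_comp T S : op_invertible T -> op_invertible S -> op_invertible (T \o S).
Proof.
move=> [T1 [[T1' a] h1 h2]] [S1 [[S1' b] h3 h4]]; exists (S1 \o T1); split.
- by exists (T1' \o S1'); apply: adj_comp.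
- by move=> x /=; rewrite h1.
- by move=> x /=; rewrite h4.
Qed.

Lemma op_inv_scale (c : C) : c != 0 -> op_invertible (fun x => c *: x).
Proof.
move=> c0; exists (fun x => c^-1 *: x); split.
- by exists (fun x => conjc c^-1 *: x); apply: (adjZ _ adj_id).
- by move=> x; rewrite scalerA mulVf // scale1r.
- by move=> x; rewrite scalerA mulfV // scale1r.
Qed.

(** With U an inverse of T S, the operator S U is a right inverse of T, and commutation makes it a
    left inverse too. It reduces the invertibility of a normal operator to that of a positive
    one. *)
Lemma op_inv_factor T S : adjointable form S -> (forall x, T (S x) = S (T x)) ->
  op_invertible (T \o S) -> op_invertible T.
Proof.
move=> [S' a] c [U [[U' b] h1 h2]].
rewrite /= in h1 h2; have h3 x : U (S (T x)) = x by rewrite -c h1.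
exists (S \o U); split.
- by exists (U' \o S'); apply: adj_comp.
- by move=> x /=; rewrite -[LHS]h3 (h2 (T x)) h3.
- by move=> x; exact: h2.
Qed.

Section Neumann.
Variables (B B' : V -> V) (c : R).
Hypotheses (a : adj B B') (c01 : 0 <= c < 1).

Let solve D D' : adj D D' -> bnd D c -> exists S, forall x, S x = x + D (S x).
Proof.
move=> aD hD; have c0 : 0 <= c by case/andP: c01.
suff h x : exists y, y = x + D y by have [S hS] := choice h; exists S.
apply: (affine_fixpoint _ c01) => [y z|y]; first exact: (adjB_arg _ _ aD).
exact: bnd_nrm.
Qed.

(** The inverse must be adjointable as well: its adjoint is the inverse of 1 - B', obtained from the
    same fixed point equation. *)
Lemma neumann : bnd B c -> op_invertible (fun x => x - B x).
Proof.
move=> hB; have c0 : 0 <= c by case/andP: c01.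
have [S hS] := solve a hB.
have [S' hS'] := solve (adj_sym a) (adj_bnd c0 a hB).
have aS : adj S S'.
  apply/adjP => k x y; move/adjP: a => aP.
  have ex : x = S x - B (S x) by rewrite {1}(hS x) addrK.
  have ey : y = S' y - B' (S' y) by rewrite {1}(hS' y) addrK.
  transitivity (phi k (S x) (S' y - B' (S' y))); first by rewrite -ey.
  rewrite (sipDr sipk) (sipNr sipk) -aP -(sipNl sipk) -(sipDl sipk).
  by rewrite -ex.
exists S; split; first by exists S'.
  move=> x; apply/eqP; rewrite -subr_eq0 -nrm_eq0 eq_le nrm_ge0 andbT.
  have e : S (x - B x) - x = B (S (x - B x) - x).
    by rewrite (adjB_arg _ _ a) {1}hS addrAC [x - B x]addrC addrK addrC.
  have := bnd_nrm (S (x - B x) - x) c0 hB; rewrite -e.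
  by case/andP: c01 => _ c1; have := nrm_ge0 (S (x - B x) - x); nra.
by move=> x; rewrite {1}hS addrK.
Qed.
End Neumann.

Lemma sip_pos B k : adj B B -> (forall x, 0 <= complex.Re (phi k x (B x))) ->
  sip (fun x y => phi k x (B y)).
Proof.
move=> a h; have /adjP aP := a; split.
- by move=> x y z; rewrite (adjD_arg _ _ a) (sipDr sipk).
- by move=> c x y; rewrite (adjZ_arg _ _ a) (sipZr sipk).
- by move=> x y; rewrite (sip_conj sipk) aP.
- move=> x; have := sip_conj (fam_sip H k) x (B x); rewrite aP; have := h x.
  case: (phi k x (B x)) => u v /= u0 [hv]; rewrite lecE /= u0 andbT.
  by apply/eqP; lra.
Qed.

(** Cauchy-Schwarz for the semi-inner product (x, B y), applied to B x and x, gives |B x|^4 <= c |B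
    x|^2 c |x|^2. *)
Lemma bnd_pos B (c : R) : 0 <= c -> adj B B ->
  (forall k x, 0 <= complex.Re (phi k x (B x)) <= c * sn (phi k) x ^+ 2) -> bnd B c.
Proof.
move=> c0 a h k x; have /adjP aP := a.
have sB := sip_pos a (fun x => proj1 (andP (h k x))).
rewrite -(@ler_pXn2r _ 2) ?nnegrE ?mulr_ge0 ?sn_ge0 // exprMn.
set u := sn _ (B x) ^+ 2; set v := sn _ x ^+ 2.
have u0 : 0 <= u by rewrite sqr_ge0.
have v0 : 0 <= v by rewrite sqr_ge0.
have := sip_CS sB (B x) x; rewrite (sip_q sipk) -(sn_sqr sipk) nrmR -/u ger0_norm //.
have /andP[h1 h2] := h k (B x); have /andP[h3 h4] := h k x.
move=> h5; have [->|un0] := eqVneq u 0; first by rewrite mulr_ge0 ?sqr_ge0.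
have up : 0 < u by rewrite lt_neqAle eq_sym un0.
rewrite -(ler_pM2l up) -expr2; apply: le_trans h5 _.
apply: le_trans (ler_pM h1 h3 h2 h4) _; rewrite -/u -/v.
by rewrite le_eqVlt; apply/orP; left; apply/eqP; ring.
Qed.

Lemma pos_invertible P (c : R) : 0 < c -> adj P P ->
  (forall k x, c * sn (phi k) x ^+ 2 <= complex.Re (phi k x (P x))) -> op_invertible P.
Proof.
(* With N = M + c at least the bound of P, the operator 1 - P / N lies between 0 and 1 - c / N, so a
   Neumann series inverts P / N. *)
move=> c0 a h; have [M M0 bM] : exists2 M, 0 <= M & bnd P M.
  by apply: adjointable_bnd; exists P.
pose N := M + c; have N0 : 0 < N by rewrite ltr_wpDl.
pose B x := x - N^-1%:C *: P x.
have aB : adj B B.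
  have : adj B (fun x => x + - (conjc N^-1%:C *: P x)).
    exact: (adjD adj_id (adjN (adjZ _ a))).
  by rewrite conjc_real.
have k01 : 0 <= 1 - c / N < 1.
  rewrite subr_ge0 ler_pdivrMr // mul1r lerDr M0 /= ltrBlDr ltrDl.
  by rewrite divr_gt0.
have hB : bnd B (1 - c / N).
  apply: bnd_pos => // [|k x]; first by case/andP: k01.
  rewrite /B (sipDr sipk) (sipNr sipk) (sipZr sipk) ReDc ReNc ReMc -(sn_sqr sipk).
  have h2 : complex.Re (phi k x (P x)) <= N * sn (phi k) x ^+ 2.
    apply: le_trans (Re_le_nrm _) _; apply: le_trans (sn_CS sipk _ _) _.
    rewrite expr2 mulrCA ler_wpM2l ?sn_ge0 //; apply: le_trans (bM _ _) _.
    by rewrite ler_wpM2r ?sn_ge0 // lerDl ltW.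
  rewrite subr_ge0 mulrC ler_pdivrMr // [_ ^+ 2 * N]mulrC h2 /=.
  rewrite mulrBl mul1r lerD2l lerN2 mulrAC ler_pM2r ?invr_gt0 //.
have := op_inv_comp (op_inv_scale (c := N%:C) _) (neumann aB k01 hB).
have Nn0 : N%:C != 0 by rewrite eq_complex /= eqxx andbT gt_eqF.
move=> /(_ Nn0); apply: op_inv_ext => x /=.
by rewrite /B opprB addrC subrK scalerA -rmorphM /= mulfV ?gt_eqF // scale1r.
Qed.

End InnerFamily.
Arguments bnd {R V X} phi T M.
Arguments op_invertible {R V W} form T.

(** * Stone-Weierstrass *)

Section StoneWeierstrass.
Context {R : realType} {Y : topologicalType}.
Implicit Types (K : set Y) (f g h : Y -> R).

(** If no finite family covered K, the complements of finite unions would generate a proper filter,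
    whose cluster point p contradicts P p being a neighbourhood of p. *)
Lemma compact_seq K (P : Y -> set Y) : compact K -> (forall x, K x -> nbhs x (P x)) ->
  exists s : seq Y, (forall x, x \in s -> K x) /\
    forall y, K y -> exists2 x, x \in s & P x y.
Proof.
move=> cK hP; apply: contrapT => nos.
pose F := [set A : set Y | exists s : seq Y, (forall x, x \in s -> K x) /\
  forall y, K y -> (forall x, x \in s -> ~ P x y) -> A y].
have FF : ProperFilter F.
  split; [|split].
  - move=> [s [sK h]]; apply: nos; exists s; split=> // y Ky.
    apply: contrapT => hn; apply: (h y Ky) => x xs Pxy.
    by apply: hn; exists x.
  - by exists [::].
  - move=> A B [s [sK hA]] [t [tK hB]]; exists (s ++ t); split.
      by move=> x; rewrite mem_cat => /orP[/sK|/tK].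
    move=> y Ky h; split; [apply: hA => // x xs|apply: hB => // x xs].
      by apply: h; rewrite mem_cat xs.
    by apply: h; rewrite mem_cat xs orbT.
  - by move=> A B AB [s [sK hA]]; exists s; split=> // y Ky h; apply: AB; apply: hA.
have [|p [Kp clp]] := cK F FF; first by exists [::].
have [|y [nPy Py]] := clp (~` P p) (P p) _ (hP p Kp); last by apply: nPy.
exists [:: p]; split=> [x|y Ky h]; first by rewrite inE => /eqP->.
by apply: h; rewrite inE.
Qed.

Definition cont_on K f := forall x, K x -> forall e, 0 < e ->
  nbhs x [set y | K y -> `|f y - f x| < e].

Lemma cont_onB K f g : cont_on K f -> cont_on K g -> cont_on K (fun y => f y - g y).
Proof.
move=> hf hg x Kx e e0; have e20 : 0 < e / 2 by lra.
apply: filterS2 (hf x Kx _ e20) (hg x Kx _ e20) => y /= h1 h2 Ky.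
have := h1 Ky; have := h2 Ky; rewrite !ltr_norml; lra.
Qed.

Lemma cont_on_bounded K f : compact K -> cont_on K f ->
  exists2 M, 0 < M & forall y, K y -> `|f y| <= M.
Proof.
move=> cK hf; have [|s [_ hs]] := @compact_seq K (fun x => [set y | K y -> `|f y - f x| < 1]) cK.
  by move=> x Kx; apply: hf.
exists (1 + \sum_(x <- s) `|f x|).
  by apply: ltr_pwDl => //; apply: sumr_ge0.
move=> y Ky; have [x xs /(_ Ky) h] := hs y Ky.
have -> : f y = (f y - f x) + f x by rewrite subrK.
apply: le_trans (ler_normD _ _) _; apply: lerD; first exact: ltW.
by rewrite (big_rem x) //= lerDl sumr_ge0.
Qed.

(* The recursion u' = u + (t^2 - u^2) / 2 converges to |t| uniformly on [-1, 1]. *)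
Fixpoint abs_iter (t : R) n : R :=
  if n is m.+1 then abs_iter t m + 2^-1 * (t * t + - 1 * (abs_iter t m * abs_iter t m))
  else 0.

Lemma abs_iterP t n : `|t| <= 1 -> 0 <= `|t| - abs_iter t n <= 2 * harm n.
Proof.
move=> t1; set a := `|t|.
have a0 : 0 <= a by rewrite normr_ge0.
have ta : t * t = a * a by rewrite -!expr2 /a real_normK ?num_real.
(* The bound 2 / (n + 2) is the one that reproduces itself under the recursion d' <= d - d^2 / 2; at
   n = 0 it is 1. *)
suff [h1 _ h2] : [/\ 0 <= a - abs_iter t n, 0 <= abs_iter t n &
    a - abs_iter t n <= 2 / n.+2%:R].
  rewrite h1 /=; apply: le_trans h2 _.
  by rewrite ler_pM2l // /harm lef_pV2 ?posrE // ler_nat.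
elim: n => [|n [h1 h2 h3]].
  by rewrite /= subr0; split=> //; rewrite divff.
rewrite /= ta; set u := abs_iter t n in h1 h2 h3 *.
have a1 : a <= 1 := t1.
pose m : R := n.+2%:R; have m2 : 2 <= m by rewrite ler_nat.
have m0 : 0 < m by lra.
have h3' : (a - u) * m <= 2 by rewrite -ler_pdivlMr.
have -> : n.+3%:R = m + 1 :> R by rewrite -natr1.
split.
- have : 0 <= (a - u) * (1 - (a + u) / 2) by apply: mulr_ge0 => //; lra.
  lra.
- have : 0 <= (a - u) * (a + u) by apply: mulr_ge0 => //; lra.
  lra.
rewrite ler_pdivlMr; last by lra.
have hd : a - (u + 2^-1 * (a * a + - 1 * (u * u))) <= (a - u) - (a - u) ^+ 2 / 2.
  have : 0 <= (a - u) * u by apply: mulr_ge0.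
  rewrite expr2; lra.
apply: le_trans (ler_wpM2r _ hd) _; first by lra.
set d := a - u in h1 h3' *.
(* The slack in the induction hypothesis. Expressed by w >= 0 and m >= 2, the new slack is a
   quotient of sums of nonnegative terms. *)
pose w := 2 - d * m; have w0 : 0 <= w by rewrite /w; lra.
have -> : d = (2 - w) / m by rewrite /w opprB addrC subrK mulfK // gt_eqF.
rewrite -subr_ge0.
have -> : 2 - ((2 - w) / m - ((2 - w) / m) ^+ 2 / 2) * (m + 1) =
  (4 + 2 * w * (m - 2) * (m + 1) + w ^+ 2 * (m + 1)) / (2 * m ^+ 2).
  by field; rewrite gt_eqF.
apply: divr_ge0; last by rewrite mulr_ge0 // sqr_ge0.
by rewrite !addr_ge0 // ?mulr_ge0 ?sqr_ge0 //; lra.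
Qed.

Variables (K : set Y) (D : set (Y -> R)).
Hypotheses (cK : compact K) (D0 : D (fun=> 0))
  (DD : forall g h, D g -> D h -> D (fun y => g y + h y))
  (DZ : forall c g, D g -> D (fun y => c * g y))
  (DM : forall g h, D g -> D h -> D (fun y => g y * h y))
  (Dc : forall g, D g -> cont_on K g).

Let cl f := forall e, 0 < e -> exists2 g, D g & forall y, K y -> `|f y - g y| <= e.

Let cl_in g : D g -> cl g.
Proof. by move=> Dg e e0; exists g => // y _; rewrite subrr normr0 ltW. Qed.

Let clD f g : cl f -> cl g -> cl (fun y => f y + g y).
Proof.
move=> hf hg e e0; have e20 : 0 < e / 2 by lra.
have [f' Df hf'] := hf _ e20; have [g' Dg hg'] := hg _ e20.
exists (fun y => f' y + g' y); first exact: DD.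
move=> y Ky; have := hf' y Ky; have := hg' y Ky; rewrite !ler_norml; lra.
Qed.

Let clZ c f : cl f -> cl (fun y => c * f y).
Proof.
move=> hf e e0; have c1 : 0 < `|c| + 1 by rewrite ltr_wpDl.
have [f' Df hf'] := hf _ (divr_gt0 e0 c1).
exists (fun y => c * f' y); first exact: DZ.
move=> y Ky; rewrite -mulrBr normrM; have := hf' y Ky.
rewrite ler_pdivlMr // mulrC; apply: le_trans.
by rewrite ler_wpM2r // lerDl.
Qed.

Let cl_abs f : cl f -> cl (fun y => `|f y|).
Proof.
move=> hf e e0; have e20 : 0 < e / 2 by lra.
have [g Dg hg] := hf _ e20.
have [M M0 hM] := cont_on_bounded cK (Dc Dg).
pose t y := M^-1 * g y.
have t1 y : K y -> `|t y| <= 1.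
  move=> Ky; rewrite normrM gtr0_norm ?invr_gt0 // mulrC ler_pdivrMr // mul1r.
  exact: hM.
(* [abs_iter] has no constant term and uses only sums, products and scalar multiples, exactly the
   operations under which D is closed. *)
have Du n : D (fun y => abs_iter (t y) n).
  elim: n => [|n IH] //=.
  by apply: DD => //; apply: DZ; apply: DD; [apply: DM; apply: DZ|apply: DZ; apply: DM].
have [N hN] := harm_small_mul (M * 2) e20.
exists (fun y => M * abs_iter (t y) N); first exact: DZ.
move=> y Ky; have /andP[h1 h2] := abs_iterP N (t1 y Ky).
have h3 : `|f y| - `|g y| <= e / 2 by apply: le_trans (lerB_dist _ _) (hg y Ky).
have h3' : `|g y| - `|f y| <= e / 2.
  by apply: le_trans (lerB_dist _ _) _; rewrite distrC; exact: hg.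
have eg : `|g y| = M * `|t y|.
  by rewrite normrM gtr0_norm ?invr_gt0 // mulrA mulfV ?mul1r // gt_eqF.
have h4 : 0 <= M * (`|t y| - abs_iter (t y) N) by rewrite mulr_ge0 // ltW.
have h5 : M * (`|t y| - abs_iter (t y) N) <= M * (2 * harm N) by rewrite ler_pM2l.
rewrite ler_norml; lra.
Qed.

Let cl_ext f g : f =1 g -> cl f -> cl g.
Proof. by move=> /funext ->. Qed.

Let cl_minr f g : cl f -> cl g -> cl (fun y => Num.min (f y) (g y)).
Proof.
move=> hf hg.
have : cl (fun y => 2^-1 * ((f y + g y) + - 1 * `|f y + - 1 * g y|)).
  by apply: clZ; apply: clD; [apply: clD|apply: clZ; apply: cl_abs; apply: clD; [|apply: clZ]].
by apply: cl_ext => y; rewrite mulN1r mulN1r minr_absE // mulrC.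
Qed.

(** A finite minimum described by its universal property; [g0] serves as the value for an empty
    list. *)
Let cl_min (s : seq Y) (G : Y -> Y -> R) g0 : cl g0 -> (forall i, i \in s -> cl (G i)) ->
  exists h, [/\ cl h, forall y, h y <= g0 y, forall i y, i \in s -> h y <= G i y &
    forall y c, c <= g0 y -> (forall i, i \in s -> c <= G i y) -> c <= h y].
Proof.
move=> h0; elim: s => [|i s IH] hs; first by exists g0; split.
have [|h [h1 h2 h3 h4]] := IH; first by move=> j js; apply: hs; rewrite inE js orbT.
exists (fun y => Num.min (h y) (G i y)); split.
- by apply: cl_minr => //; apply: hs; rewrite inE eqxx.
- by move=> y; rewrite ge_min h2.
- move=> j y; rewrite inE ge_min => /orP[/eqP->|/h3->//]; first by rewrite lexx orbT.
- move=> y c c1 c2; rewrite le_min h4 //=; first by apply: c2; rewrite inE eqxx.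
  by move=> j js; apply: c2; rewrite inE js orbT.
Qed.

(** D need not contain the constants: instead f can be interpolated by D at any two points, which
    also covers functions forced to vanish somewhere. Minima of interpolants stay below f + e / 2
    and do not fall below f at a chosen point x; a maximum over finitely many x then approximates
    f. *)
Theorem stone_weierstrass f : cont_on K f ->
  (forall x y, K x -> K y -> exists2 g, D g & g x = f x /\ g y = f y) ->
  forall e, 0 < e -> exists2 g, D g & forall y, K y -> `|f y - g y| <= e.
Proof.
move=> cf sep e e0; have e20 : 0 < e / 2 by lra.
have clf x : exists h, K x -> [/\ cl h, f x <= h x & forall y, K y -> h y < f y + e / 2].
  have [Kx|nKx] := pselect (K x); last by exists f.
  have [G hG] : exists G, forall y, K y -> [/\ D (G y), G y x = f x & G y y = f y].
    have /choice[G hG] : forall y, exists g, K y -> [/\ D g, g x = f x & g y = f y].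
      move=> y; have [Ky|nKy] := pselect (K y); last by exists f.
      by have [g Dg [g1 g2]] := sep x y Kx Ky; exists g.
    by exists G.
  have [|s [sK hs]] := @compact_seq K (fun y => [set z | K z -> G y z < f z + e / 2]) cK.
    move=> y Ky; have [DG _ Gy] := hG y Ky.
    apply: filterS (cont_onB (Dc DG) cf Ky e20) => z h Kz.
    by have := h Kz; rewrite Gy subrr subr0 ltr_norml; lra.
  have [DG Gx _] := hG x Kx.
  have [|h [h1 h2 h3 h4]] := @cl_min s G (G x) (cl_in DG).
    by move=> i /sK/hG[DGi _ _]; exact: cl_in.
  exists h => _; split=> // [|y Ky].
    by apply: h4; [rewrite Gx | move=> i /sK/hG[_ -> _]].
  have [i si Gi] := hs y Ky.
  by apply: le_lt_trans (h3 i y si) (Gi Ky).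
have [G hG] := choice clf.
have clN h : cl h -> cl (fun y => - 1 * h y) by apply: clZ.
have ex x : K x -> exists2 u, D u & forall y, K y -> `|G x y - u y| <= e / 4.
  by move=> /hG[h _ _]; apply: h; lra.
have [|s [sK hs]] := @compact_seq K (fun x => [set z | K z -> f z - e / 2 < G x z]) cK.
  move=> x Kx; have [clG Gx _] := hG x Kx.
  (* G x is only a uniform limit of members of D, so continuity is taken from a nearby u in D. Three
     errors of e / 8 remain below e / 2. *)
  have e80 : 0 < e / 8 by lra.
  have [u Du hu] := clG _ e80.
  apply: filterS (cont_onB (Dc Du) cf Kx e80) => z h Kz.
  by have := h Kz; have := hu z Kz; have := hu x Kx;
     rewrite ltr_norml !ler_norml; lra.
have [[z Kz]|nK] := pselect (exists z, K z); last first.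
  by exists (fun=> 0) => // y Ky; case: nK; exists y.
have [clz _ Gz] := hG z Kz.
(* The maximum of the G x, as the negative of a minimum. *)
have [|h [h1 h2 h3 h4]] := @cl_min s (fun x y => - 1 * G x y) (fun y => - 1 * G z y) (clN _ clz).
  by move=> i /sK/hG[clGi _ _]; exact: clN.
have [u Du hu] := clN _ h1 _ e20.
exists u => // y Ky; have := hu y Ky.
have [i si Gi] := hs y Ky; have := Gi Ky; have := h3 i y si.
have : - (f y + e / 2) <= h y.
  apply: h4; first by have := Gz y Ky; lra.
  by move=> j /sK/hG[_ _ /(_ y Ky)]; lra.
rewrite !ler_norml; lra.
Qed.

End StoneWeierstrass.

Section ContOn.
Context {R : realType} {Y : topologicalType}.
Implicit Types (K : set Y) (f g : Y -> R).

Lemma cont_onP K f :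
  cont_on K f <-> forall x, K x -> f @ within K (nbhs x) --> f x.
Proof.
split=> h x Kx.
  apply/cvgrPdist_lt => e e0; have := h x Kx e e0; apply: filterS => y hy Ky.
  by rewrite distrC; exact: (hy Ky).
move=> e e0; have /cvgrPdist_lt/(_ e e0) hw := h x Kx.
have : nbhs x [set y | K y -> `|f x - f y| < e] by exact: hw.
by apply: filterS => y /= hy Ky; rewrite distrC; exact: hy.
Qed.

Lemma cont_on_cst K (c : R) : cont_on K (fun=> c).
Proof. by apply/cont_onP => x Kx; exact: cvg_cst. Qed.

Lemma cont_onD K f g : cont_on K f -> cont_on K g -> cont_on K (fun y => f y + g y).
Proof.
by move=> /cont_onP hf /cont_onP hg; apply/cont_onP => x Kx; apply: cvgD; auto.
Qed.

Lemma cont_onM K f g : cont_on K f -> cont_on K g -> cont_on K (fun y => f y * g y).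
Proof.
by move=> /cont_onP hf /cont_onP hg; apply/cont_onP => x Kx; apply: cvgM; auto.
Qed.

End ContOn.

(** * Compact subsets of the complex plane and polynomial approximation on the real axis *)

Section ComplexPlane.
Context {R : realType}.
Local Notation C := R[i].

Lemma compact_disc (M : R) : compact ([set z : C | nrm z <= M] : set C^o).
Proof.
pose f (p : R * R) : C^o := p.1 +i* p.2.
have cf : continuous f.
  move=> [a b]; apply/(@cvg_nrmP _ C^o) => e e0.
  have e20 : 0 < e / 2 by lra.
  exists (ball a (e / 2), ball b (e / 2)); first by split; exact: nbhsx_ballx.
  move=> [c d] [/= hc hd]; apply: le_trans (@nrm_le_ReIm R (f (a, b) - f (c, d))) _.
  by move: hc hd; rewrite /ball /= !ltr_norml => hc hd; rewrite [leRHS]splitr lerD // ler_norml; lra.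
have cS := compact_setX (@segment_compact R (- M) M) (@segment_compact R (- M) M).
apply: (subclosed_compact _ (continuous_compact (continuous_subspaceT cf) cS)).
  rewrite -[X in closed X]setCK; apply: open_closedC; rewrite openE => z /= hz.
  apply/(@nbhs_nrmP _ C^o); exists (nrm z - M); first by move/negP: hz; rewrite -ltNge subr_gt0.
  move=> y hy /= hy2; have := @nrmD R C y (z - y); rewrite addrC subrK => h.
  have : nrm z < nrm z by apply: le_lt_trans h _; move: hy hy2; rewrite /nrm; lra.
  by rewrite ltxx.
move=> z /= hz; exists (complex.Re z, complex.Im z); last by case: z hz.
by split; rewrite /= in_itv /= -ler_norml; apply: le_trans hz;
  [apply: ler_Re_nrm | apply: ler_Im_nrm].
Qed.

Lemma closed_nrm (V : normedModType C) (A : set V) :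
  (forall x, ~ A x -> exists2 e : R, 0 < e & forall y, nrm (x - y) < e -> ~ A y) ->
  closed A.
Proof.
move=> h; rewrite -[A]setCK; apply: open_closedC; rewrite openE => x Ax.
by apply/nbhs_nrmP; have [e e0 he] := h x Ax; exists e.
Qed.

Lemma compact_C (K : set C) (M : R) : (forall z, K z -> nrm z <= M) ->
  (forall x, ~ K x -> exists2 e : R, 0 < e & forall y, nrm (x - y) < e -> ~ K y) ->
  compact (K : set C^o).
Proof.
move=> hM hc; apply: (subclosed_compact _ (@compact_disc M)) => //.
exact: (@closed_nrm C^o).
Qed.

Implicit Types (K : set C) (f : C -> C).

Lemma withinP K f : {within (K : set C^o), continuous (f : C^o -> C^o)} <->
  forall x, K x -> forall e : R, 0 < e -> exists2 d : R, 0 < d &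
    forall y, K y -> nrm (x - y) < d -> nrm (f x - f y) <= e.
Proof.
split.
  move=> /subspace_continuousP h x Kx e e0.
  have /(@cvg_nrmP _ C^o)/(_ e e0) := h x Kx.
  move=> /(@nbhs_nrmP _ C^o)[d d0 hd]; exists d => // y Ky hy.
  exact: hd y hy Ky.
move=> h; apply/subspace_continuousP => x Kx; apply/(@cvg_nrmP _ C^o) => e e0.
have [d d0 hd] := h x Kx e e0.
by apply/(@nbhs_nrmP _ C^o); exists d => // y hy Ky; exact: hd.
Qed.

Definition approx K f := forall e : R, 0 < e -> exists q : {poly C},
  forall z, K z -> nrm (f z - q.[z]) <= e.

(** On a set of real numbers, polynomials in the real part form an algebra in which affine functions
    interpolate at two points. K stays a subset of the plane because spectra are such sets. *)
Lemma weierstrass_R (K : set C) (g : C -> R) : compact (K : set C^o) ->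
  (forall z, K z -> complex.Im z = 0) -> cont_on (K : set C^o) g ->
  forall e : R, 0 < e -> exists q : {poly R},
    forall z, K z -> `|g z - q.[complex.Re z]| <= e.
Proof.
move=> cK K0 cg e e0.
pose D := [set h : C^o -> R | exists q : {poly R}, h = fun z => q.[complex.Re z]].
have [|||||x y Kx Ky|_ [q ->] hq] := @stone_weierstrass R C^o K D cK _ _ _ _ _ g cg _ e e0.
- by exists 0; apply/funext => z; rewrite horner0.
- by move=> _ _ [p ->] [q ->]; exists (p + q); apply/funext => z; rewrite hornerD.
- by move=> c _ [p ->]; exists (c *: p); apply/funext => z; rewrite hornerZ.
- by move=> _ _ [p ->] [q ->]; exists (p * q); apply/funext => z; rewrite hornerM.
- move=> _ [p ->]; elim/poly_ind: p => [|p c IH].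
    by rewrite (_ : (fun z => _) = fun=> 0); [exact: cont_on_cst|apply/funext => z; rewrite horner0].
  rewrite (_ : (fun z => _) = fun z : C^o => p.[complex.Re z] * complex.Re z + c).
    apply: cont_onD; last exact: cont_on_cst.
    apply: cont_onM => // z Kz d d0; apply/(@nbhs_nrmP _ C^o); exists d => // y hy _.
    rewrite distrC; apply: le_lt_trans hy.
    by apply: le_trans (ler_Re_nrm _); rewrite ReDc ReNc.
  by apply/funext => z; rewrite hornerMXaddC.
- pose a := complex.Re x; pose b := complex.Re y.
  have [xy|xy] := eqVneq x y.
    by exists (fun=> g x); [exists (g x)%:P; apply/funext => z; rewrite hornerC|rewrite xy].
  have ab : a - b != 0.
    apply: contra xy; rewrite subr_eq0 => /eqP ab.
    by rewrite eq_complex (K0 x) // (K0 y) // eqxx andbT; apply/eqP.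
  pose s := (g x - g y) / (a - b).
  exists (fun z => s * (complex.Re z - b) + g y).
    exists (s *: ('X - b%:P) + (g y)%:P); apply/funext => z.
    by rewrite hornerD hornerZ hornerXsubC hornerC.
  by rewrite -/a -/b subrr mulr0 add0r /s divfK // subrK.
by exists q => z Kz; exact: hq.
Qed.

Lemma weierstrass_C K f : compact (K : set C^o) ->
  (forall z, K z -> complex.Im z = 0) ->
  {within (K : set C^o), continuous (f : C^o -> C^o)} -> approx K f.
Proof.
move=> cK K0 /withinP cf e e0; have e20 : 0 < e / 2 by lra.
have cR : cont_on (K : set C^o) (fun z => complex.Re (f z)).
  move=> x Kx d d0; have d20 : 0 < d / 2 by lra.
  have [r r0 hr] := cf x Kx _ d20.
  apply/(@nbhs_nrmP _ C^o); exists r => // y hy Ky; rewrite distrC -ReNc -ReDc.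
  by apply: le_lt_trans (ler_Re_nrm _) _; apply: le_lt_trans (hr y Ky hy) _; lra.
have cI : cont_on (K : set C^o) (fun z => complex.Im (f z)).
  move=> x Kx d d0; have d20 : 0 < d / 2 by lra.
  have [r r0 hr] := cf x Kx _ d20.
  apply/(@nbhs_nrmP _ C^o); exists r => // y hy Ky; rewrite distrC -ImNc -ImDc.
  by apply: le_lt_trans (ler_Im_nrm _) _; apply: le_lt_trans (hr y Ky hy) _; lra.
have [p hp] := weierstrass_R cK K0 cR e20.
have [q hq] := weierstrass_R cK K0 cI e20.
exists (map_poly (real_complex R) p + 'i *: map_poly (real_complex R) q) => z Kz.
have ez : z = (complex.Re z)%:C by apply/eqP; rewrite eq_complex K0 //= eqxx eqxx.
have := hp z Kz; have := hq z Kz.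
have hz (r : {poly R}) : (map_poly (real_complex R) r).[z] = (r.[complex.Re z])%:C.
  by rewrite {1}ez horner_map.
rewrite hornerD hornerZ !hz /=.
set a := complex.Re z; case: (f z) => u v /= h1 h2.
apply: le_trans (nrm_le_ReIm _) _; rewrite [leRHS]splitr lerD //=.
  by apply: le_trans h2; rewrite le_eqVlt; apply/orP; left; apply/eqP; congr `|_|; ring.
by apply: le_trans h1; rewrite le_eqVlt; apply/orP; left; apply/eqP; congr `|_|; ring.
Qed.

End ComplexPlane.

(** * Continuous functional calculus *)

Section PolynomialOperators.
Context {R : realType}.
Local Notation C := R[i].
Context {V : completeNormedModType C}.
Implicit Types (T : V -> V) (p q : {poly C}).

(** The operator q(T). Operators are plain functions here, so it is written by coefficients and
    iterates. *)
Definition pop T q (x : V) : V := \sum_(i < size q) q`_i *: iter i T x.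

Lemma popE T n q x : (size q <= n)%N -> pop T q x = \sum_(i < n) q`_i *: iter i T x.
Proof.
move=> hn; rewrite /pop (big_ord_widen n (fun i => q`_i *: iter i T x)) //.
rewrite big_mkcond; apply: eq_bigr => i _; case: ltnP => // hi.
by rewrite nth_default // scale0r.
Qed.

Lemma popD T p q x : pop T (p + q) x = pop T p x + pop T q x.
Proof.
rewrite (popE _ _ (size_polyD p q)) (popE T x (leq_maxl (size p) (size q))).
rewrite (popE T x (leq_maxr (size p) (size q))) -big_split /=.
by apply: eq_bigr => i _; rewrite coefD scalerDl.
Qed.

Lemma popZ T (c : C) q x : pop T (c *: q) x = c *: pop T q x.
Proof.
rewrite (popE _ _ (size_scale_leq c q)) scaler_sumr.
by apply: eq_bigr => i _; rewrite coefZ scalerA.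
Qed.

Lemma popN T q x : pop T (- q) x = - pop T q x.
Proof. by rewrite -scaleN1r popZ scaleN1r. Qed.

Lemma popB T p q x : pop T (p - q) x = pop T p x - pop T q x.
Proof. by rewrite popD popN. Qed.

Lemma popC T (c : C) x : pop T c%:P x = c *: x.
Proof. by rewrite (popE _ _ (size_polyC_leq1 c)) big_ord1 coefC. Qed.

Lemma popMX T q x : pop T (q * 'X) x = pop T q (T x).
Proof.
rewrite (@popE _ (size q).+1); last first.
  have [->|q0] := eqVneq q 0; first by rewrite mul0r size_poly0.
  by rewrite size_mulX.
rewrite big_ord_recl coefMX /= scale0r add0r /pop.
by apply: eq_bigr => i _; rewrite coefMX /= add0n -iterS iterSr.
Qed.

Lemma popX T x : pop T 'X x = T x.
Proof. by rewrite -['X]mul1r popMX popC scale1r. Qed.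

Lemma pop1 T x : pop T 1 x = x.
Proof. by rewrite popC scale1r. Qed.

Lemma pop0 T x : pop T 0 x = 0.
Proof. by rewrite popC scale0r. Qed.

End PolynomialOperators.

(** * The spectrum of a self-adjoint operator and the bound of its polynomials *)

Section Spectral.
Context {R : realType}.
Local Notation C := R[i].
Context {V : completeNormedModType C} {W : Type} {form : V -> V -> W}.
Context {X : Type} {phi : X -> V -> V -> C}.
Hypothesis H : ipfam form phi.
Local Notation adj := (is_adjoint form).
Local Notation sipk := (fam_sip H _).
Local Notation bnd := (bnd phi).
Local Notation op_invertible := (op_invertible form).
Implicit Types (p q : {poly C}).

Section Linear.
Variables (T T' : V -> V).
Hypothesis a : adj T T'.

Lemma pop_comm q x : T (pop T q x) = pop T q (T x).
Proof.
rewrite /pop; elim/big_rec2: _ => [|i y z _ <-]; first exact: adj0_arg H _ _ a.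
by rewrite (adjD_arg H _ _ a) (adjZ_arg H _ _ a) -iterS iterSr.
Qed.

Lemma popM p q x : pop T (p * q) x = pop T p (pop T q x).
Proof.
elim/poly_ind: p x => [|p c IH] x; first by rewrite mul0r !pop0.
rewrite mulrDl -mulrA ['X * q]mulrC mulrA mul_polyC !popD popZ popC !popMX IH.
by rewrite pop_comm.
Qed.

Lemma pop_adj q : adj (pop T q) (pop T' (map_poly conjc q)).
Proof.
elim/poly_ind: q => [|q c IH].
  rewrite map_poly0 => x y; rewrite !pop0.
  by apply/(fam_form H) => k; rewrite (sip0l sipk) (sip0r sipk).
rewrite rmorphD rmorphM /= map_polyX map_polyC /= => x y.
have -> : pop T (q * 'X + c%:P) = fun x => (pop T q \o T) x + c *: x.
  by apply/funext => z; rewrite popD popMX popC.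
have -> : pop T' (map_poly conjc q * 'X + (conjc c)%:P) =
    fun x => (T' \o pop T' (map_poly conjc q)) x + conjc c *: x.
  apply/funext => z; rewrite popD popMX popC /=; congr (_ + _).
  rewrite /pop; elim/big_rec2: _ => [|i y' z' _ ->]; last first.
    by rewrite (adjD_arg H _ _ (adj_sym H a)) (adjZ_arg H _ _ (adj_sym H a)) -iterS iterSr.
  by rewrite (adj0_arg H (adj_sym H a)).
exact: (adjD H (adj_comp H IH a) (adjZ H _ (@adj_id _ _ _ _))).
Qed.

Lemma pop_adjointable q : adjointable form (pop T q).
Proof. by exists (pop T' (map_poly conjc q)); exact: pop_adj. Qed.

(** The half of spectral mapping that is needed: q splits into linear factors over [R[i]], and each
    factor is invertible at T. *)
Lemma inv_pop q : q != 0 -> (forall mu, root q mu -> ~ spectrum form T mu) ->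
  op_invertible (pop T q).
Proof.
move=> q0 hq; have [r er] := closed_field_poly_normal q.
have lc0 : lead_coef q != 0 by rewrite lead_coef_eq0.
have hr mu : mu \in r -> op_invertible (pop T ('X - mu%:P)).
  move=> hmu; have : root q mu by rewrite er rootZ // root_prod_XsubC.
  move=> /hq/contrapT; apply: op_inv_ext => x.
  by rewrite popB popX popC.
rewrite er; apply: (@op_inv_ext _ _ _ _ ((fun x => lead_coef q *: x) \o pop T (\prod_(z <- r) ('X - z%:P)))).
  by move=> x /=; rewrite popZ.
apply: (op_inv_comp H); first exact: (op_inv_scale H).
elim: r hr {er} => [|z r IH] hr.
  rewrite big_nil; apply: (@op_inv_ext _ _ _ _ (fun x => 1 *: x)).
    by move=> x; rewrite pop1 scale1r.
  by apply: (op_inv_scale H); rewrite oner_eq0.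
rewrite big_cons; apply: (@op_inv_ext _ _ _ _ (pop T ('X - z%:P) \o pop T (\prod_(j <- r) ('X - j%:P)))).
  by move=> x /=; rewrite popM.
apply: (op_inv_comp H); first by apply: hr; rewrite inE eqxx.
by apply: IH => mu hmu; apply: hr; rewrite inE hmu orbT.
Qed.

End Linear.

(* If [m] is the norm of a self-adjoint B, then m^2 - B^2 is not invertible:
   an inverse bounded by K would give |Bx|^2 <= (m^2 - 1/K) |x|^2. *)
Lemma norm_not_optimal B (m : R) : adj B B -> 0 < m -> bnd B m ->
  op_invertible (fun x => (m ^+ 2)%:C *: x - B (B x)) ->
  exists2 m', 0 <= m' < m & bnd B m'.
Proof.
move=> a m0 hB [S [aS h1 h2]].
have [K0 K00 bS] := adjointable_bnd H aS.
pose K := K0 + 1; have Kp : 0 < K by rewrite ltr_wpDl.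
have {}bS : bnd S K by apply: bnd_weak bS; rewrite lerDl.
have /(adjP H) aP := a.
pose P x := (m ^+ 2)%:C *: x - B (B x).
have adP : adj P P.
  have := adjD H (adjZ H (m ^+ 2)%:C (@adj_id _ _ _ _)) (adjN H (adj_comp H a a)).
  by rewrite conjc_real.
have formP k x : complex.Re (phi k x (P x)) = m ^+ 2 * sn (phi k) x ^+ 2 - sn (phi k) (B x) ^+ 2.
  rewrite (sipDr sipk) (sipNr sipk) (sipZr sipk) ReDc ReNc ReMc.
  by rewrite -aP -!(sn_sqr sipk).
have posP k x : 0 <= complex.Re (phi k x (P x)).
  by rewrite formP subr_ge0 -exprMn ler_pXn2r ?nnegrE ?mulr_ge0 ?sn_ge0 ?(ltW m0) // hB.
(* Cauchy-Schwarz for the form (x, P y) at x and S x, where P S x = x: |x|^4 <= <x, P x> <S x, x> <=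
   <x, P x> K |x|^2. *)
have key k x : sn (phi k) x ^+ 2 <= K * complex.Re (phi k x (P x)).
  have [x0|x0] := eqVneq (sn (phi k) x) 0.
    by rewrite x0 expr0n mulr_ge0 // ltW.
  have xp : 0 < sn (phi k) x ^+ 2 by rewrite exprn_gt0 // lt_neqAle eq_sym x0 sn_ge0.
  have PS : P (S x) = x := h2 x.
  have := sip_CS (sip_pos H adP (posP k)) x (S x); rewrite PS.
  rewrite (sip_q sipk) nrmR -(sn_sqr sipk) (ger0_norm (ltW xp)) => h.
  have h3 : complex.Re (phi k (S x) x) <= K * sn (phi k) x ^+ 2.
    apply: le_trans (Re_le_nrm _) _; apply: le_trans (sn_CS sipk _ _) _.
    by rewrite expr2 mulrA ler_wpM2r ?sn_ge0.
  rewrite -(ler_pM2l xp) -expr2; apply: le_trans h _.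
  rewrite [leRHS](_ : _ = complex.Re (phi k x (P x)) * (K * sn (phi k) x ^+ 2)); last by ring.
  by apply: ler_wpM2l; [exact: posP | exact: h3].
(* The square root is 0 if m^2 < 1 / K, which is harmless: the seminorm of B x is then 0 as well. *)
exists (Num.sqrt (m ^+ 2 - K^-1)).
  rewrite sqrtr_ge0 /= -[ltRHS]ger0_norm ?ltW // -sqrtr_sqr ltr_sqrt ?exprn_gt0 //.
  by rewrite gtrBl invr_gt0.
move=> k x; rewrite -(@ler_pXn2r _ 2) ?nnegrE ?mulr_ge0 ?sn_ge0 ?sqrtr_ge0 //.
rewrite exprMn; have := key k x; rewrite formP mulrC -ler_pdivrMr // => hk.
have h4 : sn (phi k) (B x) ^+ 2 <= (m ^+ 2 - K^-1) * sn (phi k) x ^+ 2 by lra.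
apply: le_trans h4 _; rewrite ler_wpM2r ?sqr_ge0 //.
have [h5|h5] := leP 0 (m ^+ 2 - K^-1); first by rewrite sqr_sqrtr.
by apply: le_trans (ltW h5) (sqr_ge0 _).
Qed.

Section SelfAdjoint.
Variable T : V -> V.
Hypothesis a : adj T T.

Let aP := proj1 (adjP H T T) a.

Lemma adj_sub_scalar l : adj (fun x => T x - l *: x) (fun x => T x - conjc l *: x).
Proof. exact: (adjD H a (adjN H (adjZ H l (@adj_id _ _ _ _)))). Qed.

(** For l = r + i b the product of T - l with its adjoint is (T - r)^2 + b^2, which is at least b^2:
    the mixed term vanishes because <(T - r) x, x> is real. *)
Lemma spectrum_real l : spectrum form T l -> complex.Im l = 0.
Proof.
move=> /spectrumP sl; apply: contrapT => /eqP b0; apply: sl.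
have cE (z : C) : - conjc z = - (complex.Re z)%:C + (complex.Im z) *i.
  by case: z => v w; apply/eqP; rewrite eq_complex /= oppr0 opprK addr0 add0r !eqxx.
set b := complex.Im l in b0; set r := complex.Re l.
have aA := adj_sub_scalar l; set A := fun x => _ in aA *; set A' := fun x => _ in aA.
have aA' : adj A' A by apply: (adj_sym H).
apply: (op_inv_factor H (S := A')); first by exists A.
  move=> x; rewrite /A /A' !(adjB_arg H _ _ a) !(adjZ_arg H _ _ a) !scalerBr !scalerA.
  by rewrite [l * _]mulrC !opprB addrACA [RHS]addrACA [- _ - _]addrC.
have /(adjP H) aAP := aA'.
apply: (pos_invertible H (c := b ^+ 2)); first by rewrite lt_neqAle eq_sym sqrf_eq0 b0 sqr_ge0.
  exact: (adj_comp H aA aA').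
move=> k x /=; rewrite -aAP.
pose u := T x - r%:C *: x.
have -> : A' x = u + (b *i) *: x.
  rewrite /A' /u -addrA; congr (_ + _); rewrite -!scaleNr -scalerDl; congr (_ *: _).
  exact: cE.
rewrite (sip_qD sipk) (sip_qZ sipk) -!(sn_sqr sipk) (sipZr sipk).
have -> : nrm (b *i) ^+ 2 = b ^+ 2 by rewrite nrm_sqr /= expr0n add0r.
have : complex.Im (phi k u x) = 0.
  have := sip_conj (fam_sip H k) u x.
  have -> : phi k x u = phi k u x.
    rewrite /u (sipDr sipk) (sipDl sipk) (sipNr sipk) (sipNl sipk) (sipZr sipk) (sipZl sipk).
    by rewrite aP conjc_real.
  by case: (phi k u x) => v w /= [hw]; lra.
case: (phi k u x) => v w /= ->; rewrite mul0r mulr0 subr0 mulr0 addr0 lerDr.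
by rewrite sqr_ge0.
Qed.

Lemma spectrum_bounded (M : R) l : 0 <= M -> bnd T M -> spectrum form T l -> nrm l <= M.
Proof.
move=> M0 hT /spectrumP sl; rewrite leNgt; apply/negP => hl; apply: sl.
have n0 : 0 < nrm l by apply: le_lt_trans hl.
have l0 : l != 0 by rewrite -nrm_gt0.
have c01 : 0 <= nrm l^-1 * M < 1.
  by rewrite mulr_ge0 ?nrm_ge0 //= nrmV mulrC ltr_pdivrMr // mul1r.
have aB := adjZ H l^-1 a.
have := op_inv_comp H (op_inv_scale H (c := - l) _) (neumann H aB c01 (bndZ H _ hT)).
rewrite oppr_eq0 => /(_ l0); apply: op_inv_ext => x /=.
by rewrite scalerBr scalerA mulNr mulfV // scaleN1r opprK scaleNr addrC.
Qed.

Lemma spectrum_closed l : ~ spectrum form T l ->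
  exists2 e : R, 0 < e & forall m, nrm (l - m) < e -> ~ spectrum form T m.
Proof.
move=> /contrapT[S [aS h1 h2]]; have [S' aSS'] := aS.
have [K K0 bS] := adjointable_bnd H aS.
have e0 : 0 < (K + 1)^-1 by rewrite invr_gt0 ltr_wpDl.
exists (K + 1)^-1 => // m hm; apply.
have c01 : 0 <= nrm (m - l) * K < 1.
  rewrite mulr_ge0 ?nrm_ge0 //= nrm_subC.
  apply: le_lt_trans (_ : nrm (l - m) * (K + 1) < 1); first by rewrite ler_wpM2l ?nrm_ge0 // lerDl.
  by move: hm; rewrite -ltr_pdivlMr ?ltr_wpDl // mul1r.
have := op_inv_comp H _ (neumann H (adjZ H (m - l) aSS') c01 (bndZ H _ bS)).
move=> /(_ (fun x => T x - l *: x)) hh.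
have := hh (ex_intro _ S (And3 aS h1 h2)).
apply: op_inv_ext => x /=.
have aA := adj_sub_scalar l.
have := adjB_arg H x ((m - l) *: S x) aA; rewrite /= => ->.
have := adjZ_arg H (m - l) (S x) aA; rewrite /= => ->.
by rewrite h2 scalerBl opprB addrA subrK.
Qed.

Let real_poly_adj q : map_poly conjc q = q -> adj (pop T q) (pop T q).
Proof. by move=> e; have := pop_adj a q; rewrite e. Qed.

(** The infimum m of all bounds of q(T) is again a bound. If m > c, then m^2 - q^2 has no root in
    the spectrum, so m^2 - q(T)^2 is invertible and [norm_not_optimal] contradicts minimality.
    Invertibility requires that m^2 - q^2 is not the zero polynomial. *)
Let spectral_bound0 q (c : R) : map_poly conjc q = q -> 0 <= c ->
  (forall m : R, 0 < m -> (m ^+ 2)%:C%:P - q ^+ 2 != 0) ->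
  (forall l, spectrum form T l -> nrm q.[l] <= c) -> bnd (pop T q) c.
Proof.
move=> qr c0 hne hq; have aq := real_poly_adj qr.
pose A := [set M : R | 0 <= M /\ bnd (pop T q) M].
have hA : has_inf A.
  split; last by exists 0 => M [].
  have [M M0 hM] := adjointable_bnd H (pop_adjointable a q).
  by exists M.
have m0 : 0 <= inf A by apply: lb_le_inf; [case: hA | move=> M []].
have hm : bnd (pop T q) (inf A).
  move=> k x; apply/ler_addgt0Pl => e e0.
  have s1 : 0 < sn (phi k) x + 1 by rewrite ltr_wpDl // sn_ge0.
  have [M [M0 hM] Me] := inf_adherent (divr_gt0 e0 s1) hA.
  apply: le_trans (hM k x) _.
  apply: le_trans (_ : (inf A + e / (sn (phi k) x + 1)) * sn (phi k) x <= _).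
    by rewrite ler_wpM2r ?sn_ge0 // ltW.
  rewrite mulrDl addrC lerD2r mulrAC ler_pdivrMr // ler_wpM2l ?(ltW e0) //.
  by rewrite lerDl.
have [hle|hlt] := leP (inf A) c; first exact: bnd_weak hm.
have mp : 0 < inf A by apply: le_lt_trans hlt.
exfalso; have [|m' /andP[m'0 m'1] hm'] := norm_not_optimal aq mp hm; last first.
  by have := ge_inf (proj2 hA) (conj m'0 hm' : A m'); rewrite leNgt m'1.
apply: (@op_inv_ext _ _ _ _ (pop T ((inf A ^+ 2)%:C%:P - q ^+ 2))).
  by move=> x; rewrite popB popC expr2 (popM a).
apply: (inv_pop a); first exact: hne.
move=> mu; rewrite /root hornerD hornerN hornerC horner_exp subr_eq0 => /eqP e /hq.
rewrite leNgt => /negP; apply; apply: lt_le_trans hlt _.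
rewrite -(@ler_pXn2r _ 2) ?nnegrE ?nrm_ge0 // -nrmX -e nrmR.
by rewrite ger0_norm // sqr_ge0.
Qed.

(** What remains is q^2 = m^2. Then q(T) is m times an isometry, and m <= c as soon as the spectrum
    has a point. *)
Lemma spectral_bound_real q (c : R) : map_poly conjc q = q -> 0 <= c ->
  (forall l, spectrum form T l -> nrm q.[l] <= c) -> bnd (pop T q) c.
Proof.
move=> qr c0 hq.
have [hne|] := pselect (forall m : R, 0 < m -> (m ^+ 2)%:C%:P - q ^+ 2 != 0).
  exact: spectral_bound0.
move=> /existsNP[m /not_implyP[m0 /negP/negPn/eqP e]].
have [[l sl]|nos] := pselect (exists l, spectrum form T l).
  have hl : q.[l] ^+ 2 = (m ^+ 2)%:C.
    move/eqP: e; rewrite subr_eq0 => /eqP e.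
    by rewrite -horner_exp -e hornerC.
  have mc : m <= c.
    apply: le_trans (hq l sl); rewrite -(@ler_pXn2r _ 2) ?nnegrE ?nrm_ge0 ?(ltW m0) //.
    by rewrite -nrmX hl nrmR ger0_norm // sqr_ge0.
  apply: bnd_weak mc _ => k x.
  have /(adjP H) aq := real_poly_adj qr.
  rewrite -(@ler_pXn2r _ 2) ?nnegrE ?mulr_ge0 ?sn_ge0 ?(ltW m0) // exprMn.
  rewrite (sn_sqr sipk) aq -(popM a) -expr2.
  move/eqP: e; rewrite subr_eq0 => /eqP <-.
  by rewrite popC (sipZr sipk) ReMc -(sn_sqr sipk).
(* With an empty spectrum, the nonconstant polynomial 'X shows T = 0; but 0 is not in the spectrum,
   so 0 is invertible and the space is trivial. *)
have hX : bnd (pop T 'X) 0.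
  apply: spectral_bound0 => //; first by rewrite map_polyX.
    move=> m1 m10; apply/eqP => /(congr1 (fun p : {poly C} => p`_2)).
    rewrite coefB coefC /= -['X^2]mul1r -['X^2]/('X^2) mul1r coefXn /= sub0r coef0.
    by move/eqP; rewrite oppr_eq0 oner_eq0.
  by move=> l sl; case: nos; exists l.
have T0 x : T x = 0.
  apply: (fam_eq0 H) => k; have := hX k x; rewrite mul0r.
  by rewrite popX.
have V0 (x : V) : x = 0.
  have /contrapT[S [[S' aS] h1 h2]] : ~ spectrum form T 0 by move=> s0; apply: nos; exists 0.
  by have := h1 x; rewrite T0 scale0r subr0 (adj0_arg H aS).
move=> k x; rewrite (V0 (pop T q x)) /sn (sip_q0 sipk) sqrtr0.
by rewrite mulr_ge0 // sqrtr_ge0.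
Qed.

(** By |q(T) x|^2 = <x, r(T) x>, where r is q times its conjugate polynomial and hence has real
    coefficients; on the real spectrum r takes the values |q|^2. *)
Lemma spectral_bound q (c : R) : 0 <= c ->
  (forall l, spectrum form T l -> nrm q.[l] <= c) -> bnd (pop T q) c.
Proof.
move=> c0 hq; pose r := map_poly conjc q * q.
have qK : map_poly conjc (map_poly conjc q) = q.
  by rewrite -map_poly_comp /= map_poly_id // => z _ /=; rewrite conjcK.
have : bnd (pop T r) (c ^+ 2).
  apply: spectral_bound_real; first by rewrite /r rmorphM /= qK mulrC.
    by rewrite sqr_ge0.
  move=> l sl; rewrite /r hornerM nrmM.
  have -> : (map_poly conjc q).[l] = conjc q.[l].
    have el : l = conjc l by have := spectrum_real sl; case: l {sl} => u v /= ->; rewrite oppr0.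
    by rewrite {1}el horner_map.
  by rewrite nrm_conj -expr2 ler_pXn2r ?nnegrE ?nrm_ge0 // hq.
move=> h k x; have /(adjP H) aq := pop_adj a q.
rewrite -(@ler_pXn2r _ 2) ?nnegrE ?mulr_ge0 ?sn_ge0 // exprMn.
rewrite (sn_sqr sipk) aq -(popM a) -/r.
apply: le_trans (Re_le_nrm _) _; apply: le_trans (sn_CS sipk _ _) _.
rewrite [X in _ <= _ * X]expr2 mulrCA ler_wpM2l ?sn_ge0 //; exact: h.
Qed.

End SelfAdjoint.
End Spectral.

Section Calculus.
Context {R : realType}.
Local Notation C := R[i].
Context {V : completeNormedModType C} {W : Type} {form : V -> V -> W}.
Context {X : Type} {phi : X -> V -> V -> C}.
Hypothesis H : ipfam form phi.
Local Notation adj := (is_adjoint form).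
Local Notation sipk := (fam_sip H _).
Local Notation bnd := (bnd phi).
Implicit Types (f g : C -> C) (S : V -> V).

(** Only these properties of the spectrum enter the calculus. The interval [0, 1] has them too, for
    T and all its localizations at once, although the spectra differ. *)
Definition spectral_set (K : set C) (T : V -> V) :=
  [/\ forall z, K z -> complex.Im z = 0,
      exists M : R, forall z, K z -> nrm z <= M &
      forall (q : {poly C}) (c : R), 0 <= c ->
        (forall z, K z -> nrm q.[z] <= c) -> bnd (pop T q) c].

(* [S = f(T)]: S is a norm limit of q(T) for polynomials q converging to f
   uniformly on K. *)
Definition fcalc (K : set C) (T : V -> V) f S := forall e : R, 0 < e ->
  exists q : {poly C}, (forall z, K z -> nrm (f z - q.[z]) <= e) /\
    bnd (fun x => S x - pop T q x) e.

Variables (K : set C) (T : V -> V).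
Hypotheses (a : adj T T) (sK : spectral_set K T).

Let K0 z : K z -> complex.Im z = 0.
Proof. by have [h _ _] := sK; exact: h. Qed.

Let bound (q : {poly C}) (c : R) : 0 <= c ->
  (forall z, K z -> nrm q.[z] <= c) -> bnd (pop T q) c.
Proof. by have [_ _ h] := sK; exact: h. Qed.

Let poly_bounded (q : {poly C}) : exists2 M : R, 0 <= M & forall z, K z -> nrm q.[z] <= M.
Proof.
have [_ [M hM] _] := sK.
elim/poly_ind: q => [|q c [N N0 hN]].
  by exists 0 => // z _; rewrite horner0 nrm0.
exists (N * `|M| + nrm c); first by rewrite addr_ge0 ?nrm_ge0 // mulr_ge0.
move=> z Kz; rewrite hornerMXaddC; apply: le_trans (nrmD _ _) _.
rewrite lerD2r nrmM; apply: ler_pM; rewrite ?nrm_ge0 //; first exact: hN.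
exact: le_trans (hM z Kz) (ler_norm _).
Qed.

Lemma fcalc_approx f S : fcalc K T f S -> approx K f.
Proof. by move=> h e e0; have [q [hq _]] := h e e0; exists q. Qed.

Lemma fcalc_bounded f S : fcalc K T f S -> exists2 M : R, 0 <= M & forall z, K z -> nrm (f z) <= M.
Proof.
move=> h; have [q [hq _]] := h 1 ltr01; have [M M0 hM] := poly_bounded q.
exists (1 + M); first by rewrite addr_ge0.
move=> z Kz; have -> : f z = (f z - q.[z]) + q.[z] by rewrite subrK.
by apply: le_trans (nrmD _ _) _; apply: lerD; [exact: hq | exact: hM].
Qed.

Lemma fcalc_ex f : approx K f -> exists S, fcalc K T f S.
Proof.
move=> ha; have [q hq] := choice (fun n => ha (harm n) (harm_gt0 n)).
have dq n m : bnd (fun x => pop T (q n) x - pop T (q m) x) (harm n + harm m).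
  have h : bnd (pop T (q n - q m)) (harm n + harm m).
    apply: bound => [|z Kz]; first by rewrite addr_ge0 // ltW ?harm_gt0.
    rewrite hornerD hornerN.
    have -> : (q n).[z] - (q m).[z] = (f z - (q m).[z]) - (f z - (q n).[z]).
      by ring.
    by apply: le_trans (nrmB _ _) _; rewrite addrC lerD ?hq.
  by apply: bnd_ext h => x; rewrite popB.
have lims x : exists l, forall n, nrm (l - pop T (q n) x) <= 2 * nrm x * harm n.
  apply: (@complete_rate _ _ (fun n => pop T (q n) x) (fun n => 2 * nrm x * harm n)).
    by move=> e e0; exact: harm_small_mul.
  move=> n m nm; have := bnd_nrm H x _ (dq m n).
  have hn := harm_gt0 (R := R) n; have hm := harm_gt0 (R := R) m.
  move=> /(_ (addr_ge0 (ltW hm) (ltW hn))) h; apply: le_trans h _.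
  rewrite mulrAC ler_wpM2r ?nrm_ge0 //; have := harm_mono (R := R) nm; lra.
have [S hS] := choice lims; exists S => e e0.
have [N hN] := @harm_small_mul R 2 e e0.
exists (q N); split.
  move=> z Kz; apply: le_trans (hq N z Kz) _; apply: le_trans hN.
  by have := harm_gt0 (R := R) N; lra.
move=> k x; apply: le_trans (_ : 2 * harm N * sn (phi k) x <= _); last first.
  by rewrite ler_wpM2r ?sn_ge0.
(* [lims] bounds the error by the norm of x only. For a bound by the seminorm at k, q N is compared
   with q n, and n tends to infinity. *)
rewrite -subr_le0; apply: (@harm_le _ _ (2 * nrm x)) => [|n0].
  by rewrite mulr_ge0 ?nrm_ge0.
pose n := maxn n0 N.
have h1 : sn (phi k) (S x - pop T (q n) x) <= 2 * nrm x * harm n.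
  exact: le_trans (sn_nrm H k _) (hS x n).
have h2 := dq n N k x.
have := snD sipk (S x - pop T (q n) x) (pop T (q n) x - pop T (q N) x) (phi := phi k).
rewrite addrA subrK => h3.
have h4 : 2 * nrm x * harm n <= 2 * nrm x * harm n0.
  by rewrite ler_wpM2l ?mulr_ge0 ?nrm_ge0 // harm_mono // leq_maxl.
have h5 : (harm n + harm N) * sn (phi k) x <= 2 * harm N * sn (phi k) x.
  by rewrite ler_wpM2r ?sn_ge0 //; have := harm_mono (R := R) (leq_maxr n0 N); rewrite -/n; lra.
lra.
Qed.

Lemma fcalc_uniq f g S S' : {in K, f =1 g} -> fcalc K T f S -> fcalc K T g S' -> S = S'.
Proof.
move=> fg h h'; apply/funext => x; apply/eqP; rewrite -subr_eq0; apply/eqP.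
apply: (fam_eq0 H) => k; apply: (@harm_le _ _ (4 * sn (phi k) x)) => [|n].
  by rewrite mulr_ge0 ?sn_ge0.
have [q [hq bq]] := h _ (harm_gt0 n); have [q' [hq' bq']] := h' _ (harm_gt0 n).
have b : bnd (pop T (q - q')) (2 * harm n).
  apply: bound => [|z Kz]; first by rewrite mulr_ge0 // ltW ?harm_gt0.
  rewrite hornerD hornerN -(subrK (f z) q.[z]) addrAC -addrA.
  apply: le_trans (nrmD _ _) _; rewrite nrm_subC.
  have := hq z Kz; have := hq' z Kz; rewrite -(fg z) ?inE //.
  by rewrite [_ - q'.[z]]addrC addrC; lra.
have := bq k x; have := bq' k x; have := b k x; rewrite popB.
set u := pop T q x; set v := pop T q' x => h1 h2 h3.
have := snD sipk (S x - u) (u - v) (phi := phi k).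
have := snD sipk (S x - v) (v - S' x) (phi := phi k).
have e1 : S x - u + (u - v) = S x - v by rewrite addrA subrK.
have e2 : S x - v + (v - S' x) = S x - S' x by rewrite addrA subrK.
rewrite e1 e2 -[v - S' x]opprB (snN sipk); lra.
Qed.

Lemma fcalc_poly (q : {poly C}) : fcalc K T (fun z => q.[z]) (pop T q).
Proof.
move=> e e0; exists q; split=> [z _|k x]; first by rewrite subrr nrm0 ltW.
by rewrite subrr /sn (sip_q0 sipk) sqrtr0 mulr_ge0 ?sqrtr_ge0 // ltW.
Qed.

Lemma fcalc_ext f g S : {in K, f =1 g} -> fcalc K T f S -> fcalc K T g S.
Proof.
move=> fg h e e0; have [q [hq bq]] := h e e0; exists q; split=> // z Kz.
by rewrite -fg ?inE // hq.
Qed.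

Lemma fcalc_adj f S S' : fcalc K T f S -> fcalc K T (fun z => conjc (f z)) S' -> adj S S'.
Proof.
move=> h h'; apply/(adjP H) => k x y; apply/eqP; rewrite -subr_eq0 -nrm_eq0.
rewrite eq_le nrm_ge0 andbT.
apply: (@harm_le _ _ (4 * (sn (phi k) x * sn (phi k) y))) => [|n].
  by rewrite !mulr_ge0 ?sn_ge0.
have [q [hq bq]] := h _ (harm_gt0 n); have [q' [hq' bq']] := h' _ (harm_gt0 n).
pose r := map_poly conjc q.
have hr z : K z -> r.[z] = conjc q.[z].
  move=> Kz; have ez : z = conjc z.
    by have := K0 Kz; case: z {Kz} => u v /= ->; rewrite oppr0.
  by rewrite /r {1}ez horner_map.
have b : bnd (pop T (q' - r)) (2 * harm n).
  apply: bound => [|z Kz]; first by rewrite mulr_ge0 // ltW ?harm_gt0.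
  rewrite hornerD hornerN hr //.
  have -> : q'.[z] - conjc q.[z] = - (conjc (f z) - q'.[z]) + conjc (f z - q.[z]).
    by rewrite rmorphB /=; ring.
  apply: le_trans (nrmD _ _) _; rewrite nrmN nrm_conj.
  by have := hq z Kz; have := hq' z Kz; lra.
have /(adjP H) aq := pop_adj H a q.
have := bq k x; have := bq' k y; have := b k y; rewrite popB -/r.
set u := pop T q x; set v := pop T q' y; set w := pop T r y => h1 h2 h3.
have -> : phi k (S x) y - phi k x (S' y) = phi k (S x - u) y + (phi k x (w - v) + phi k x (v - S' y)).
  rewrite (sipDl sipk) !(sipDr sipk) (sipNl sipk) !(sipNr sipk) /u aq -/r -/w.
  ring.
have c1 := sn_CS sipk (S x - u) y (phi := phi k).
have c2 := sn_CS sipk x (w - v) (phi := phi k).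
have c3 := sn_CS sipk x (v - S' y) (phi := phi k).
have t1 : sn (phi k) (S x - u) * sn (phi k) y <= harm n * sn (phi k) x * sn (phi k) y.
  by rewrite ler_wpM2r ?sn_ge0.
have t2 : sn (phi k) x * sn (phi k) (w - v) <= sn (phi k) x * (2 * harm n * sn (phi k) y).
  by rewrite ler_wpM2l ?sn_ge0 // -opprB (snN sipk).
have t3 : sn (phi k) x * sn (phi k) (v - S' y) <= sn (phi k) x * (harm n * sn (phi k) y).
  by rewrite ler_wpM2l ?sn_ge0 // -opprB (snN sipk).
have := nrmD (phi k (S x - u) y) (phi k x (w - v) + phi k x (v - S' y)).
have := nrmD (phi k x (w - v)) (phi k x (v - S' y)).
lra.
Qed.

Lemma approx_conj f : approx K f -> approx K (fun z => conjc (f z)).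
Proof.
move=> h e e0; have [q hq] := h e e0; exists (map_poly conjc q) => z Kz.
have ez : z = conjc z by have := K0 Kz; case: z {Kz} => u v /= ->; rewrite oppr0.
by rewrite {2}ez horner_map /= -rmorphB nrm_conj hq.
Qed.

Lemma fcalc_adjointable f S : fcalc K T f S -> adjointable form S.
Proof.
move=> h; have [S' h'] := fcalc_ex (approx_conj (fcalc_approx h)).
by exists S'; exact: fcalc_adj h h'.
Qed.

Lemma fcalc_conj f S S' : fcalc K T f S -> adj S S' -> fcalc K T (fun z => conjc (f z)) S'.
Proof.
move=> h aS; have [U h'] := fcalc_ex (approx_conj (fcalc_approx h)).
by rewrite (adj_uniq H aS (fcalc_adj h h')).
Qed.

Lemma fcalcD f g S S' : fcalc K T f S -> fcalc K T g S' ->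
  fcalc K T (fun z => f z + g z) (fun x => S x + S' x).
Proof.
move=> h h' e e0; have e20 : 0 < e / 2 by lra.
have [q [hq bq]] := h _ e20; have [q' [hq' bq']] := h' _ e20.
exists (q + q'); split=> [z Kz|].
  rewrite hornerD opprD addrACA [leRHS]splitr; apply: le_trans (nrmD _ _) _.
  by rewrite lerD ?hq ?hq'.
rewrite [e]splitr; apply: bnd_ext (bndD H bq bq') => x /=.
by rewrite popD opprD addrACA.
Qed.

Lemma fcalcZ (c : C) f S : fcalc K T f S -> fcalc K T (fun z => c * f z) (fun x => c *: S x).
Proof.
move=> h e e0; have c0 : 0 < nrm c + 1 by rewrite ltr_wpDl ?nrm_ge0.
have [q [hq bq]] := h _ (divr_gt0 e0 c0).
have le : nrm c * (e / (nrm c + 1)) <= e.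
  by rewrite mulrA ler_pdivrMr // mulrC ler_wpM2l ?(ltW e0) // lerDl.
exists (c *: q); split=> [z Kz|].
  rewrite hornerZ -mulrBr nrmM; apply: le_trans le; rewrite ler_wpM2l ?nrm_ge0 //.
  exact: hq.
apply: bnd_weak le _; apply: bnd_ext (bndZ H c bq) => x.
by rewrite popZ scalerBr.
Qed.

Lemma fcalcM f g S S' : fcalc K T f S -> fcalc K T g S' ->
  fcalc K T (fun z => f z * g z) (S \o S').
Proof.
move=> h h' e e0; have e20 : 0 < e / 2 by lra.
have aS := fcalc_adjointable h; have [F F0 hF] := fcalc_bounded h.
have [M M0 bS] := adjointable_bnd H aS.
have N10 : 0 < M + F + 1 by rewrite ltr_wpDl // addr_ge0.
(* The order of choices matters: the tolerance for q' depends on bounds of S and f, and that for q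
   on a bound G of the chosen q'. *)
have [q' [hq' bq']] := h' _ (divr_gt0 e20 N10).
have [G G0 hG] := poly_bounded q'.
have G10 : 0 < G + 1 by rewrite ltr_wpDl.
have [q [hq bq]] := h _ (divr_gt0 e20 G10).
have l1 (c d : R) : 0 <= c -> c <= d -> 0 < d -> c * (e / 2 / d) <= e / 2.
  by move=> c0 cd d0; rewrite mulrA ler_pdivrMr // mulrC ler_wpM2l // ltW.
have lM : M * (e / 2 / (M + F + 1)) <= e / 2 by apply: l1 => //; lra.
have lF : F * (e / 2 / (M + F + 1)) <= e / 2 by apply: l1 => //; lra.
have lG : G * (e / 2 / (G + 1)) <= e / 2 by apply: l1 => //; lra.
exists (q * q'); split=> [z Kz|].
  have -> : f z * g z - (q * q').[z] = f z * (g z - q'.[z]) + (f z - q.[z]) * q'.[z].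
    by rewrite hornerM; ring.
  apply: le_trans (nrmD _ _) _; rewrite !nrmM [leRHS]splitr; apply: lerD.
    by apply: le_trans lF; apply: ler_pM; rewrite ?nrm_ge0 ?hF ?hq'.
  by apply: le_trans lG; rewrite mulrC; apply: ler_pM; rewrite ?nrm_ge0 ?hG ?hq.
have b1 := bnd_comp M0 bS bq'.
have b2 := bnd_comp (ltW (divr_gt0 e20 G10)) bq (bound G0 hG).
have le3 : M * (e / 2 / (M + F + 1)) + e / 2 / (G + 1) * G <= e.
  by rewrite [leRHS]splitr (mulrC _ G) lerD.
apply: bnd_weak le3 _; apply: bnd_ext (bndD H b1 b2).
move=> x /=; case: aS => S1 aS1; rewrite (adjB_arg H _ _ aS1) (popM H a).
by rewrite addrA subrK.
Qed.

End Calculus.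
Arguments fcalc {R V X} phi K T f S.
Arguments spectral_set {R V X} phi K T.

(** * Continuous functions on the unit interval of the real axis *)

Section UnitInterval.
Context {R : realType}.
Local Notation C := R[i].
Implicit Types (F G : R -> R) (f g : C -> C).

Definition itv01 : set R := [set t | 0 <= t <= 1].
Definition I01 : set C := [set z | complex.Im z = 0 /\ itv01 (complex.Re z)].
Definition lift F (z : C) : C := (F (complex.Re z))%:C.

Lemma I01P z : I01 z -> z = (complex.Re z)%:C /\ 0 <= complex.Re z <= 1.
Proof. by case: z => u v [/= -> h]. Qed.

Lemma compact_I01 : compact (I01 : set C^o).
Proof.
apply: (@compact_C _ _ 1) => [z /I01P[-> /andP[h0 h1]]|x nx].
  by rewrite nrmR ger0_norm.
have dist y : I01 y -> nrm (x - y) <= 0 -> I01 x.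
  move=> Iy h; suff -> : x = y by [].
  by apply/eqP; rewrite -subr_eq0 -nrm_eq0 eq_le h nrm_ge0.
set r := complex.Re x; set s := complex.Im x.
have Re_lt y : nrm (x - y) < `|r - complex.Re y| -> False.
  by apply/negP; rewrite -leNgt; apply: le_trans (ler_Re_nrm _); rewrite ReDc ReNc.
have Im_lt y : nrm (x - y) < `|s - complex.Im y| -> False.
  by apply/negP; rewrite -leNgt; apply: le_trans (ler_Im_nrm _); rewrite ImDc ImNc.
have [s0|sn0] := eqVneq s 0; last first.
  exists `|s|; first by rewrite normr_gt0.
  by move=> y hy [y0 _]; apply: (Im_lt y); rewrite y0 subr0.
have [r0|r0] := ltP r 0.
  exists (- r); first by rewrite oppr_gt0.
  move=> y hy [_ /andP[y0 _]]; apply: (Re_lt y); apply: lt_le_trans hy _.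
  by rewrite ler0_norm; lra.
have [r1|r1] := ltP 1 r; last by case: nx; split=> //; rewrite /itv01 /= r0 r1.
exists (r - 1); first by rewrite subr_gt0.
move=> y hy [_ /andP[_ y1]]; apply: (Re_lt y); apply: lt_le_trans hy _.
by rewrite ger0_norm; lra.
Qed.

Lemma lift_within F : cont_on itv01 F ->
  {within (I01 : set C^o), continuous (lift F : C^o -> C^o)}.
Proof.
move=> h; apply/withinP => x [x0 xI] e e0.
have /nbhs_ballP[d /= d0 hd] := h _ xI e e0.
exists d => // y [y0 yI] hy; rewrite /lift -rmorphB nrmR distrC; apply: ltW.
apply: hd => //; rewrite /ball /= -ReNc -ReDc.
exact: le_lt_trans (ler_Re_nrm _) hy.
Qed.

Lemma withinD (K : set C) f g :
  {within (K : set C^o), continuous (f : C^o -> C^o)} ->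
  {within (K : set C^o), continuous (g : C^o -> C^o)} ->
  {within (K : set C^o), continuous ((fun z => f z + g z) : C^o -> C^o)}.
Proof.
move=> /subspace_continuousP hf /subspace_continuousP hg; apply/subspace_continuousP => x Kx.
exact: (@cvgD _ C^o _ _ _ _ _ _ _ (hf x Kx) (hg x Kx)).
Qed.

Lemma withinM (K : set C) f g :
  {within (K : set C^o), continuous (f : C^o -> C^o)} ->
  {within (K : set C^o), continuous (g : C^o -> C^o)} ->
  {within (K : set C^o), continuous ((fun z => f z * g z) : C^o -> C^o)}.
Proof.
move=> /subspace_continuousP hf /subspace_continuousP hg; apply/subspace_continuousP => x Kx.
exact: (@cvgM C C^o _ _ _ _ _ _ (hf x Kx) (hg x Kx)).
Qed.

Lemma within_cst (K : set C) (c : C) :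
  {within (K : set C^o), continuous ((fun=> c) : C^o -> C^o)}.
Proof. by apply/withinP => x Kx e e0; exists 1 => // y _ _; rewrite subrr nrm0 ltW. Qed.

Lemma within_id (K : set C) : {within (K : set C^o), continuous (id : C^o -> C^o)}.
Proof. by apply/withinP => x Kx e e0; exists e => // y _ /ltW. Qed.

Lemma within_horner (K : set C) (q : {poly C}) :
  {within (K : set C^o), continuous ((fun z => q.[z]) : C^o -> C^o)}.
Proof.
elim/poly_ind: q => [|q c IH].
  by rewrite (_ : (fun z => _) = fun=> 0); [exact: within_cst|apply/funext => z; rewrite horner0].
rewrite (_ : (fun z => _) = fun z => q.[z] * z + c); last first.
  by apply/funext => z; rewrite hornerMXaddC.
exact: (withinD (withinM IH (@within_id K)) (@within_cst K c)).
Qed.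

Lemma within_comp (K : set C) f (G : C -> C) :
  {within (K : set C^o), continuous (f : C^o -> C^o)} ->
  (forall x (e : R), 0 < e -> exists2 d : R, 0 < d &
    forall y, nrm (x - y) < d -> nrm (G x - G y) <= e) ->
  {within (K : set C^o), continuous ((fun z => G (f z)) : C^o -> C^o)}.
Proof.
move=> /withinP hf hG; apply/withinP => x Kx e e0.
have [d d0 hd] := hG (f x) e e0; have d20 : 0 < d / 2 by lra.
have [r r0 hr] := hf x Kx _ d20.
exists r => // y Ky hy; apply: hd; apply: le_lt_trans (hr y Ky hy) _; lra.
Qed.

Lemma within_nrm (K : set C) f (F : R -> R) : continuous F ->
  {within (K : set C^o), continuous (f : C^o -> C^o)} ->
  {within (K : set C^o), continuous ((fun z => (F (nrm (f z)))%:C) : C^o -> C^o)}.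
Proof.
move=> cF cf; apply: (@within_comp K f (fun w => (F (nrm w))%:C)) => // x e e0.
have /cvgrPdist_le/(_ e e0)/nbhs_ballP[d /= d0 hd] := cF (nrm x).
exists d => // y hy; rewrite -rmorphB nrmR; apply: hd.
rewrite /ball /=; apply: le_lt_trans hy; rewrite ler_norml.
have h1 := nrm_tri y x 0; have h2 := nrm_tri x y 0; move: h1 h2.
by rewrite !subr0 (nrm_subC y x) lerBlDr; lra.
Qed.

End UnitInterval.
Arguments I01 {R}.
Arguments itv01 {R}.

(** * Existence of the functional calculus and its agreement with limits of polynomials *)

Section CalculusExistence.
Context {R : realType}.
Local Notation C := R[i].
Context {V : completeNormedModType C} {W : Type} {form : V -> V -> W}.
Context {X : Type} {phi : X -> V -> V -> C}.
Hypothesis H : ipfam form phi.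
Local Notation adj := (is_adjoint form).
Local Notation sipk := (fam_sip H _).
Local Notation bnd := (bnd phi).
Local Notation spectral_set := (@spectral_set _ _ _ phi).
Local Notation fcalc := (@fcalc _ _ _ phi).

Section General.
Variable T : V -> V.
Hypothesis a : adj T T.

Lemma spectrum_spectral : spectral_set (spectrum form T) T.
Proof.
have aT : adjointable form T by exists T.
have [M M0 hM] := adjointable_bnd H aT; split.
- by move=> z; apply: (spectrum_real H a).
- by exists M => z; apply: (spectrum_bounded H a M0 hM).
- by move=> q c c0; apply: (spectral_bound H a).
Qed.

Lemma spectrum_compact : compact (spectrum form T : set C^o).
Proof.
have [h0 [M hM] _] := spectrum_spectral.
by apply: (compact_C hM) => x; apply: (spectrum_closed H a).
Qed.

(** [calculus] selects among the values of all calculi, so nothing can be said of it without one.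
    Here each value is a limit of polynomials in T, and the algebraic identities survive the
    limit. *)
Lemma is_calculus_ex : exists Phi, is_calculus form T Phi.
Proof.
have sK := spectrum_spectral; have cK := spectrum_compact.
pose Phi f : V -> V := get [set S | fcalc (spectrum form T) T f S].
have ex f : approx (spectrum form T) f -> fcalc (spectrum form T) T f (Phi f).
  by move=> /(fcalc_ex H sK)[S hS]; exact: (@getPex _ [set S | fcalc (spectrum form T) T f S] (ex_intro _ S hS)).
have PhiP f : continuous_on_spectrum form T f -> fcalc (spectrum form T) T f (Phi f).
  by move=> cf; apply: ex; apply: weierstrass_C cf => //; case: sK.
have uniq f S : fcalc (spectrum form T) T f S -> Phi f = S.
  move=> h; have h' := ex f (fcalc_approx h).
  by apply: (fcalc_uniq H sK _ h' h).
exists Phi; split.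
- move=> f g /PhiP hf /PhiP hg fg; exact: (fcalc_uniq H sK fg hf hg).
- by move=> f g /PhiP hf /PhiP hg x; rewrite (uniq _ _ (fcalcD H hf hg)).
- by move=> l f /PhiP hf x; rewrite (uniq _ _ (fcalcZ H l hf)).
- by move=> f g /PhiP hf /PhiP hg x; rewrite (uniq _ _ (fcalcM H a sK hf hg)).
- move=> f /PhiP hf.
  apply: (fcalc_adj H a sK hf); apply: ex; apply: (approx_conj sK).
  exact: fcalc_approx hf.
- move=> x; have := @fcalc_poly _ _ _ _ _ _ H (spectrum form T) T 1.
  move=> h; rewrite (uniq _ (pop T 1)) ?pop1 //.
  by apply: fcalc_ext h => z _; rewrite hornerC.
- move=> x; have := @fcalc_poly _ _ _ _ _ _ H (spectrum form T) T 'X.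
  move=> h; rewrite (uniq _ (pop T 'X)) ?popX //.
  by apply: fcalc_ext h => z _; rewrite hornerX.
Qed.

Local Notation cos := (continuous_on_spectrum form T).

Let csD f g : cos f -> cos g -> cos (fun z => f z + g z).
Proof. exact: withinD. Qed.

Let csM f g : cos f -> cos g -> cos (fun z => f z * g z).
Proof. exact: withinM. Qed.

Let cs_cst c : cos (fun=> c).
Proof. exact: within_cst. Qed.

Let cs_id : cos (fun z => z).
Proof. exact: within_id. Qed.

Let cs_horner q : cos (fun z => q.[z]).
Proof. exact: within_horner. Qed.

Lemma calculus_poly Phi (q : {poly C}) x : is_calculus form T Phi ->
  Phi (fun z => q.[z]) x = pop T q x.
Proof.
move=> hPhi.
have Phic (c : C) y : Phi (fun=> c) y = c *: y.
  have := calculusZ hPhi c (@cs_cst 1) y; rewrite (calculus1 hPhi) => <-.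
  by have -> : (fun t : C => c * 1) = (fun=> c) by apply: funext => t; rewrite mulr1.
elim/poly_ind: q x => [|q c IH] x.
  have -> : (fun z : C => (0 : {poly C}).[z]) = fun=> 0.
    by apply: funext => z; rewrite horner0.
  by rewrite pop0 Phic scale0r.
have -> : (fun z : C => (q * 'X + c%:P).[z]) = fun z => q.[z] * z + c.
  by apply: funext => z; rewrite hornerMXaddC.
rewrite (calculusD hPhi (csM (@cs_horner q) cs_id) (@cs_cst c)).
by rewrite (calculusM hPhi (@cs_horner q) cs_id) IH (calculus_id hPhi) Phic popD popMX popC.
Qed.

(** [is_calculus] assumes no continuity of Phi, yet Phi is contractive: if |h| <= e on the spectrum,
    then e^2 - |h|^2 = g^2 for a continuous real g, and |Phi(h) x|^2 + |Phi(g) x|^2 = e^2 |x|^2. It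
    is applied to h = f - q. *)
Lemma calculus_bound Phi f (q : {poly C}) (e : R) : is_calculus form T Phi ->
  cos f -> 0 <= e ->
  (forall z, spectrum form T z -> nrm (f z - q.[z]) <= e) ->
  bnd (fun x => Phi f x - pop T q x) e.
Proof.
move=> hPhi cf e0 hfq.
pose h z := f z + (-1) * q.[z].
have cq1 : cos (fun z => (-1) * q.[z]) by exact: (csM (@cs_cst (-1)) (@cs_horner q)).
have ch : cos h by exact: (csD cf cq1).
have Ph x : Phi h x = Phi f x - pop T q x.
  rewrite (calculusD hPhi cf cq1) (calculusZ hPhi (-1) (@cs_horner q)).
  by rewrite (calculus_poly _ _ hPhi) scaleN1r.
(* Continuous on the whole line, since the square root is 0 on negative numbers. *)
pose F (t : R) := Num.sqrt (e ^+ 2 - t ^+ 2).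
have cF : continuous F.
  move=> t; apply: (@continuous_comp _ _ _ (fun t : R => e ^+ 2 - t ^+ 2)).
    by apply: cvgB; [exact: cvg_cst | apply: exprn_continuous].
  exact: sqrt_continuous.
pose g z := (F (nrm (h z)))%:C.
have cg : cos g by exact: (within_nrm cF ch).
have cgc : cos (fun z => conjc (g z)).
  have -> : (fun z => conjc (g z)) = g by apply: funext => z; exact: conjc_real.
  exact: cg.
have chc : cos (fun z => conjc (h z)).
  apply: (@within_comp _ _ h conjc ch) => x d d0; exists d => // y hy.
  by rewrite -rmorphB nrm_conj ltW.
have chh := csM chc ch; have cgg := csM cgc cg.
have sum1 x : Phi (fun z => conjc (h z)) (Phi h x) + Phi (fun z => conjc (g z)) (Phi g x) = (e ^+ 2)%:C *: x.
  rewrite -(calculusM hPhi chc ch) -(calculusM hPhi cgc cg) -(calculusD hPhi chh cgg).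
  have := calculusZ hPhi (e ^+ 2)%:C (@cs_cst 1) x; rewrite (calculus1 hPhi) => <-.
  apply: (congr1 (fun S => S x)); apply: (calculus_ext hPhi (csD chh cgg) (@cs_cst _)).
  move=> z; rewrite inE => /hfq hz; rewrite !mul_conj mulr1 -rmorphD /=.
  congr (_%:C); rewrite nrmR real_normK ?num_real // sqr_sqrtr; first by rewrite addrC subrK.
  rewrite subr_ge0 ler_pXn2r ?nnegrE ?nrm_ge0 //.
  by rewrite /h mulN1r.
move=> k x; rewrite -Ph -(@ler_pXn2r _ 2) ?nnegrE ?mulr_ge0 ?sn_ge0 // exprMn.
have /(adjP H) a1 := calculus_star hPhi ch; have /(adjP H) a2 := calculus_star hPhi cg.
rewrite !(sn_sqr sipk) -[e ^+ 2 * _]ReMc -(sipZr sipk) -sum1 (sipDr sipk) ReDc a1 lerDl.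
by rewrite -a2 (sip_q_ge0 sipk).
Qed.

(** Contractivity makes every calculus agree with the polynomial limit, so the selection made in
    [calculus] is immaterial. K may be larger than the spectrum, provided f is continuous on all of
    it. *)
Lemma calculus_fcalc (K : set C) f : spectral_set K T ->
  spectrum form T `<=` K -> approx K f ->
  {within (K : set C^o), continuous (f : C^o -> C^o)} ->
  fcalc K T f (calculus form T f).
Proof.
move=> sK subK af cf; have [Phi0 hPhi0] := is_calculus_ex.
have [Phi hPhi ->] : exists2 Phi, is_calculus form T Phi & calculus form T f = Phi f.
  apply: (@getPex _ [set S | exists2 Phi, is_calculus form T Phi & S = Phi f]).
  by exists (Phi0 f), Phi0.
have cf' : continuous_on_spectrum form T f by exact: continuous_subspaceW cf.
move=> e e0; have [q hq] := af e e0; exists q; split=> //.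
by apply: calculus_bound => //; [exact: ltW | move=> z /subK; exact: hq].
Qed.

End General.

(** 0 <= T <= 1 in terms of quadratic forms, a condition that passes to localizations by density. *)
Definition pos1 (T : V -> V) :=
  adj T T /\ forall k x, 0 <= complex.Re (phi k x (T x)) <= sn (phi k) x ^+ 2.

Lemma spectrum_I01 T : pos1 T -> spectrum form T `<=` I01.
Proof.
move=> [a h] l sl; have l0 := spectrum_real H a sl.
have aA := adj_sub_scalar H a l.
have cl : conjc l = l by case: l l0 {sl aA} => u v /= ->; rewrite oppr0.
rewrite cl in aA.
have el : l = (complex.Re l)%:C by case: l l0 {sl aA cl} => u v /= ->.
have fA k x : complex.Re (phi k x (T x - l *: x)) =
    complex.Re (phi k x (T x)) - complex.Re l * sn (phi k) x ^+ 2.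
  by rewrite (sipDr sipk) (sipNr sipk) (sipZr sipk) ReDc ReNc {1}el ReMc -(sn_sqr sipk).
split=> //; apply/andP; split; rewrite leNgt; apply/negP => hl; apply: sl.
  apply: (pos_invertible H (c := - complex.Re l)) => //; first by rewrite oppr_gt0.
  by move=> k x; rewrite fA; have /andP[h1 _] := h k x; lra.
have i1 : op_invertible form (fun x => - (T x - l *: x)).
  apply: (pos_invertible H (c := complex.Re l - 1)); first by rewrite subr_gt0.
    exact: (adjN H aA).
  move=> k x; rewrite (sipNr sipk) ReNc fA; have /andP[_ h1] := h k x.
  by rewrite mulrBl mul1r; lra.
have n1 : (-1 : C) != 0 by rewrite oppr_eq0 oner_eq0.
apply: op_inv_ext (op_inv_comp H (op_inv_scale H n1) i1) => x /=.
by rewrite scaleN1r opprK.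
Qed.

Lemma spectral_I01 T : pos1 T -> spectral_set I01 T.
Proof.
move=> hT; have sub := spectrum_I01 hT; have [a _] := hT.
split; first by move=> z [].
  by exists 1 => z /I01P[-> /andP[h0 h1]]; rewrite nrmR ger0_norm.
by move=> q c c0 hq; apply: (spectral_bound H a) => // l /sub; exact: hq.
Qed.

Lemma approx_I01 (f : C -> C) :
  {within (I01 : set C^o), continuous (f : C^o -> C^o)} -> approx I01 f.
Proof. by apply: weierstrass_C; [exact: compact_I01 | move=> z []]. Qed.

Lemma calculus_I01 T f : pos1 T ->
  {within (I01 : set C^o), continuous (f : C^o -> C^o)} ->
  fcalc I01 T f (calculus form T f).
Proof.
move=> hT cf; have [a _] := hT; apply: calculus_fcalc => //.
- exact: spectral_I01.
- exact: spectrum_I01.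
- exact: approx_I01.
Qed.

Lemma fcalc_lift_adj T F B : pos1 T -> fcalc I01 T (lift F) B -> adj B B.
Proof.
move=> hT h; have [a _] := hT.
apply: (fcalc_adj H a (spectral_I01 hT) h); apply: fcalc_ext h => z _.
by rewrite /lift conjc_real.
Qed.

(** The root Q supplies positivity, and the factorization B = Q Q is the form in which the trace
    lemmas take a positive operator. *)
Lemma fcalc_sqrt T F B : pos1 T -> cont_on itv01 F ->
  (forall t, itv01 t -> 0 <= F t) -> fcalc I01 T (lift F) B ->
  exists Q, [/\ adj Q Q, B = Q \o Q & fcalc I01 T (lift (fun t => Num.sqrt (F t))) Q].
Proof.
move=> hT cF F0 h; have [a _] := hT; have sK := spectral_I01 hT.
have cs : cont_on itv01 (fun t => Num.sqrt (F t)).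
  move/cont_onP: cF => cF; apply/cont_onP => x xI.
  exact: (continuous_cvg _ (@sqrt_continuous R (F x)) (cF x xI)).
have [Q hQ] := fcalc_ex H sK (approx_I01 (lift_within cs)).
have aQ := fcalc_lift_adj hT hQ.
exists Q; split=> //.
apply: (fcalc_uniq H sK _ h (fcalcM H a sK hQ hQ)) => z; rewrite inE => -[_ zI].
by rewrite /lift -rmorphM /= -expr2 sqr_sqrtr // F0.
Qed.

Lemma fcalc_ge0 T F B k x : pos1 T -> cont_on itv01 F ->
  (forall t, itv01 t -> 0 <= F t) -> fcalc I01 T (lift F) B ->
  0 <= complex.Re (phi k x (B x)).
Proof.
move=> hT cF F0 h; have [Q [/(adjP H) aQ -> _]] := fcalc_sqrt hT cF F0 h.
by rewrite /= -aQ (sip_q_ge0 sipk).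
Qed.

Lemma fcalc_id T : fcalc I01 T id T.
Proof.
have := @fcalc_poly _ _ _ _ _ _ H I01 T 'X.
have -> : pop T 'X = T by apply/funext => x; rewrite popX.
by apply: fcalc_ext => z _; rewrite hornerX.
Qed.

Lemma fcalc1 T : fcalc I01 T (fun=> 1) id.
Proof.
have := @fcalc_poly _ _ _ _ _ _ H I01 T 1.
have -> : pop T 1 = id by apply/funext => x; rewrite pop1.
by apply: fcalc_ext => z _; rewrite hornerC.
Qed.

Lemma fcalc_le T F G B D k x : pos1 T -> cont_on itv01 F -> cont_on itv01 G ->
  (forall t, itv01 t -> F t <= G t) ->
  fcalc I01 T (lift F) B -> fcalc I01 T (lift G) D ->
  complex.Re (phi k x (B x)) <= complex.Re (phi k x (D x)).
Proof.
move=> hT cF cG FG hB hD; rewrite -subr_ge0 -ReNc -ReDc -(sipNr sipk) -(sipDr sipk).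
apply: (@fcalc_ge0 T (fun t => G t - F t) (fun x => D x - B x)) => //.
- exact: cont_onB.
- by move=> t /FG; rewrite subr_ge0.
have := fcalcD H hD (fcalcZ H (-1) hB).
have -> : (fun x => D x + -1 *: B x) = fun x => D x - B x.
  by apply/funext => y; rewrite scaleN1r.
by apply: fcalc_ext => z _; rewrite /lift mulN1r rmorphB.
Qed.

Lemma fcalc_pos1 T F B : pos1 T -> cont_on itv01 F ->
  (forall t, itv01 t -> 0 <= F t <= 1) -> fcalc I01 T (lift F) B -> pos1 B.
Proof.
move=> hT cF F01 h; split; first exact: fcalc_lift_adj h.
move=> k x; apply/andP; split.
  by apply: fcalc_ge0 h => // t /F01/andP[].
rewrite (sn_sqr sipk); have h1 : fcalc I01 T (lift (fun=> 1)) id.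
  by apply: fcalc_ext (fcalc1 T) => z _.
apply: (fcalc_le k x hT cF (@cont_on_cst _ _ _ 1) _ h h1).
by move=> t /F01/andP[].
Qed.

(** Needed because |S|^p is built by two successive calculi, of the adjoint of S times S and then of
    |S|. Polynomials in B = G(T) are functions of T, and f is a limit of polynomials. *)
Lemma fcalc_comp T G B f S : pos1 T -> fcalc I01 T (lift G) B ->
  (forall t, itv01 t -> itv01 (G t)) -> fcalc I01 B f S ->
  fcalc I01 T (fun z => f (lift G z)) S.
Proof.
move=> hT hB G01 hS e e0; have e20 : 0 < e / 2 by lra.
have [a _] := hT; have sK := spectral_I01 hT.
have [q [hq bq]] := hS _ e20.
have hqB : fcalc I01 T (fun z => q.[lift G z]) (pop B q).
  elim/poly_ind: q {hq bq} => [|q c IH].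
    have := fcalcZ H 0 (fcalc1 T).
    have -> : (fun x => 0 *: id x) = pop B 0 by apply/funext => x; rewrite pop0 scale0r.
    by apply: fcalc_ext => z _; rewrite horner0 mul0r.
  have := fcalcD H (fcalcM H a sK IH hB) (fcalcZ H c (fcalc1 T)).
  have -> : (fun x => (pop B q \o B) x + c *: id x) = pop B (q * 'X + c%:P).
    by apply/funext => x; rewrite popD popMX popC.
  by apply: fcalc_ext => z _; rewrite hornerMXaddC mulr1.
have [r [hr br]] := hqB _ e20; exists r; split.
  move=> z Iz; have -> : f (lift G z) - r.[z] = (f (lift G z) - q.[lift G z]) + (q.[lift G z] - r.[z]).
    by rewrite addrA subrK.
  rewrite [leRHS]splitr; apply: le_trans (nrmD _ _) _; apply: lerD; last exact: hr.
  by apply: hq; case: Iz => _ zI; split=> //; exact: G01.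
rewrite [e]splitr; apply: bnd_ext (bndD H bq br) => x /=.
by rewrite addrA subrK.
Qed.

End CalculusExistence.
Arguments pos1 {R V W} form {X} phi T.

(** * Characters of commutative C*-algebras *)

Section CommutativeCstar.
Context {R : realType} {A : commCstarType R}.
Local Notation C := R[i].
Implicit Types (x y a b : A) (N : A -> R).

Lemma cmulDl a b c : cmul (a + b) c = cmul a c + cmul b c.
Proof. by rewrite cmulC cmulDr !(cmulC c). Qed.

Lemma cmulZl (l : C) a b : cmul (l *: a) b = l *: cmul a b.
Proof. by rewrite cmulC cmulZr cmulC. Qed.

Lemma cmulNr a b : cmul a (- b) = - cmul a b.
Proof. by rewrite -scaleN1r cmulZr scaleN1r. Qed.

Lemma cmulNl a b : cmul (- a) b = - cmul a b.
Proof. by rewrite cmulC cmulNr cmulC. Qed.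

Lemma cmulBr a b c : cmul a (b - c) = cmul a b - cmul a c.
Proof. by rewrite cmulDr cmulNr. Qed.

Lemma cmulBl a b c : cmul (a - b) c = cmul a c - cmul b c.
Proof. by rewrite cmulDl cmulNl. Qed.

Lemma cmulCA a b c : cmul a (cmul b c) = cmul b (cmul a c).
Proof. by rewrite !cmulA (cmulC a b). Qed.

Lemma cmulACA a b c d : cmul (cmul a b) (cmul c d) = cmul (cmul a c) (cmul b d).
Proof. by rewrite -!cmulA (cmulCA b). Qed.

Lemma nrm_cmul a b : nrm (cmul a b) <= nrm a * nrm b.
Proof. by rewrite -lecR rmorphM /= -!nrmE; exact: cnormM. Qed.

Lemma nrm_cstar_id a : nrm (cmul (cstar a) a) = nrm a ^+ 2.
Proof. by apply: complexI; rewrite rmorphXn /= -!nrmE; exact: cstar_identity. Qed.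

(** By commutativity the C*-identity for a a involves the square of the self-adjoint element a^* a,
    to which the identity applies twice more. *)
Lemma nrm_cmul_sq a : nrm (cmul a a) = nrm a ^+ 2.
Proof.
apply/eqP; rewrite -(@eqrXn2 _ 2) ?nrm_ge0 ?sqr_ge0 //; apply/eqP.
rewrite -(nrm_cstar_id (cmul a a)) cstarM cmulACA.
have e : cstar (cmul (cstar a) a) = cmul (cstar a) a by rewrite cstarM cstarK.
by rewrite -{1}e !nrm_cstar_id.
Qed.

(* The modulus of a character will be obtained as a minimal one among the
   seminorms of this kind that attain the norm at a given element. *)
Record pmsn N : Prop := Pmsn {
  pmD : forall x y, N (x + y) <= N x + N y;
  pmZ : forall (l : C) x, N (l *: x) <= nrm l * N x;
  pmM : forall x y, N (cmul x y) <= N x * N y;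
  pmsq : forall x, N (cmul x x) = N x ^+ 2;
  pm_ge0 : forall x, 0 <= N x;
  pm_le : forall x, N x <= nrm x }.

Lemma pmsn_nrm : pmsn nrm.
Proof.
split; [exact: nrmD| |exact: nrm_cmul|exact: nrm_cmul_sq|exact: nrm_ge0|by []].
by move=> l x; rewrite nrmZ.
Qed.

Section Seminorm.
Variable N : A -> R.
Hypothesis HN : pmsn N.

Lemma pmN x : N (- x) = N x.
Proof.
suff h y : N (- y) <= N y by apply/eqP; rewrite eq_le h -{1}[x]opprK h.
by rewrite -scaleN1r; apply: le_trans (pmZ HN _ _) _; rewrite nrmN /nrm normr1 mul1r.
Qed.

Lemma pmZE (l : C) x : N (l *: x) = nrm l * N x.
Proof.
apply/eqP; rewrite eq_le (pmZ HN) /=.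
have [->|l0] := eqVneq l 0; first by rewrite nrm0 mul0r (pm_ge0 HN).
have {1}-> : x = l^-1 *: (l *: x) by rewrite scalerA mulVf // scale1r.
have n0 : 0 < nrm l by rewrite nrm_gt0.
rewrite -ler_pdivlMl //; apply: le_trans (pmZ HN _ _) _.
by rewrite nrmV.
Qed.

(** The iterate is b^(n+1), as there is no unit to start from. Squaring gives equality at exponents
    2^k; submultiplicativity carries it down to the smaller ones. *)
Lemma pmX b n : N (iter n (cmul b) b) = N b ^+ n.+1.
Proof.
have up c : N c <= N b -> forall j, N (iter j (cmul b) c) <= N b ^+ j * N c.
  move=> _; elim=> [|j IH]; first by rewrite mul1r.
  rewrite iterS exprS -mulrA; apply: le_trans (pmM HN _ _) _.
  by rewrite ler_wpM2l ?(pm_ge0 HN).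
have pw c j : cmul (iter j (cmul b) b) c = iter j.+1 (cmul b) c.
  by elim: j => [//|j IH]; rewrite iterS -cmulA IH.
have p2 k : N (iter (2 ^ k).-1 (cmul b) b) = N b ^+ (2 ^ k).
  elim: k => [|k IH]; first by rewrite expr1.
  have -> : iter (2 ^ k.+1).-1 (cmul b) b = cmul (iter (2 ^ k).-1 (cmul b) b) (iter (2 ^ k).-1 (cmul b) b).
    rewrite pw prednK ?expn_gt0 // -iterD; congr iter.
    by rewrite expnS mul2n -addnn; case: (2 ^ k)%N (expn_gt0 2 k) => //= j _; rewrite addnS.
  by rewrite (pmsq HN) IH -exprM expnS mulnC.
apply/eqP; rewrite eq_le; apply/andP; split.
  by apply: le_trans (up b _ n) _ => //; rewrite exprSr.
have [b0|b0] := eqVneq (N b) 0; first by rewrite b0 expr0n (pm_ge0 HN).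
have bp : 0 < N b by rewrite lt_neqAle eq_sym b0 (pm_ge0 HN).
have hn : (n.+1 <= 2 ^ n.+1)%N by rewrite ltnW // ltn_expl.
have := p2 n.+1; set M := (2 ^ n.+1)%N in hn *; move=> hM.
have e : (M.-1 = (M - n.+1) + n)%N by case: M hn {hM} => // M hn /=; rewrite subSS subnK.
have : N b ^+ (M - n.+1) * N b ^+ n.+1 <= N b ^+ (M - n.+1) * N (iter n (cmul b) b).
  rewrite -exprD subnK // -hM e iterD.
  elim: (M - n.+1)%N => [|j IH]; first by rewrite mul1r.
  rewrite iterS exprS -mulrA; apply: le_trans (pmM HN _ _) _.
  by rewrite ler_wpM2l ?(pm_ge0 HN).
by rewrite ler_pM2l ?exprn_gt0.
Qed.
End Seminorm.

Section DirectedInf.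
Variable S : set (A -> R).
Hypotheses (S0 : exists N, S N)
  (Sdir : forall N M, S N -> S M -> exists L, S L /\ forall x, L x <= N x /\ L x <= M x)
  (Sge : forall N x, S N -> 0 <= N x).

Definition dinf x := inf [set N x | N in S].

Let has x : has_inf [set N x | N in S].
Proof.
split; first by have [N SN] := S0; exists (N x), N.
by exists 0 => _ [N SN <-]; exact: Sge.
Qed.

Lemma dinf_le N x : S N -> dinf x <= N x.
Proof. by move=> SN; apply: (ge_inf (proj2 (has x))); exists N. Qed.

Lemma dinf_ge (c : R) x : (forall N, S N -> c <= N x) -> c <= dinf x.
Proof. by move=> h; apply: lb_le_inf (proj1 (has x)) _ => _ [N /h ? <-]. Qed.

Lemma dinf_approx (e : R) x y : 0 < e ->
  exists N, [/\ S N, N x < dinf x + e & N y < dinf y + e].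
Proof.
move=> e0; have [_ [N SN <-] hN] := inf_adherent e0 (has x).
have [_ [M SM <-] hM] := inf_adherent e0 (has y).
have [L [SL hL]] := Sdir SN SM; exists L; split=> //.
  by apply: le_lt_trans hN; have [] := hL x.
by apply: le_lt_trans hM; have [] := hL y.
Qed.

(** Submultiplicativity is asked only from one member to another: for N(b^n x) / N(b)^n it holds
    from index n to index 2 n. *)
Lemma dinf_pmsn :
  (forall N x y, S N -> N (x + y) <= N x + N y) ->
  (forall N (l : C) x, S N -> N (l *: x) <= nrm l * N x) ->
  (forall N, S N -> exists2 M, S M & forall x y, M (cmul x y) <= N x * N y) ->
  (forall N x, S N -> dinf x ^+ 2 <= N (cmul x x)) ->
  (forall N x, S N -> N x <= nrm x) -> pmsn dinf.
Proof.
move=> hD hZ hM hsq hle.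
have d0 x : 0 <= dinf x by apply: dinf_ge => N /Sge.
have dM x y : dinf (cmul x y) <= dinf x * dinf y.
  apply/ler_addgt0Pl => e e0; rewrite addrC.
  pose K := dinf x + dinf y + 1; have K0 : 0 < K by rewrite ltr_wpDl // addr_ge0.
  pose d := Num.min 1 (e / K).
  have dp : 0 < d by rewrite lt_min ltr01 divr_gt0.
  have d1 : d <= 1 by rewrite ge_min lexx.
  have dK : d * K <= e by rewrite -ler_pdivlMr // ge_min lexx orbT.
  have [N [SN h1 h2]] := dinf_approx x y dp.
  have [M SM hNM] := hM N SN.
  apply: le_trans (dinf_le _ SM) _; apply: le_trans (hNM x y) _.
  apply: le_trans (ler_pM (Sge _ SN) (Sge _ SN) (ltW h1) (ltW h2)) _.
  rewrite mulrDl !mulrDr -addrA lerD2l.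
  apply: le_trans dK; rewrite /K !mulrDr mulr1.
  have : d * d <= d by rewrite ler_piMr // ltW.
  by rewrite (mulrC (dinf x) d); lra.
split=> //.
- move=> x y; apply/ler_addgt0Pl => e e0; have e20 : 0 < e / 2 by lra.
  have [N [SN h1 h2]] := dinf_approx x y e20.
  by have := dinf_le (x + y) SN; have := hD _ x y SN; lra.
- move=> l x; apply/ler_addgt0Pl => e e0.
  have l0 : 0 < nrm l + 1 by rewrite ltr_wpDl ?nrm_ge0.
  have [N [SN h1 _]] := dinf_approx x x (divr_gt0 e0 l0).
  apply: le_trans (dinf_le _ SN) _; apply: le_trans (hZ _ _ _ SN) _.
  apply: le_trans (ler_wpM2l (nrm_ge0 l) (ltW h1)) _.
  rewrite mulrDr addrC lerD2r mulrA ler_pdivrMr // mulrC ler_wpM2l ?(ltW e0) //.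
  by rewrite lerDl.
- move=> x; apply/eqP; rewrite eq_le dM /=.
  by apply: dinf_ge => N SN; exact: hsq.
- by move=> x; have [N SN] := S0; apply: le_trans (dinf_le _ SN) (hle _ _ SN).
Qed.
End DirectedInf.

(* Restricts the supremum of the |chi(x)| to the characters with maximal |chi(b)|. *)
Section Smoothing.
Variables (N : A -> R) (b : A).
Hypotheses (HN : pmsn N) (b0 : 0 < N b).
Let r := N b.

(** For a supremum N of values |chi|, the factor |chi(b) / r|^n damps all chi except those with
    |chi(b)| = r. *)
Let s n x := N (iter n (cmul b) x) / r ^+ n.
Definition smooth := dinf [set M | exists n, M = s n].

Let rX n : 0 < r ^+ n. Proof. exact: exprn_gt0. Qed.

Let s_anti m n x : (m <= n)%N -> s n x <= s m x.
Proof.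
elim: n => [|n IH]; first by rewrite leqn0 => /eqP->.
rewrite leq_eqVlt ltnS => /orP[/eqP->//|/IH]; apply: le_trans.
rewrite /s ler_pdivrMr // exprS mulrCA divfK ?gt_eqF // iterS.
exact: pmM.
Qed.

Let Sge M x : [set M | exists n, M = s n] M -> 0 <= M x.
Proof. by move=> [n ->]; rewrite divr_ge0 ?(pm_ge0 HN) // ltW. Qed.

Let Sdir M M' : [set M | exists n, M = s n] M -> [set M | exists n, M = s n] M' ->
  exists L, [set M | exists n, M = s n] L /\ forall x, L x <= M x /\ L x <= M' x.
Proof.
move=> [n ->] [m ->]; exists (s (maxn n m)); split; first by exists (maxn n m).
by move=> x; split; apply: s_anti; [exact: leq_maxl | exact: leq_maxr].
Qed.

Let S0 : exists M, [set M | exists n, M = s n] M.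
Proof. by exists (s 0%N), 0%N. Qed.

Let itM n x y : iter n (cmul b) (cmul x y) = cmul (iter n (cmul b) x) y.
Proof. by elim: n => [//|n IH]; rewrite !iterS IH cmulA. Qed.

Let s2 n x y : s (n + n) (cmul x y) = N (cmul (iter n (cmul b) x) (iter n (cmul b) y)) / r ^+ n / r ^+ n.
Proof.
rewrite /s exprD invfM mulrA; congr (N _ / _ / _).
by rewrite iterD itM cmulC itM cmulC.
Qed.

Lemma smooth_le x : smooth x <= N x.
Proof.
have h : s 0%N x = N x by rewrite /s expr0 divr1.
by rewrite -h; apply: (dinf_le S0 Sge); exists 0%N.
Qed.

Lemma smooth_pmsn : pmsn smooth.
Proof.
apply: (dinf_pmsn S0 Sdir Sge).
- move=> _ x y [n ->]; rewrite /s -mulrDl ler_pM2r ?invr_gt0 //.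
  have -> : iter n (cmul b) (x + y) = iter n (cmul b) x + iter n (cmul b) y.
    by elim: n => [//|n IH]; rewrite !iterS IH cmulDr.
  exact: pmD.
- move=> _ l x [n ->]; rewrite /s mulrA ler_pM2r ?invr_gt0 //.
  have -> : iter n (cmul b) (l *: x) = l *: iter n (cmul b) x.
    by elim: n => [//|n IH]; rewrite !iterS IH cmulZr.
  exact: pmZ.
- move=> _ [n ->]; exists (s (n + n)); first by exists (n + n)%N.
  move=> x y; rewrite s2 /s mulf_div -mulrA -invfM ler_pM2r ?invr_gt0 ?mulr_gt0 //.
  exact: pmM.
- move=> _ x [n ->]; have [hn|hn] := leqP n (n + n).
    apply: le_trans _ (s_anti (cmul x x) hn); rewrite s2 (pmsq HN) -mulrA -invfM -expr2 -expr_div_n.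
    have d0 : 0 <= smooth x by apply: (dinf_ge S0 Sge) => M /Sge.
    have d1 : smooth x <= s n x by apply: (dinf_le S0 Sge); exists n.
    by rewrite ler_pXn2r ?nnegrE // divr_ge0 ?(pm_ge0 HN) ?(ltW (rX n)).
  by move: hn; rewrite ltnNge leq_addr.
- move=> _ x [n ->]; apply: le_trans (s_anti x (leq0n n)) _.
  by rewrite /s expr0 divr1 (pm_le HN).
Qed.

Lemma smooth_mul x : smooth (cmul b x) = r * smooth x.
Proof.
apply/eqP; rewrite eq_le; apply/andP; split.
  rewrite mulrC -ler_pdivrMr //; apply: (dinf_ge S0 Sge) => _ [n ->].
  rewrite ler_pdivrMr //; apply: le_trans (_ : s n (cmul b x) <= _).
    by apply: (dinf_le S0 Sge); exists n.
  by rewrite /s -iterSr iterS mulrAC ler_pM2r ?invr_gt0 // mulrC pmM.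
apply: (dinf_ge S0 Sge) => _ [n ->].
have -> : s n (cmul b x) = r * s n.+1 x.
  by rewrite /s -iterSr exprS invfM mulrCA [r * _]mulrA mulfV ?mul1r // gt_eqF.
by rewrite ler_pM2l //; apply: (dinf_le S0 Sge); exists n.+1.
Qed.

Lemma smooth_self : smooth b = r.
Proof.
have h n : s n b = r by rewrite /s (pmX HN) exprSr -/r mulrAC mulfV ?mul1r ?gt_eqF.
apply/eqP; rewrite eq_le; apply/andP; split.
  by rewrite -(h 0%N); apply: (dinf_le S0 Sge); exists 0%N.
by apply: (dinf_ge S0 Sge) => _ [n ->]; rewrite h.
Qed.

(** Elements that already multiply exactly continue to do so, so smoothing at another element does
    not leave the class minimized below. *)
Lemma smooth_preserve a (m : R) : 0 < m -> (forall x, N (cmul a x) = m * N x) -> N a = m ->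
  (forall x, smooth (cmul a x) = m * smooth x) /\ smooth a = m.
Proof.
move=> m0 ha Na.
have sa n x : s n (cmul a x) = m * s n x.
  by rewrite /s cmulC itM cmulC ha mulrA.
split.
  move=> x; apply/eqP; rewrite eq_le; apply/andP; split.
    rewrite mulrC -ler_pdivrMr //; apply: (dinf_ge S0 Sge) => _ [n ->].
    by rewrite ler_pdivrMr // mulrC -sa; apply: (dinf_le S0 Sge); exists n.
  apply: (dinf_ge S0 Sge) => _ [n ->]; rewrite sa ler_pM2l //.
  by apply: (dinf_le S0 Sge); exists n.
have sm n : s n a = m.
  case: n => [|n]; first by rewrite /s expr0 divr1.
  rewrite /s.
  have -> : iter n.+1 (cmul b) a = cmul a (iter n (cmul b) b).
    by rewrite iterSr itM cmulC.
  by rewrite ha (pmX HN) -/r mulfK // gt_eqF.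
apply/eqP; rewrite eq_le; apply/andP; split.
  by rewrite -(sm 0%N); apply: (dinf_le S0 Sge); exists 0%N.
by apply: (dinf_ge S0 Sge) => _ [n ->]; rewrite sm.
Qed.
End Smoothing.

End CommutativeCstar.

(** * A character that attains the norm of a given nonzero element *)

Section CharacterExistence.
Context {R : realType} {A : commCstarType R}.
Local Notation C := R[i].
Implicit Types (x y a b : A) (N : A -> R).
Variable a0 : A.
Hypothesis a00 : a0 != 0.
Let m : R := nrm a0.

Let m0 : 0 < m. Proof. by rewrite nrm_gt0. Qed.

(** The conditions at a0 keep a minimal N from degenerating to 0, and let a0 replace the missing
    unit. *)
Let cls N := [/\ pmsn N, forall x, N (cmul a0 x) = m * N x & N a0 = m].

Let cls_ex : cls (smooth nrm a0).
Proof.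
have a0p : 0 < nrm a0 := m0.
split; [exact: (smooth_pmsn pmsn_nrm)| exact: (smooth_mul pmsn_nrm)|exact: (smooth_self pmsn_nrm)].
Qed.

(** Zorn for the reversed order: a nonempty chain is bounded by its pointwise infimum, and the empty
    one by the smoothing of the norm at a0. *)
Let cls_min : exists2 N, cls N & forall M, cls M -> (forall x, M x <= N x) -> M = N.
Proof.
pose T := {N | cls N}; pose leT (s t : T) := `[< forall x, sval t x <= sval s x >].
have [||||[N hN] hmin] := @Zorn T leT.
- by move=> t; apply/asboolP.
- move=> r s t /asboolP h1 /asboolP h2; apply/asboolP => x.
  exact: le_trans (h2 x) (h1 x).
- move=> [s hs] [t ht] /asboolP h1 /asboolP h2; apply: eq_exist.
  by apply/funext => x; apply/eqP; rewrite eq_le; move: (h1 x) (h2 x) => /= -> ->.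
- move=> F tot; have [[t0 Ft0]|F0] := pselect (exists t, F t); last first.
    by exists (exist _ _ cls_ex) => s Fs; case: F0; exists s.
  pose S := [set N | exists2 t, F t & N = sval t].
  have S0 : exists N, S N by exists (sval t0), t0.
  have Sc N : S N -> cls N by move=> [[M hM] _ ->].
  have Sge N x : S N -> 0 <= N x by move=> /Sc[h _ _]; exact: pm_ge0 h x.
  have Sdir N M : S N -> S M -> exists L, S L /\ forall x, L x <= N x /\ L x <= M x.
    move=> [s Fs ->] [t Ft ->]; have [/asboolP h|/asboolP h] := tot s t Fs Ft.
      by exists (sval t); split; [exists t|move=> x; split].
    by exists (sval s); split; [exists s|move=> x; split].
  have hP : cls (dinf S).
    split.
    + apply: (dinf_pmsn S0 Sdir Sge).
      * by move=> N x y /Sc[h _ _]; exact: pmD.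
      * by move=> N l x /Sc[h _ _]; exact: pmZ.
      * by move=> N SN; exists N => // x y; have [h _ _] := Sc N SN; exact: pmM.
      * move=> N x SN; have [h _ _] := Sc N SN; rewrite (pmsq h).
        rewrite ler_pXn2r ?nnegrE ?(pm_ge0 h) ?(dinf_le S0 Sge) //.
        by apply: (dinf_ge S0 Sge) => M; exact: Sge.
      * by move=> N x /Sc[h _ _]; exact: pm_le.
    + move=> x; apply/eqP; rewrite eq_le; apply/andP; split.
        rewrite mulrC -ler_pdivrMr //; apply: (dinf_ge S0 Sge) => N SN.
        have [_ h _] := Sc N SN; rewrite ler_pdivrMr // mulrC -h.
        exact: (dinf_le S0 Sge).
      apply: (dinf_ge S0 Sge) => N SN; have [_ h _] := Sc N SN.
      by rewrite h ler_pM2l //; exact: (dinf_le S0 Sge).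
    + apply/eqP; rewrite eq_le; apply/andP; split.
        by have [N SN] := S0; have [_ _ <-] := Sc N SN; exact: (dinf_le S0 Sge).
      by apply: (dinf_ge S0 Sge) => N /Sc[_ _ ->].
  exists (exist _ _ hP) => s Fs; apply/asboolP => x.
  by apply: (dinf_le S0 Sge); exists s.
exists N => // M hM MN.
by have /(congr1 sval) := hmin (exist _ M hM) (asboolT MN).
Qed.

Section Multiplicative.
Variable N : A -> R.
Hypotheses (cN : cls N) (minN : forall M, cls M -> (forall x, M x <= N x) -> M = N).

Let HN : pmsn N. Proof. by case: cN. Qed.
Let Na0 : N a0 = m. Proof. by case: cN. Qed.

(** Smoothing N at x gives a smaller member of the class, hence N itself; and the smoothing is
    multiplicative along x. *)
Let NM x y : N (cmul x y) = N x * N y.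
Proof.
have [x0|x0] := eqVneq (N x) 0.
  apply/eqP; rewrite eq_le x0 mul0r (pm_ge0 HN) andbT.
  by apply: le_trans (pmM HN _ _) _; rewrite x0 mul0r.
have xp : 0 < N x by rewrite lt_neqAle eq_sym x0 (pm_ge0 HN).
have [_ h1 h2] := cN; have [h3 h4] := smooth_preserve HN xp m0 h1 h2.
have e := minN (And3 (smooth_pmsn HN xp) h3 h4) (smooth_le HN xp).
by have := smooth_mul HN xp y; rewrite e.
Qed.

Let NB x y : N x - N y <= N (x - y).
Proof. by rewrite lerBlDr; apply: le_trans (pmD HN _ _); rewrite subrK. Qed.

Section Element.
Variable b : A.
Let op (l : C) y := cmul b y - l *: y.
(** Plays the role of N(b - l 1): by multiplicativity, b - l scales N by the same factor at every
    y. *)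
Let g l : R := N (op l a0) / m.

Let gN l y : N (op l y) = g l * N y.
Proof.
have e : cmul a0 (op l y) = cmul (op l a0) y.
  by rewrite cmulBr cmulBl !cmulA (cmulC a0) cmulZr cmulZl.
apply: (@mulfI _ m); first by rewrite gt_eqF.
by rewrite -{1}Na0 -NM e NM /g mulrA mulrCA mulfV ?mulr1 // gt_eqF.
Qed.

Let g_ge0 l : 0 <= g l.
Proof. by rewrite divr_ge0 ?(pm_ge0 HN) // ltW. Qed.

Let g_lip l l' : g l <= g l' + nrm (l - l').
Proof.
rewrite /g ler_pdivrMr // mulrDl divfK ?gt_eqF //.
have -> : op l a0 = op l' a0 - (l - l') *: a0.
  by rewrite /op scalerBl opprB addrA subrK.
by apply: le_trans (pmD HN _ _) _; rewrite (pmN HN) (pmZE HN) Na0.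
Qed.

Let g_large l : nrm l - nrm b <= g l.
Proof.
rewrite /g ler_pdivlMr // mulrBl -{1}Na0 -(pmZE HN).
rewrite lerBlDr -[X in N X <= _](subKr (cmul b a0)).
apply: le_trans (pmD HN _ _) _; rewrite (pmN HN) addrC lerD2l NM Na0.
by rewrite ler_pM2r // (pm_le HN).
Qed.

Let g0 : g 0 <= nrm b.
Proof.
by rewrite /g /op scale0r subr0 NM Na0 mulfK ?gt_eqF // (pm_le HN).
Qed.

(** g is 1-Lipschitz, and outside the disc of radius 2 |b| it exceeds |b|, hence g 0. *)
Let g_min : exists l0, forall l, g l0 <= g l.
Proof.
pose D := [set z : C | nrm z <= 2 * nrm b].
have lip (l l' : C) (e : R) : nrm (l - l') < e -> `|g l' - g l| < e.
  by have := g_lip l l'; have := g_lip l' l; rewrite (nrm_subC l' l) ltr_norml; lra.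
have cg : {within (D : set C^o), continuous (g : C^o -> R)}.
  apply/subspace_continuousP; apply/cont_onP => l _ e e0.
  by apply/(@nbhs_nrmP _ C^o); exists e => // l' h _; exact: lip.
have D0 : D 0 by rewrite /D /= nrm0 mulr_ge0 ?nrm_ge0.
have [|l0 _ h] := @compact_EVT_min C^o R g D _ (@compact_disc _ _) cg; first by exists 0.
exists l0 => l; have [hl|hl] := leP (nrm l) (2 * nrm b); first by apply: h; rewrite inE.
apply: le_trans (h 0 _) _; first by rewrite inE.
by have := g_large l; have := g0; lra.
Qed.

(* Ostrowski's argument: if the minimum M of |b - l| is positive, the
   factorization of y^(2^k) - mu^(2^k) into linear terms, each of size at least
   M, shows that the minimum is also attained at distance M/2. *)
Let g_step l0 (mu : C) : (forall l, g l0 <= g l) -> 0 < g l0 ->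
  nrm mu = g l0 / 2 -> g (l0 + mu) = g l0.
Proof.
set M := g l0 => hmin M0 hmu.
pose B := op l0; pose Y k := iter (2 ^ k) B.
have BD y z : B (y + z) = B y + B z.
  by rewrite /B /op cmulDr scalerDr opprD addrACA.
have BZ c y : B (c *: y) = c *: B y.
  by rewrite /B /op cmulZr scalerBr !scalerA mulrC.
have itD n y z : iter n B (y + z) = iter n B y + iter n B z.
  by elim: n => [//|n IH]; rewrite !iterS IH BD.
have itZ n c y : iter n B (c *: y) = c *: iter n B y.
  by elim: n => [//|n IH]; rewrite !iterS IH BZ.
have YS k y : Y k.+1 y = Y k (Y k y).
  by rewrite /Y -iterD addnn -mul2n -expnS.
have fac k (s : C) z : Y k.+1 z - s ^+ 2 *: z = Y k (Y k z - s *: z) - (- s) *: (Y k z - s *: z).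
  have YZ c y : Y k (c *: y) = c *: Y k y by rewrite /Y itZ.
  have YB y w : Y k (y - w) = Y k y - Y k w.
    by rewrite -scaleN1r {1}/Y itD -/(Y k _) -/(Y k _) YZ scaleN1r.
  by rewrite YS YB YZ scaleNr opprK scalerBr scalerA -expr2 addrA subrK.
(* Every s has a square root, so B^(2^k) - s splits into 2^k factors B - t, each scaling N by at
   least M. *)
have c1 k (s : C) z : M ^+ (2 ^ k) * N z <= N (Y k z - s *: z).
  elim: k s z => [|k IH] s z.
    rewrite /Y /= expr1.
    have -> : B z - s *: z = op (l0 + s) z by rewrite /B /op scalerDl opprD addrA.
    by rewrite gN ler_wpM2r ?(pm_ge0 HN).
  rewrite -(sqrtCK s) fac expnS mul2n -addnn exprD -mulrA.
  apply: le_trans (IH _ _); rewrite ler_wpM2l ?exprn_ge0 ?(ltW M0) //.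
(* The factor B - mu is kept apart and counted as g(l0 + mu). Both sides carry an extra M, so that
   no exponent 2^k - 1 appears. *)
have c2 k z : g (l0 + mu) * M ^+ (2 ^ k) * N z <= M * N (Y k z - mu ^+ (2 ^ k) *: z).
  elim: k z => [|k IH] z.
    rewrite /Y /= !expr1.
    have -> : B z - mu *: z = op (l0 + mu) z by rewrite /B /op scalerDl opprD addrA.
    by rewrite gN le_eqVlt; apply/orP; left; apply/eqP; ring.
  have -> : mu ^+ (2 ^ k.+1) = (mu ^+ (2 ^ k)) ^+ 2 by rewrite -exprM mulnC -expnS.
  rewrite fac expnS mul2n -addnn exprD.
  have := c1 k (- mu ^+ (2 ^ k)) (Y k z - mu ^+ (2 ^ k) *: z).
  set w := N (_ - - _ *: _) => h.
  apply: le_trans (_ : M * (M ^+ (2 ^ k) * N (Y k z - mu ^+ (2 ^ k) *: z)) <= _); last by rewrite ler_pM2l.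
  have := IH z; set u := N (_ - _ *: z); set t := M ^+ _ => h'.
  have t0 : 0 <= t by rewrite exprn_ge0 // ltW.
  rewrite [leLHS](_ : _ = t * (g (l0 + mu) * t * N z)); last by ring.
  by rewrite [leRHS](_ : _ = t * (M * u)); [exact: ler_wpM2l | ring].
have up n z : N (iter n B z) = M ^+ n * N z.
  by elim: n => [|n IH]; rewrite ?mul1r // iterS gN -/M IH exprS mulrA.
apply/eqP; rewrite eq_le hmin andbT; apply/ler_addgt0Pl => e e0.
have half01 : 0 <= (2^-1 : R) < 1 by rewrite invr_ge0 ler0n invf_lt1 ?ltr1n.
have [k0 hk0] := expr_small half01 (divr_gt0 e0 M0).
have hk : (2^-1 : R) ^+ (2 ^ k0) <= e / M.
  have [h1 h2] := andP half01; apply: le_trans hk0.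
  by apply: ler_wiXn2l => //; [exact: ltW | rewrite ltnW // ltn_expl].
have := c2 k0 a0; rewrite Na0 => h.
have h2 : N (Y k0 a0 - mu ^+ (2 ^ k0) *: a0) <= (M ^+ (2 ^ k0) + nrm mu ^+ (2 ^ k0)) * m.
  apply: le_trans (pmD HN _ _) _; rewrite (pmN HN) (pmZE HN) up Na0 nrmX mulrDl //.
have := le_trans h (ler_wpM2l (ltW M0) h2); rewrite mulrA ler_pM2r //.
rewrite hmu (exprMn _ M); set t := M ^+ _ => h3.
have t0 : 0 < t by rewrite exprn_gt0.
have h4 : g (l0 + mu) <= M * (1 + 2^-1 ^+ (2 ^ k0)).
  rewrite -(ler_pM2r t0); apply: le_trans h3 _.
  by rewrite le_eqVlt; apply/orP; left; apply/eqP; ring.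
apply: le_trans h4 _; rewrite mulrDr mulr1 addrC lerD2r.
by rewrite mulrC -ler_pdivlMr.
Qed.

(** If the minimum M were positive, steps of length M / 2 along the real direction would keep g
    equal to M, against [g_large]. *)
Lemma spectral_value : exists l : C, forall y, N (cmul b y - l *: y) = 0.
Proof.
have [l0 hmin] := g_min; exists l0 => y; rewrite gN.
have [->|gn0] := eqVneq (g l0) 0; first by rewrite mul0r.
have M0 : 0 < g l0 by rewrite lt_neqAle eq_sym gn0 g_ge0.
set M := g l0 in M0 hmin.
have hj j : g (l0 + (j%:R * (M / 2))%:C) = M.
  elim: j => [|j IH]; first by rewrite mul0r addr0.
  have h1 := @g_step (l0 + (j%:R * (M / 2))%:C) (M / 2)%:C; rewrite IH in h1.
  rewrite -natr1 mulrDl mul1r rmorphD /= addrA; apply: h1 => //.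
  by rewrite nrmR ger0_norm // divr_ge0 // ltW.
exfalso.
have M20 : 0 < M / 2 by lra.
pose K := (M + nrm b + nrm l0) / (M / 2).
pose j := (Num.truncn K).+1.
have := g_large (l0 + (j%:R * (M / 2))%:C); rewrite hj.
have h1 : M + nrm b + nrm l0 < j%:R * (M / 2).
  by rewrite -ltr_pdivrMr // truncnS_gt.
have := nrmB (l0 + (j%:R * (M / 2))%:C) l0; rewrite addrC addKr nrmR ger0_norm; last first.
  by rewrite mulr_ge0 // ltW.
lra.
Qed.
End Element.

(** chi(b) is the scalar by which b acts up to N. Its uniqueness gives linearity and
    multiplicativity, and N = |chi|. *)
Lemma multiplicative_character :
  exists chi : {ptws A -> C^o}, is_character chi /\ nrm (chi a0) = nrm a0.
Proof.
have /choice[chi hchi] := spectral_value.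
have uniq b l : (forall y, N (cmul b y - l *: y) = 0) -> chi b = l.
  move=> h; have : N (chi b *: a0 - l *: a0) <= 0.
    have -> : chi b *: a0 - l *: a0 = (cmul b a0 - l *: a0) - (cmul b a0 - chi b *: a0).
      by rewrite opprB [RHS]addrC addrA subrK.
    by apply: le_trans (pmD HN _ _) _; rewrite (pmN HN) h hchi addr0.
  rewrite -scalerBl (pmZE HN) Na0 pmulr_lle0 // => h1.
  apply/eqP; rewrite -subr_eq0 -nrm_eq0 eq_le h1 nrm_ge0 //.
have le0 x : N x <= 0 -> N x = 0 by move=> h; apply/eqP; rewrite eq_le h (pm_ge0 HN).
have chiN x : N x = nrm (chi x).
  have h1 := NB (cmul x a0) (chi x *: a0); have h2 := NB (chi x *: a0) (cmul x a0).
  move: h1 h2; rewrite -[chi x *: a0 - cmul x a0]opprB (pmN HN) hchi NM (pmZE HN) Na0.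
  rewrite -!mulrBl !pmulr_lle0 // !subr_le0 => h1 h2.
  by apply/eqP; rewrite eq_le h1 h2.
have chiL (l : C) a b : chi (l *: a + b) = l * chi a + chi b.
  apply: uniq => y; apply: le0.
  have -> : cmul (l *: a + b) y - (l * chi a + chi b) *: y =
      l *: (cmul a y - chi a *: y) + (cmul b y - chi b *: y).
    by rewrite cmulDl cmulZl scalerDl scalerBr scalerA opprD addrACA.
  by apply: le_trans (pmD HN _ _) _; rewrite (pmZE HN) !hchi mulr0 addr0.
have chiM a b : chi (cmul a b) = chi a * chi b.
  apply: uniq => y; apply: le0.
  have -> : cmul (cmul a b) y - (chi a * chi b) *: y =
      cmul a (cmul b y - chi b *: y) + chi b *: (cmul a y - chi a *: y).
    rewrite cmulBr cmulZr scalerBr scalerA -cmulA addrA subrK.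
    by rewrite mulrC.
  by apply: le_trans (pmD HN _ _) _; rewrite NM (pmZE HN) !hchi !mulr0 addr0.
have chiD a b : chi (a + b) = chi a + chi b.
  by have := chiL 1 a b; rewrite scale1r mul1r.
have chi0 : chi 0 = 0 by apply: (addrI (chi 0)); rewrite -chiD !addr0.
have chiZ (l : C) a : chi (l *: a) = l * chi a.
  by have := chiL l a 0; rewrite chi0 !addr0.
have nchi x : nrm (chi x) <= nrm x by rewrite -chiN (pm_le HN).
have chia0 : nrm (chi a0) = m by rewrite -chiN Na0.
(* Arens: |chi(h) + i t|^2 <= |h|^2 + t^2 for all real t, so the linear term 2 t Im chi(h) must
   vanish. For lack of a unit, the estimate is made for h a0 + i t a0. *)
have chi_sa h : cstar h = h -> complex.Im (chi h) = 0.
  move=> sh; pose t_bound (t : R) := nchi (cmul h a0 + (t *i) *: a0).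
  have key (t : R) : nrm (chi h + t *i) ^+ 2 <= nrm h ^+ 2 + t ^+ 2.
    have := t_bound t; rewrite chiD chiM chiZ -mulrDl nrmM chia0.
    rewrite -(@ler_pXn2r _ 2) ?nnegrE ?mulr_ge0 ?nrm_ge0 ?(ltW m0) // exprMn => h1.
    have h2 : nrm (cmul h a0 + (t *i) *: a0) ^+ 2 <= (nrm h ^+ 2 + t ^+ 2) * m ^+ 2.
      rewrite -nrm_cstar_id cstarD cstarM sh cstarZ.
      have -> : cmul (cmul (cstar a0) h + conjc (t *i) *: cstar a0) (cmul h a0 + (t *i) *: a0) =
          cmul (cmul h h) (cmul (cstar a0) a0) + (t ^+ 2)%:C *: cmul (cstar a0) a0.
        rewrite cmulDl !cmulDr !cmulZl !cmulZr scalerA.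
        have -> : conjc (t *i) * t *i = (t ^+ 2)%:C :> C.
          by rewrite mul_conj; congr (_%:C); rewrite nrm_sqr /= expr0n add0r.
        have -> : conjc (t *i) = - (t *i) :> C by apply/eqP; rewrite eq_complex /= oppr0 !eqxx.
        rewrite (cmulCA (cstar a0) h) (cmulC (cstar a0) h) cmulACA -(cmulA h).
        by rewrite scaleNr -(cmulA h (cstar a0)) addrA addrK.
      apply: le_trans (nrmD _ _) _; rewrite mulrDl lerD //.
        apply: le_trans (nrm_cmul _ _) _; rewrite nrm_cstar_id ler_wpM2r ?sqr_ge0 //.
        by apply: le_trans (nrm_cmul _ _) _; rewrite expr2.
      by rewrite nrmZ nrm_cstar_id nrmR ger0_norm ?sqr_ge0.
    have := le_trans h1 h2; rewrite ler_pM2r //.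
    by rewrite exprn_gt0.
  apply: contrapT => /eqP b0; set be := complex.Im (chi h) in b0.
  pose t := (nrm h ^+ 2 + 1) / (2 * be).
  have := key t; rewrite nrm_sqr ReDc ImDc /= addr0 -/be.
  have : 2 * be * t = nrm h ^+ 2 + 1 by rewrite /t mulrC divfK // mulf_neq0.
  have := sqr_ge0 (complex.Re (chi h)); have := sqr_ge0 be.
  by rewrite !expr2; lra.
exists chi; split; last by rewrite chia0.
split=> //; last by exists a0; rewrite -nrm_gt0 chia0.
move=> a.
pose h := a + cstar a; pose k := 'i *: (a - cstar a).
have cstarN (x : A) : cstar (- x) = - cstar x.
  by rewrite -scaleN1r cstarZ rmorphN rmorph1 scaleN1r.
have sh : cstar h = h by rewrite /h cstarD cstarK addrC.
have sk : cstar k = k.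
  rewrite /k cstarZ cstarD cstarN cstarK.
  have -> : conjc 'i = - 'i :> C by apply/eqP; rewrite eq_complex /= oppr0 !eqxx.
  by rewrite scaleNr -scalerN opprB.
have := chi_sa _ sh; have := chi_sa _ sk.
have chiN' x : chi (- x) = - chi x by rewrite -scaleN1r chiZ mulN1r.
rewrite /h /k chiZ !chiD chiN'; case: (chi a) => u v; case: (chi (cstar a)) => u' v' /=.
move=> h1 h2; apply/eqP; rewrite eq_complex /=; apply/andP; split; apply/eqP; lra.
Qed.

End Multiplicative.

Theorem character_exists :
  exists chi : {ptws A -> C^o}, is_character chi /\ nrm (chi a0) = nrm a0.
Proof.
have [N cN minN] := cls_min.
exact: multiplicative_character cN minN.
Qed.

End CharacterExistence.

(** * The Gelfand representation *)

Section Gelfand.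
Context {R : realType} {A : commCstarType R}.
Local Notation C := R[i].
Local Notation Y := {ptws A -> C^o}.
Implicit Types (chi psi : Y) (a b : A).

Lemma nbhs_eval chi a (e : R) : 0 < e -> nbhs chi [set psi : Y | nrm (psi a - chi a : C) < e].
Proof.
move=> e0; have e20 : 0 < e / 2 by lra.
have h : (proj a : Y -> C^o) @ chi --> (chi a : C^o) by exact: (@proj_continuous A (fun=> C^o) a chi).
have h2 := proj1 (@cvg_nrmP R C^o Y (nbhs chi) (nbhs_filter chi) (proj a) (chi a)) h _ e20.
apply: (@filterS Y (nbhs chi) (nbhs_filter chi) _ _ _ h2) => psi h3 /=; rewrite nrm_subC.
have h4 : nrm (chi a - psi a : C) <= e / 2 := h3.
apply: le_lt_trans h4 _; lra.
Qed.

(** The characters together with 0. Contractivity places them in a product of discs, where dropping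
    the condition of being nonzero makes them a closed set. *)
Record qchar chi : Prop := QChar {
  qcharL : forall (l : C) a b, chi (l *: a + b) = l * chi a + chi b;
  qcharM : forall a b, chi (cmul a b) = chi a * chi b;
  qchar_star : forall a, chi (cstar a) = conjc (chi a);
  qchar_le : forall a, nrm (chi a : C) <= nrm a }.

Section Linear.
Variable chi : Y.
Hypothesis Hc : forall (l : C) a b, chi (l *: a + b) = l * chi a + chi b.

Lemma lin_D a b : chi (a + b) = chi a + chi b.
Proof. by rewrite -[a]scale1r Hc mul1r !scale1r. Qed.

Lemma lin_0 : chi 0 = 0.
Proof. by apply: (addrI (chi 0)); rewrite -lin_D !addr0. Qed.

Lemma lin_Z (l : C) a : chi (l *: a) = l * chi a.
Proof. by have := Hc l a 0; rewrite lin_0 !addr0. Qed.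

Lemma lin_N a : chi (- a) = - chi a.
Proof. by rewrite -scaleN1r lin_Z mulN1r. Qed.

Lemma lin_B a b : chi (a - b) = chi a - chi b.
Proof. by rewrite lin_D lin_N. Qed.
End Linear.

(* If chi(a) = 1 and |a| < 1, then [b = a + a b] has a solution, at which chi
   gives [chi(b) = 1 + chi(b)]. *)
Lemma is_character_qchar chi : is_character chi -> qchar chi.
Proof.
move=> [hL hM hS _]; split=> // a; rewrite leNgt; apply/negP => ha.
have c0 : 0 < nrm (chi a : C) by apply: le_lt_trans ha; rewrite nrm_ge0.
have chi0 : (chi a : C) != 0 by rewrite -nrm_gt0.
pose a' := (chi a)^-1 *: a.
have c01 : 0 <= nrm a' < 1.
  by rewrite nrm_ge0 nrmZ nrmV mulrC ltr_pdivrMr // mul1r.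
have [b hb] : exists b, b = a' + cmul a' b.
  apply: (affine_fixpoint a' c01) => [y z|y]; first exact: cmulBr.
  exact: nrm_cmul.
have chia' : chi a' = 1 by rewrite lin_Z // mulVf.
have := congr1 chi hb; rewrite lin_D // hM chia' mul1r => /(congr1 (fun z => z - chi b)).
by rewrite subrr addrK => /esym/eqP; rewrite oner_eq0.
Qed.

Lemma charspaceP (x : charspace A) : is_character (set_val x).
Proof. exact: set_valP. Qed.

Definition mkchar chi (h : is_character chi) : charspace A := SigSub (mem_set h).

Lemma gelfand_mkchar chi (h : is_character chi) a : gelfand a (mkchar h) = chi a.
Proof. by []. Qed.

Lemma gelfand_qchar (x : charspace A) : qchar (set_val x : Y).
Proof. exact: is_character_qchar (charspaceP x). Qed.

Lemma gelfandD (x : charspace A) a b : gelfand (a + b) x = gelfand a x + gelfand b x.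
Proof. exact: lin_D (qcharL (gelfand_qchar x)) a b. Qed.

Lemma gelfandB (x : charspace A) a b : gelfand (a - b) x = gelfand a x - gelfand b x.
Proof. exact: lin_B (qcharL (gelfand_qchar x)) a b. Qed.

Lemma gelfandZ (x : charspace A) (l : C) a : gelfand (l *: a) x = l * gelfand a x.
Proof. exact: lin_Z (qcharL (gelfand_qchar x)) l a. Qed.

Lemma gelfandM (x : charspace A) a b : gelfand (cmul a b) x = gelfand a x * gelfand b x.
Proof. exact: qcharM (gelfand_qchar x) a b. Qed.

Lemma gelfand_star (x : charspace A) a : gelfand (cstar a) x = conjc (gelfand a x).
Proof. exact: qchar_star (gelfand_qchar x) a. Qed.

Lemma gelfand_le (x : charspace A) a : nrm (gelfand a x) <= nrm a.
Proof. exact: qchar_le (gelfand_qchar x) a. Qed.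

Lemma gelfand_attain a : a != 0 -> exists x : charspace A, nrm (gelfand a x) = nrm a.
Proof.
by move=> /character_exists[chi [h1 h2]]; exists (mkchar h1); rewrite gelfand_mkchar.
Qed.

Lemma nrm_le_gelfand a (c : R) : 0 <= c ->
  (forall x : charspace A, nrm (gelfand a x) <= c) -> nrm a <= c.
Proof.
move=> c0 h; have [->|/gelfand_attain[x <-]] := eqVneq a 0; first by rewrite nrm0.
exact: h.
Qed.

Lemma gelfand_inj a b : (forall x : charspace A, gelfand a x = gelfand b x) -> a = b.
Proof.
move=> h; apply/eqP; rewrite -subr_eq0 -nrm_eq0 eq_le nrm_ge0 andbT.
by apply: nrm_le_gelfand => // x; rewrite gelfandB h subrr nrm0.
Qed.

Lemma qchar_dich chi : qchar chi -> (forall a, chi a = 0) \/ is_character chi.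
Proof.
move=> h; have [h0|h0] := pselect (forall a, chi a = 0); [by left|right].
split; [exact: qcharL h|exact: qcharM h|exact: qchar_star h|].
by move/existsNP: h0 => [a /eqP ha]; exists a.
Qed.

Lemma qchar_compact : compact ([set chi | qchar chi] : set Y).
Proof.
have cT := @tychonoff A (fun=> C^o) (fun a => [set z : C | nrm z <= nrm a])
  (fun a => @compact_disc R (nrm a)).
apply: (subclosed_compact _ cT); last by move=> chi [_ _ _ h] a; exact: h.
rewrite -[X in closed X]setCK; apply: open_closedC; rewrite openE => chi /= nchi.
apply: contrapT => nn; apply: nchi.
(* A property of all members of the set cannot fail throughout a neighbourhood of chi, chi being in
   the closure. Each defining condition that fails at chi leads to such a neighbourhood. *)
have approx (P : Y -> Prop) : (forall psi, qchar psi -> P psi) ->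
    nbhs chi [set psi | ~ P psi] -> False.
  by move=> h hn; apply: nn; apply: filterS hn => psi /= h1 h2; apply: h1; exact: h.
split.
- move=> l a b; apply/eqP; rewrite -subr_eq0; apply/negPn/negP => n0.
  pose d := nrm (chi (l *: a + b) - (l * chi a + chi b) : C).
  have d0 : 0 < d by rewrite nrm_gt0.
  (* If the three values move by less than t, the defect of linearity moves by less than (2 + |l|)
     t. *)
  have K0 : 0 < 2 + nrm l by rewrite ltr_wpDr ?nrm_ge0.
  have e0 : 0 < d / (2 + nrm l) by rewrite divr_gt0.
  apply: (approx (fun psi => psi (l *: a + b) - (l * psi a + psi b) = 0)).
    by move=> psi h; rewrite (qcharL h) subrr.
  near=> psi => /= h.
  have h1 : nrm (psi (l *: a + b) - chi (l *: a + b) : C) < d / (2 + nrm l) by near: psi; exact: nbhs_eval.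
  have h2 : nrm (psi a - chi a : C) < d / (2 + nrm l) by near: psi; exact: nbhs_eval.
  have h3 : nrm (psi b - chi b : C) < d / (2 + nrm l) by near: psi; exact: nbhs_eval.
  have : d < d; last by rewrite ltxx.
  rewrite {1}/d.
  have -> : chi (l *: a + b) - (l * chi a + chi b) =
     (chi (l *: a + b) - psi (l *: a + b)) + (l * (psi a - chi a) + (psi b - chi b)) + (psi (l *: a + b) - (l * psi a + psi b)) :> C.
    by ring.
  rewrite h addr0; apply: le_lt_trans (nrmD _ _) _.
  rewrite nrm_subC; apply: le_lt_trans (lerD (lexx _) (nrmD _ _)) _; rewrite nrmM.
  have h4 : nrm l * nrm (psi a - chi a : C) <= nrm l * (d / (2 + nrm l)).
    by rewrite ler_wpM2l ?nrm_ge0 // ltW.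
  have : d = (2 + nrm l) * (d / (2 + nrm l)) by rewrite mulrC divfK // gt_eqF.
  move: h1 h2 h3 h4; set t := d / _; lra.
- move=> a b; apply/eqP; rewrite -subr_eq0; apply/negPn/negP => n0.
  pose d := nrm (chi (cmul a b) - (chi a * chi b) : C).
  have d0 : 0 < d by rewrite nrm_gt0.
  have K0 : 0 < 2 + nrm (chi a : C) + nrm b by rewrite !ltr_wpDr ?nrm_ge0.
  have e0 : 0 < d / (2 + nrm (chi a : C) + nrm b) by rewrite divr_gt0.
  set t := d / _ in e0.
  (* The bound of psi b is recorded too, to control the term (psi a - chi a) psi b. *)
  apply: (approx (fun psi => psi (cmul a b) = psi a * psi b /\ nrm (psi b : C) <= nrm b)).
    by move=> psi h; rewrite (qcharM h); split=> //; exact: qchar_le h b.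
  near=> psi => /= -[h hb].
  have h1 : nrm (psi (cmul a b) - chi (cmul a b) : C) < t by near: psi; exact: nbhs_eval.
  have h2 : nrm (psi a - chi a : C) < t by near: psi; exact: nbhs_eval.
  have h3 : nrm (psi b - chi b : C) < t by near: psi; exact: nbhs_eval.
  have : d < d; last by rewrite ltxx.
  rewrite {1}/d.
  have -> : chi (cmul a b) - (chi a * chi b) =
     (chi (cmul a b) - psi (cmul a b)) + (chi a * (psi b - chi b) + (psi a - chi a) * psi b) :> C.
    by rewrite h; ring.
  apply: le_lt_trans (nrmD _ _) _.
  rewrite nrm_subC; apply: le_lt_trans (lerD (lexx _) (nrmD _ _)) _; rewrite !nrmM.
  have h4 : nrm (chi a : C) * nrm (psi b - chi b : C) <= nrm (chi a : C) * t.
    by rewrite ler_wpM2l ?nrm_ge0 // ltW.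
  have h5 : nrm (psi a - chi a : C) * nrm (psi b : C) <= t * nrm b.
    by apply: ler_pM; rewrite ?nrm_ge0 // ltW.
  have : d = (2 + nrm (chi a : C) + nrm b) * t by rewrite mulrC divfK // gt_eqF.
  move: h1 h4 h5; lra.
- move=> a; apply/eqP; rewrite -subr_eq0; apply/negPn/negP => n0.
  pose d := nrm (chi (cstar a) - conjc (chi a) : C).
  have d0 : 0 < d by rewrite nrm_gt0.
  have e0 : 0 < d / 2 by lra.
  apply: (approx (fun psi => psi (cstar a) = conjc (psi a))).
    by move=> psi h; rewrite (qchar_star h).
  near=> psi => /= h.
  have h1 : nrm (psi (cstar a) - chi (cstar a) : C) < d / 2 by near: psi; exact: nbhs_eval.
  have h2 : nrm (psi a - chi a : C) < d / 2 by near: psi; exact: nbhs_eval.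
  have : d < d; last by rewrite ltxx.
  rewrite {1}/d.
  have -> : chi (cstar a) - conjc (chi a) =
     (chi (cstar a) - psi (cstar a)) + conjc (psi a - chi a) :> C.
    by rewrite h rmorphB /=; ring.
  apply: le_lt_trans (nrmD _ _) _.
  by rewrite nrm_subC nrm_conj; move: h1 h2; lra.
- move=> a; rewrite leNgt; apply/negP => n0.
  have e0 : 0 < nrm (chi a : C) - nrm a by rewrite subr_gt0.
  apply: (approx (fun psi => nrm (psi a : C) <= nrm a)).
    by move=> psi h; exact: qchar_le h a.
  near=> psi => /= h.
  have h1 : nrm (psi a - chi a : C) < nrm (chi a : C) - nrm a by near: psi; exact: nbhs_eval.
  have := nrmB (psi a : C) (psi a - chi a : C); rewrite opprB addrC subrK; lra.
Unshelve. all: by end_near. Qed.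

Lemma pick_real chi : qchar chi -> (exists a, chi a != 0) ->
  exists a, chi a = 1 /\ forall psi, qchar psi -> complex.Im (psi a) = 0.
Proof.
move=> hc [a ha].
have n0 : 0 < nrm (chi a : C) ^+ 2 by rewrite exprn_gt0 // nrm_gt0.
exists (((nrm (chi a : C) ^+ 2)^-1)%:C *: cmul (cstar a) a); split.
  rewrite (lin_Z (qcharL hc)) (qcharM hc) (qchar_star hc) mul_conj -rmorphM /=.
  by rewrite mulVf // gt_eqF.
move=> psi hp; rewrite (lin_Z (qcharL hp)) (qcharM hp) (qchar_star hp) mul_conj -rmorphM /=.
by [].
Qed.

(** With chi(u) = 1, the element d = u b - psi(b) u vanishes at psi and has the value chi(b) -
    psi(b) at chi; a multiple of d^* d is real everywhere. *)
Lemma pick_sep chi psi : qchar chi -> qchar psi -> chi <> psi ->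
  (exists a, chi a != 0) ->
  exists a, [/\ chi a = 1, psi a = 0 & forall xi, qchar xi -> complex.Im (xi a) = 0].
Proof.
move=> hc hp ne /(pick_real hc)[u [hu _]].
have [b hb] : exists b, chi b != psi b.
  by apply: contrapT => h; apply: ne; apply/funext => b; apply: contrapT => /eqP h2; apply: h; exists b.
pose d := cmul u b - psi b *: u.
have hd : chi d = chi b - psi b.
  by rewrite (lin_B (qcharL hc)) (qcharM hc) (lin_Z (qcharL hc)) hu mul1r mulr1.
have pd : psi d = 0.
  by rewrite (lin_B (qcharL hp)) (qcharM hp) (lin_Z (qcharL hp)) mulrC subrr.
have n0 : 0 < nrm (chi d : C) ^+ 2 by rewrite exprn_gt0 // nrm_gt0 hd subr_eq0.
exists (((nrm (chi d : C) ^+ 2)^-1)%:C *: cmul (cstar d) d); split.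
- rewrite (lin_Z (qcharL hc)) (qcharM hc) (qchar_star hc) mul_conj -rmorphM /=.
  by rewrite mulVf // gt_eqF.
- by rewrite (lin_Z (qcharL hp)) (qcharM hp) pd !mulr0.
- by move=> xi h; rewrite (lin_Z (qcharL h)) (qcharM h) (qchar_star h) mul_conj -rmorphM /=.
Qed.

(* Stone-Weierstrass on the compact space of all characters together with 0:
   the domination by [a0] makes F vanish continuously at 0. *)
Theorem gelfand_surjective (F : Y -> R) (a0 : A) :
  (forall chi, is_character chi -> forall e, 0 < e ->
     nbhs chi [set psi | is_character psi -> `|F psi - F chi| < e]) ->
  (forall chi, is_character chi -> `|F chi| <= nrm (chi a0 : C)) ->
  exists b : A, forall chi, is_character chi -> chi b = (F chi)%:C.
Proof.
move=> cF dF.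
pose G chi := if `[< is_character chi >] then F chi else 0.
pose Om : set Y := [set chi | qchar chi].
pose D := [set g : Y -> R | exists b : A, forall chi, qchar chi -> chi b = (g chi)%:C].
have GF chi : is_character chi -> G chi = F chi by rewrite /G => h; rewrite asboolT.
have G0 chi : (forall a, chi a = 0) -> G chi = 0.
  by move=> h; rewrite /G asboolF // => -[_ _ _ [a]]; rewrite h eqxx.
have cG : cont_on Om G.
  move=> chi hc e e0; have [h0|hch] := qchar_dich hc.
    apply: filterS (nbhs_eval chi a0 e0) => psi /= h hp.
    rewrite (G0 chi) // subr0; have [hp0|hpch] := qchar_dich hp.
      by rewrite G0 // normr0.
    by rewrite GF //; apply: le_lt_trans (dF _ hpch) _; move: h; rewrite h0 subr0.
  (* Functionals that are close to chi at a are nonzero, so the value of G at 0 does not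
     interfere. *)
  have [_ _ _ [a ha]] := hch.
  have n0 : 0 < nrm (chi a : C) by rewrite nrm_gt0.
  apply: filterS2 (cF _ hch _ e0) (nbhs_eval chi a n0) => psi /= h1 h2 hp.
  have [hp0|hpch] := qchar_dich hp; last by rewrite !GF // h1.
  by move: h2; rewrite hp0 sub0r nrmN ltxx.
have cD g : D g -> cont_on Om g.
  move=> [b hb] chi hc e e0; apply: filterS (nbhs_eval chi b e0) => psi /= h hp.
  by move: h; rewrite !hb // -rmorphB nrmR.
have D0 : D (fun=> 0) by exists 0 => chi hc; rewrite (lin_0 (qcharL hc)).
have DD g h : D g -> D h -> D (fun y => g y + h y).
  move=> [b hb] [c hc]; exists (b + c) => chi hchi.
  by rewrite (lin_D (qcharL hchi)) hb // hc // rmorphD.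
have DZ c g : D g -> D (fun y => c * g y).
  move=> [b hb]; exists (c%:C *: b) => chi hchi.
  by rewrite (lin_Z (qcharL hchi)) hb // rmorphM.
have DM g h : D g -> D h -> D (fun y => g y * h y).
  move=> [b hb] [c hc]; exists (cmul b c) => chi hchi.
  by rewrite (qcharM hchi) hb // hc // rmorphM.
have DRe b : (forall xi, qchar xi -> complex.Im (xi b) = 0) -> D (fun xi => complex.Re (xi b)).
  by move=> hb; exists b => xi /hb; case: (xi b) => u v /= ->.
have sep chi psi : Om chi -> Om psi -> exists2 g, D g & g chi = G chi /\ g psi = G psi.
  move=> hc hp; have [->|ne] := pselect (chi = psi).
    have [h0|hch] := qchar_dich hp; first by exists (fun=> 0) => //; rewrite G0.
    have [_ _ _ hex] := hch; have [b [hb1 hb2]] := pick_real hp hex.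
    exists (fun xi => G psi * complex.Re (xi b)); first by apply: DZ; exact: DRe.
    by rewrite hb1 /= mulr1.
  have half phi rho : qchar phi -> qchar rho -> phi <> rho ->
      exists2 g, D g & g phi = G phi /\ g rho = 0.
    move=> hphi hrho nee; have [h0|hch] := qchar_dich hphi.
      by exists (fun=> 0) => //; rewrite G0.
    have [_ _ _ hex] := hch; have [b [hb1 hb2 hb3]] := pick_sep hphi hrho nee hex.
    exists (fun xi => G phi * complex.Re (xi b)); first by apply: DZ; exact: DRe.
    by rewrite hb1 hb2 /= mulr1 mulr0.
  have [g Dg [g1 g2]] := half _ _ hc hp ne.
  have [h Dh [h1 h2]] := half _ _ hp hc (fun e => ne (esym e)).
  by exists (fun xi => g xi + h xi); [exact: DD | rewrite g1 g2 h1 h2 addr0 add0r].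
have app n : exists b : A, forall chi, is_character chi -> nrm ((F chi)%:C - chi b : C) <= harm n.
  have [g [b hb] hg] := @stone_weierstrass R Y Om D qchar_compact D0 DD DZ DM cD G cG sep _ (harm_gt0 n).
  exists b => chi hch; have hc := is_character_qchar hch.
  by rewrite hb // -rmorphB nrmR -(GF _ hch); exact: hg.
have [b hb] := choice app.
have cau n k : nrm (b k - b n) <= harm n + harm k.
  apply: nrm_le_gelfand => [|x]; first by rewrite addr_ge0 // ltW ?harm_gt0.
  have hx := charspaceP x; rewrite gelfandB.
  have -> : gelfand (b k) x - gelfand (b n) x =
    ((F (set_val x))%:C - gelfand (b n) x) - ((F (set_val x))%:C - gelfand (b k) x) by ring.
  by apply: le_trans (nrmB _ _) _; apply: lerD; exact: hb.
have [l hl] : exists l, forall n, nrm (l - b n) <= 2 * harm n.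
  apply: (@complete_rate R A b (fun n => 2 * harm n)).
    by move=> e e0; exact: harm_small_mul.
  move=> n k nk; apply: le_trans (cau n k) _.
  by have := harm_mono (R := R) nk; lra.
exists l => chi hch; have hc := is_character_qchar hch.
apply/eqP; rewrite -subr_eq0 -nrm_eq0 eq_le nrm_ge0 andbT.
apply: (@harm_le _ _ 3) => // n.
have -> : chi l - (F chi)%:C = chi (l - b n) - ((F chi)%:C - chi (b n)) :> C.
  by rewrite (lin_B (qcharL hc)); ring.
apply: le_trans (nrmB _ _) _.
have := qchar_le hc (l - b n); have := hl n; have := hb n chi hch; lra.
Qed.

End Gelfand.

(** * Localizations *)

Section Families.
Context {R : realType}.
Local Notation C := R[i].

Definition hip_phi {A : commCstarType R} {E : hilbertModType A} (x : charspace A) (u v : E) : C :=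
  gelfand (hip u v) x.

(** |u|^2 is the norm of <u, u>, which some character attains; positivity of the values follows from
    <u, u> = b^* b. *)
Lemma hip_fam (A : commCstarType R) (E : hilbertModType A) :
  ipfam (hip : E -> E -> A) (@hip_phi A E).
Proof.
have hsq (u : E) (x : charspace A) : exists b : A, gelfand (hip u u) x = (nrm (gelfand b x) ^+ 2)%:C.
  have [b hb] := hip_ge0 u; exists b.
  by rewrite hb gelfandM gelfand_star mul_conj.
have nsq (u : E) : nrm u ^+ 2 = nrm (hip u u).
  by apply: complexI; rewrite rmorphXn /= -!nrmE; exact: hip_norm.
split.
- move=> x; split.
  + by move=> u v w; rewrite /hip_phi hipDr gelfandD.
  + by move=> c u v; rewrite /hip_phi hipZr gelfandZ.
  + by move=> u v; rewrite /hip_phi -gelfand_star hip_star.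
  + by move=> u; rewrite /hip_phi; have [b ->] := hsq u x; rewrite lecR sqr_ge0.
- by move=> x u; rewrite nsq; apply: le_trans (Re_le_nrm _) (gelfand_le _ _).
- move=> u u0; have [|x hx] := @gelfand_attain R A (hip u u).
    by rewrite -nrm_gt0 -nsq exprn_gt0 // nrm_gt0.
  exists x; rewrite nsq -hx /hip_phi; have [b ->] := hsq u x.
  by rewrite nrmR ger0_norm // sqr_ge0.
- move=> u v u' v'; split=> [h x|h]; first by rewrite /hip_phi h.
  exact: gelfand_inj.
Qed.

Definition ip_phi {H : hilbertType R} (_ : unit) (u v : H) : C := ip u v.

Lemma ip_re (H : hilbertType R) (u : H) : complex.Re (ip u u) = nrm u ^+ 2.
Proof. by rewrite ip_norm nrmE -rmorphXn. Qed.

Lemma ip_fam (H : hilbertType R) : ipfam (ip : H -> H -> C) (@ip_phi H).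
Proof.
split.
- move=> k; split.
  + by move=> u v w; rewrite /ip_phi ipDr.
  + by move=> c u v; rewrite /ip_phi ipZr.
  + by move=> u v; rewrite /ip_phi ip_conj.
  + by move=> u; rewrite /ip_phi ip_norm nrmE -rmorphXn lecR sqr_ge0.
- by move=> k u; rewrite ip_re.
- by move=> u _; exists tt; rewrite ip_re.
- by move=> u v u' v'; split=> [h k|h]; [exact: h | exact: (h tt)].
Qed.

Lemma sn_ip (H : hilbertType R) k (u : H) : sn (ip_phi k) u = nrm u.
Proof. by rewrite /sn ip_re sqrtr_sqr ger0_norm ?nrm_ge0. Qed.

Lemma ip_CS (H : hilbertType R) (u v : H) : nrm (ip u v) <= nrm u * nrm v.
Proof. by have := sn_CS (fam_sip (ip_fam H) tt) u v; rewrite !sn_ip. Qed.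

End Families.

(** * Operators on the localization at a character *)

Section Push.
Context {R : realType} {A : commCstarType R} {E : hilbertModType A}.
Local Notation C := R[i].
Variables (chi : charspace A) (L : localization E chi).
Implicit Types (T : E -> E) (S : L -> L) (v w : L) (x y : E).
Local Notation phi := (@hip_phi R A E chi).
Let HE := hip_fam E.
Let HL := ip_fam L.
Let sE : sip phi := fam_sip HE chi.
Local Notation push := (@push_op R A E chi L).
Let sL : sip (ip : L -> L -> C) := fam_sip HL tt.

(** Every elementary tensor has this form, as x (x) l = (l x) (x) 1, so the image is a dense
    subspace; its norm is the seminorm of E at chi. *)
Definition iota x : L := tens L x 1.

Lemma iotaD x y : iota (x + y) = iota x + iota y.
Proof. exact: tensDl. Qed.

Lemma iotaZ (c : C) x : iota (c *: x) = c *: iota x.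
Proof. exact: tensZl. Qed.

Lemma iotaB x y : iota (x - y) = iota x - iota y.
Proof. by rewrite iotaD -scaleN1r iotaZ scaleN1r. Qed.

Lemma iota0 : iota 0 = 0.
Proof. by have := iotaB 0 0; rewrite !subrr. Qed.

Lemma tensE x (l : C) : tens L x l = iota (l *: x).
Proof. by rewrite iotaZ -tensZr mulr1. Qed.

Lemma ip_iota x y : ip (iota x) (iota y) = phi x y.
Proof. by rewrite tens_ip rmorph1 mul1r mulr1. Qed.

Lemma nrm_iota x : nrm (iota x) = sn phi x.
Proof. by rewrite /sn -ip_iota ip_re sqrtr_sqr ger0_norm ?nrm_ge0. Qed.

Lemma iota_dense v (e : R) : 0 < e -> exists x, nrm (v - iota x) <= e.
Proof.
pose M := [set v : L | forall e : R, 0 < e -> exists x, nrm (v - iota x) <= e].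
suff MT : M = setT by have Mv : M v by [rewrite MT]; exact: Mv.
apply: tens_dense.
- apply: closed_nrm => w /existsNP[e' /not_implyP[e0 hn]].
  exists (e' / 2); first by lra.
  move=> u hu hMu; have e20 : 0 < e' / 2 by lra.
  have [x hx] := hMu _ e20; apply: hn; exists x.
  by have := nrm_tri u w (iota x); lra.
- by move=> x l e' e0; exists (l *: x); rewrite tensE subrr nrm0 ltW.
- move=> u w hu hw e' e0; have e20 : 0 < e' / 2 by lra.
  have [x hx] := hu _ e20; have [y hy] := hw _ e20; exists (x + y).
  rewrite iotaD opprD addrACA; apply: le_trans (nrmD _ _) _; lra.
Qed.

(** Only approximants within distance 1 are tested, so that K may depend on v and bound products in
    which the approximant occurs. *)
Lemma dense_le (f : L -> R) (K : R) v : 0 <= K ->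
  (forall x, nrm (v - iota x) <= 1 -> f v <= K * nrm (v - iota x)) -> f v <= 0.
Proof.
move=> K0 h; apply: (@harm_le _ _ K) => // n.
have [x hx] := iota_dense v (harm_gt0 n).
have h1 : nrm (v - iota x) <= 1.
  by apply: le_trans hx _; rewrite /harm invf_le1 ?ltr0Sn // ler1n.
by apply: le_trans (h x h1) _; rewrite ler_wpM2l.
Qed.

Lemma dense_bnd S (M : R) : adjointable ip S -> 0 <= M ->
  (forall x, nrm (S (iota x)) <= M * nrm (iota x)) -> bnd (@ip_phi R L) S M.
Proof.
move=> aS M0 h k v; rewrite !sn_ip -subr_le0.
have [K K0 bS] := adjointable_bnd HL aS; case: (aS) => S' aSS'.
apply: (@dense_le (fun v => nrm (S v) - M * nrm v) (K + M)); first by rewrite addr_ge0.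
move=> x _.
have h1 : nrm (S (v - iota x)) <= K * nrm (v - iota x) := bnd_nrm HL _ K0 bS.
rewrite (adjB_arg HL _ _ aSS') in h1.
have h2 : nrm (S v) <= nrm (S v - S (iota x)) + nrm (S (iota x)).
  by have := nrmD (S v - S (iota x)) (S (iota x)); rewrite subrK.
have h3 : M * nrm (iota x) <= M * (nrm v + nrm (v - iota x)).
  rewrite ler_wpM2l //; have := nrmB v (v - iota x).
  by rewrite opprB addrC subrK.
have := h x; lra.
Qed.

Lemma dense_eq S U : adjointable ip S -> adjointable ip U ->
  (forall x, S (iota x) = U (iota x)) -> S = U.
Proof.
move=> [S' aS] [U' aU] h.
have aD := adjD HL aS (adjN HL aU).
have hb : bnd (@ip_phi R L) (fun v => S v - U v) 0.
  apply: dense_bnd => // [|x]; first by exists (fun v => S' v - U' v).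
  by rewrite h subrr nrm0 mul0r.
apply/funext => v; apply/eqP; rewrite -subr_eq0; apply/eqP.
apply: (fam_eq0 HL) => k; have := hb k v; by rewrite mul0r.
Qed.

Lemma dense_ge0 S v : adjointable ip S ->
  (forall x, 0 <= complex.Re (ip (iota x) (S (iota x)))) -> 0 <= complex.Re (ip v (S v)).
Proof.
move=> aS h; have [K K0 bS] := adjointable_bnd HL aS; case: (aS) => S' aSS'.
rewrite -oppr_le0.
apply: (@dense_le (fun v => - complex.Re (ip v (S v))) (K * (nrm v + (nrm v + 1)))).
  by rewrite mulr_ge0 // !addr_ge0 ?nrm_ge0.
move=> x x1; set d := nrm (v - iota x).
have e : ip (iota x) (S (iota x)) = ip v (S v) - (ip v (S (v - iota x)) + ip (v - iota x) (S (iota x))).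
  rewrite (adjB_arg HL _ _ aSS') (sipDr sL) (sipNr sL) (sipDl sL) (sipNl sL) /ip_phi.
  ring.
have := h x; rewrite e ReDc ReNc => h1.
have h2 : nrm (ip v (S (v - iota x))) <= nrm v * (K * d).
  apply: le_trans (ip_CS _ _) _; rewrite ler_wpM2l ?nrm_ge0 //.
  exact: (bnd_nrm HL _ K0 bS).
have h3 : nrm (ip (v - iota x) (S (iota x))) <= d * (K * (nrm v + 1)).
  apply: le_trans (ip_CS _ _) _; rewrite ler_wpM2l ?nrm_ge0 //.
  apply: le_trans (bnd_nrm HL _ K0 bS) _; rewrite ler_wpM2l //.
  have := nrmB v (v - iota x); rewrite opprB addrC subrK; move: x1; lra.
have := Re_le_nrm (- (ip v (S (v - iota x)) + ip (v - iota x) (S (iota x)))).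
rewrite nrmN ReNc; have := nrmD (ip v (S (v - iota x))) (ip (v - iota x) (S (iota x))).
have := ler_Re_nrm (ip v (S (v - iota x)) + ip (v - iota x) (S (iota x))).
rewrite ler_norml => /andP[h4 h5]; lra.
Qed.

Lemma extension T (M : R) : 0 <= M -> adjointable hip T -> bnd (@hip_phi R A E) T M ->
  exists S : L -> L, forall v x, nrm (S v - iota (T x)) <= M * nrm (v - iota x).
Proof.
move=> M0 [T' aT] bT.
suff h v : exists l, forall x, nrm (l - iota (T x)) <= M * nrm (v - iota x).
  by have [S hS] := choice h; exists S.
have [x hx] := choice (fun n => iota_dense v (harm_gt0 n)).
have dT y z : nrm (iota (T y) - iota (T z)) <= M * nrm (iota y - iota z).
  by rewrite -!iotaB -(adjB_arg HE _ _ aT) !nrm_iota.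
have [e e0|n m nm|l hl] := @complete_rate _ _ (fun n => iota (T (x n))) (fun n => M * (2 * harm n)).
- have [N hN] := harm_small_mul (M * 2) e0; exists N.
  by rewrite mulrA.
- apply: le_trans (dT _ _) _; rewrite ler_wpM2l //.
  have := nrm_tri v (iota (x m)) (iota (x n)); rewrite (nrm_subC _ v).
  have := hx n; have := hx m; have := harm_mono (R := R) nm; lra.
exists l => y; rewrite -subr_le0; apply: (@harm_le _ _ (3 * M)) => [|n].
  by rewrite mulr_ge0.
have h1 := nrm_tri (iota (T (x n))) l (iota (T y)).
have h2 := hl n; have h3 := dT (x n) y; have h4 := hx n.
have h5 : M * nrm (iota (x n) - iota y) <= M * (nrm (v - iota (x n)) + nrm (v - iota y)).
  by rewrite ler_wpM2l // (nrm_subC v (iota (x n))) nrm_tri.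
have h6 : M * nrm (v - iota (x n)) <= M * harm n by rewrite ler_wpM2l.
lra.
Qed.

(** T and its adjoint are extended separately; approximating both arguments leaves four error terms,
    each a multiple of 1 / (n + 1). *)
Lemma extension_adj T T' : is_adjoint hip T T' -> exists S S',
  [/\ is_adjoint ip S S', forall x, S (iota x) = iota (T x) & forall x, S' (iota x) = iota (T' x)].
Proof.
move=> aT; have aT' := adj_sym HE aT.
have adT : adjointable hip T by exists T'.
have [M M0 bT] := adjointable_bnd HE adT.
have bT' := adj_bnd HE M0 aT bT.
have [S hS] := extension M0 adT bT.
have adT' : adjointable hip T' by exists T.
have [S' hS'] := extension M0 adT' bT'.
exists S, S'; split; last 2 first.
- move=> x; apply/eqP; rewrite -subr_eq0 -nrm_eq0 eq_le nrm_ge0 andbT.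
  by have := hS (iota x) x; rewrite subrr nrm0 mulr0.
- move=> x; apply/eqP; rewrite -subr_eq0 -nrm_eq0 eq_le nrm_ge0 andbT.
  by have := hS' (iota x) x; rewrite subrr nrm0 mulr0.
move=> v w; apply/eqP; rewrite -subr_eq0 -nrm_eq0 eq_le nrm_ge0 andbT.
pose K := M * nrm w + (nrm (S v) + M) + nrm v * M + (nrm (S' w) + M).
apply: (@harm_le _ _ K) => [|n].
  by rewrite /K !addr_ge0 ?mulr_ge0 ?nrm_ge0.
have [x hx] := iota_dense v (harm_gt0 n); have [y hy] := iota_dense w (harm_gt0 n).
have h1 : harm n <= 1 :> R by rewrite /harm invf_le1 ?ltr0Sn // ler1n.
have h0 := harm_gt0 (R := R) n.
have /(adjP HE) aTP := aT.
have e : ip (S v) w - ip v (S' w) = ip (S v - iota (T x)) w + ip (iota (T x)) (w - iota y)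
   - ip v (S' w - iota (T' y)) - ip (v - iota x) (iota (T' y)).
  rewrite (sipDl sL) (sipNl sL) !(sipDr sL) !(sipNr sL) (sipDl sL) (sipNl sL) /ip_phi.
  have -> : ip (iota (T x)) (iota y) = ip (iota x) (iota (T' y)) by rewrite !ip_iota aTP.
  ring.
have b1 : nrm (ip (S v - iota (T x)) w) <= M * harm n * nrm w.
  apply: le_trans (ip_CS _ _) _; rewrite ler_wpM2r ?nrm_ge0 //.
  by apply: le_trans (hS v x) _; rewrite ler_wpM2l.
have b2 : nrm (ip (iota (T x)) (w - iota y)) <= (nrm (S v) + M) * harm n.
  apply: le_trans (ip_CS _ _) _; apply: ler_pM; rewrite ?nrm_ge0 //.
  have := nrmB (S v) (S v - iota (T x)); rewrite opprB addrC subrK => h2.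
  have : M * nrm (v - iota x) <= M by rewrite ler_piMr //; lra.
  by have := hS v x; lra.
have b3 : nrm (ip v (S' w - iota (T' y))) <= nrm v * (M * harm n).
  apply: le_trans (ip_CS _ _) _; rewrite ler_wpM2l ?nrm_ge0 //.
  by apply: le_trans (hS' w y) _; rewrite ler_wpM2l.
have b4 : nrm (ip (v - iota x) (iota (T' y))) <= harm n * (nrm (S' w) + M).
  apply: le_trans (ip_CS _ _) _; apply: ler_pM; rewrite ?nrm_ge0 //.
  have := nrmB (S' w) (S' w - iota (T' y)); rewrite opprB addrC subrK => h2.
  have : M * nrm (w - iota y) <= M by rewrite ler_piMr //; lra.
  by have := hS' w y; lra.
rewrite e; set p1 := ip _ w in b1 *; set p2 := ip _ (w - _) in b2 *.
set p3 := ip v _ in b3 *; set p4 := ip (v - _) _ in b4 *.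
have := nrmB (p1 + p2 - p3) p4; have := nrmB (p1 + p2) p3; have := nrmD p1 p2.
rewrite /K; lra.
Qed.

Lemma push_opP T : adjointable hip T ->
  adjointable ip (push T) /\ forall x, push T (iota x) = iota (T x).
Proof.
move=> [T' aT]; have [S [S' [aS h h']]] := extension_adj aT.
have [|h1 h2] := @getPex _ [set S : L -> L | adjointable ip S /\
    forall x l, S (tens L x l) = tens L (T x) l].
  exists S; split; first by exists S'.
  by move=> x l; rewrite !tensE h (adjZ_arg HE _ _ aT).
by split=> // x; exact: h2.
Qed.

Lemma push_op_adj T T' : is_adjoint hip T T' -> is_adjoint ip (push T) (push T').
Proof.
move=> aT; have [S [S' [aS h h']]] := extension_adj aT.
have aT' := adj_sym HE aT; have aS' := adj_sym HL aS.
have [|p1 p2] := @push_opP T; first by exists T'.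
have [|p3 p4] := @push_opP T'; first by exists T.
have -> : push T = S by apply: dense_eq => [||x]; [|exists S'|rewrite p2 h].
by have -> : push T' = S' by apply: dense_eq => [||x]; [|exists S|rewrite p4 h'].
Qed.

Lemma push_pos1 T : pos1 hip (@hip_phi R A E) T ->
  pos1 ip (@ip_phi R L) (push T).
Proof.
move=> [aT h]; have aS := push_op_adj aT; split=> // k v.
have aTT : adjointable hip T by exists T.
have [aSS hS] := push_opP aTT.
apply/andP; split.
  apply: dense_ge0 => // x; rewrite hS ip_iota.
  by have /andP[] := h chi x.
rewrite sn_ip -ip_re -subr_ge0 -ReNc -ReDc -(sipNr sL) -(sipDr sL).
have aD : is_adjoint ip (fun v => v - push T v) (fun v => v - push T v).
  exact: (adjD HL (@adj_id _ _ _ _) (adjN HL aS)).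
apply: (@dense_ge0 (fun v => v - push T v)); first by exists (fun v => v - push T v).
move=> x; rewrite hS -iotaB ip_iota (sipDr sE) (sipNr sE) ReDc ReNc subr_ge0.
by have /andP[_] := h chi x; rewrite (sn_sqr sE).
Qed.

Lemma push_pop T (q : {poly C}) x : adjointable hip T ->
  pop (push T) q (iota x) = iota (pop T q x).
Proof.
move=> /push_opP[_ h].
have it n : iter n (push T) (iota x) = iota (iter n T x).
  by elim: n => [//|n IH]; rewrite !iterS IH h.
rewrite /pop; apply: (big_rec2 (fun (u : L) (y : E) => u = iota y)); first by rewrite iota0.
by move=> i y u _ ->; rewrite iotaD iotaZ it.
Qed.

(** Localization commutes with the calculus: the same polynomials serve, since the bound at the
    seminorm of chi is the norm bound on the image of [iota]. *)
Lemma push_fcalc (K : set C) T (f : C -> C) (S : E -> E) : adjointable hip T -> adjointable hip S ->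
  fcalc (@hip_phi R A E) K T f S -> fcalc (@ip_phi R L) K (push T) f (push S).
Proof.
move=> aT aS h e e0; have [q [hq bq]] := h e e0; exists q; split=> //.
have [pa ph] := push_opP aS; have [pT hT] := push_opP aT.
apply: dense_bnd; [|exact: ltW|].
  have [S' aS'] := pa; case: pT => T1 aT1; have [S2 aS2] := pop_adjointable HL aT1 q.
  by exists (fun v => S' v - S2 v); exact: (adjD HL aS' (adjN HL aS2)).
move=> x; rewrite ph push_pop // -iotaB !nrm_iota.
exact: bq.
Qed.

End Push.

(** * Traces *)

Section TraceSup.
Context {R : realType}.
Local Notation C := R[i].
Context {V : lmodType C}.
Variables (phi : V -> V -> C) (Hs : sip phi).
Implicit Types (P : V -> V).

(** The Gram matrix of x is at most B: sending the standard basis of C^J to x defines a map of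
    squared norm at most B. *)
Definition gram_le (J : finType) (x : J -> V) (B : R) := forall c : J -> C,
  complex.Re (phi (\sum_i c i *: x i) (\sum_i c i *: x i)) <= B * \sum_i nrm (c i) ^+ 2.

(* The supremum of these sums is the trace of a positive P; it depends on phi
   only, and not on the choice of a model of the localization. *)
Definition trset P : set R := [set s | exists (J : finType) (x : J -> V),
  gram_le x 1 /\ s = \sum_i complex.Re (phi (x i) (P (x i)))].

(** A relation rather than a value, so that it also asserts that the trace is finite. *)
Definition trlub P (t : R) := ubound (trset P) t /\ forall u, ubound (trset P) u -> t <= u.

Lemma trset0 P : trset P 0.
Proof.
exists void, (fun v : void => match v with end); split; last by rewrite big1 // => -[].
by move=> c; rewrite !big_pred0 ?mulr0; try (by case); rewrite (sip0r Hs).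
Qed.

Lemma trub_ge0 P t : ubound (trset P) t -> 0 <= t.
Proof. by apply; exact: trset0. Qed.

Lemma trlub_approx P t (e : R) : trlub P t -> 0 < e -> exists2 s, trset P s & t - e < s.
Proof.
move=> [_ h] e0; apply: contrapT => hn.
have : t <= t - e; last by lra.
by apply: h => s hs; rewrite leNgt; apply/negP => hlt; apply: hn; exists s.
Qed.

Lemma trlub_sup P t : ubound (trset P) t -> trlub P (sup (trset P)).
Proof.
move=> ht; have hs : has_sup (trset P) by split; [exists 0; exact: trset0 | exists t].
split; first by move=> s hS; apply: (ub_le_sup (proj2 hs)).
by move=> u hu; apply: ge_sup => //; case: hs.
Qed.

Lemma trub_gram P t (J : finType) (x : J -> V) (B : R) : 0 < B ->
  (forall (c : C) y, P (c *: y) = c *: P y) ->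
  ubound (trset P) t -> gram_le x B ->
  \sum_i complex.Re (phi (x i) (P (x i))) <= B * t.
Proof.
move=> B0 PZ ht hx; pose b : R := (Num.sqrt B)^-1.
have b0 : 0 < b by rewrite invr_gt0 sqrtr_gt0.
have bB : b ^+ 2 = B^-1 by rewrite exprVn sqr_sqrtr // ltW.
rewrite -ler_pdivrMl //; apply: ht; exists J, (fun i => b%:C *: x i); split.
  move=> c.
  have -> : \sum_i c i *: (b%:C *: x i) = b%:C *: \sum_i c i *: x i.
    by rewrite scaler_sumr; apply: eq_bigr => i _; rewrite !scalerA mulrC.
  rewrite (sip_qZ Hs) nrmR ger0_norm ?(ltW b0) // bB mul1r.
  by rewrite ler_pdivrMl //; exact: hx.
rewrite mulr_sumr; apply: eq_bigr => i _.
rewrite PZ (sipZr Hs) (sipZl Hs) conjc_real mulrA -rmorphM ReMc -expr2 bB.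
by [].
Qed.

(** With s the sum on the left, the vector w satisfies <w, v> = s and |w|^2 <= s, so Cauchy-Schwarz
    gives s^2 <= s |v|^2. *)
Lemma bessel (J : finType) (x : J -> V) v : gram_le x 1 ->
  \sum_i nrm (phi (x i) v) ^+ 2 <= complex.Re (phi v v).
Proof.
move=> hx; set s := \sum_i _.
have s0 : 0 <= s by apply: sumr_ge0 => i _; rewrite sqr_ge0.
pose w := \sum_i phi (x i) v *: x i.
have hw := hx (fun i => phi (x i) v); rewrite -/w mul1r -/s in hw.
have wv : phi w v = s%:C.
  rewrite /w /s; elim/big_rec2: _ => [|i y1 y2 _ IH]; first by rewrite (sip0l Hs).
  by rewrite (sipDl Hs) (sipZl Hs) mul_conj IH rmorphD.
have := sip_CS Hs w v; rewrite wv nrmR ger0_norm // => h.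
have [->|sn0] := eqVneq s 0; first exact: sip_q_ge0.
have sp : 0 < s by rewrite lt_neqAle eq_sym sn0.
rewrite -(ler_pM2l sp) -expr2; apply: le_trans h _.
by rewrite ler_wpM2r // sip_q_ge0.
Qed.

(** Each term is at most the root of the sum of squares. The square of the cardinality is crude but
    suffices, as it is multiplied by arbitrarily small numbers. *)
Lemma sum_sqr_bound (J : finType) (c : J -> C) :
  (\sum_i nrm (c i)) ^+ 2 <= #|J|%:R ^+ 2 * \sum_i nrm (c i) ^+ 2.
Proof.
set s := \sum_i nrm (c i) ^+ 2.
have s0 : 0 <= s by apply: sumr_ge0 => i _; rewrite sqr_ge0.
have h i : nrm (c i) <= Num.sqrt s.
  rewrite -[leLHS]ger0_norm ?nrm_ge0 // -sqrtr_sqr ler_sqrt // /s (bigD1 i) //=.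
  by rewrite lerDl sumr_ge0 // => j _; rewrite sqr_ge0.
have : \sum_i nrm (c i) <= #|J|%:R * Num.sqrt s.
  apply: le_trans (ler_sum _ (fun i _ => h i)) _.
  by rewrite sumr_const mulr_natl.
move=> h2; rewrite -[in leRHS](sqr_sqrtr s0) -exprMn ler_pXn2r ?nnegrE //.
  by apply: sumr_ge0 => i _; exact: nrm_ge0.
Qed.

End TraceSup.

Local Instance totally_is_filter (I : choiceType) : Filter (@summability.totally I).
Proof. exact: (@filter_filter _ _ (@summability.totally_filter I)). Qed.

(** * The trace on a Hilbert space as a supremum *)

Section HilbertTraces.
Context {R : realType} {H : hilbertType R}.
Local Notation C := R[i].
Let sH : sip (ip : H -> H -> C) := fam_sip (ip_fam H) tt.

(** [is_trace] quantifies over all bases; the uniqueness of its value rests on the existence of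
    one. *)
Lemma orthonormal_basis_ex : exists (I : choiceType) (e : I -> H), orthonormal_basis e.
Proof.
pose ON (M : set H) := forall u v, M u -> M v -> ip u v = (u == v)%:R.
have [F hF tot|M [hM maxM]] := @Zorn_bigcup H ON.
  move=> u v [A FA Au] [B FB Bv].
  have [AB|BA] := tot A B FA FB.
    by apply: (hF _ FB) => //; exact: AB.
  by apply: (hF _ FA) => //; exact: BA.
exists M, (fun i : M => set_val i); split.
  by move=> i j; rewrite hM ?(inj_eq val_inj) //; exact: set_valP.
move=> x hx; apply: contrapT => /eqP x0.
have n0 : 0 < nrm x by rewrite nrm_gt0.
pose u := (nrm x)^-1%:C *: x.
have uu : ip u u = 1.
  rewrite (sip_q sH) (sip_qZ sH) nrmR ger0_norm ?invr_ge0 ?nrm_ge0 // ip_re.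
  by rewrite -exprMn mulVf ?gt_eqF // expr1n.
have uM v : M v -> ip v u = 0.
  move=> Mv; rewrite /u ipZr; have := hx (SigSub (mem_set Mv)) => /= ->.
  by rewrite mulr0.
have nMu : ~ M u by move=> Mu; have := uM u Mu; rewrite uu => /eqP; rewrite oner_eq0.
apply: (maxM (M `|` [set u])).
  by split; [exact: subsetUl | move=> h; apply: nMu; apply: h; right].
have sym v : M v -> (v == u) = false.
  by move=> Mv; apply/eqP => e; apply: nMu; rewrite -e.
move=> v w [Mv|->] [Mw|->].
- exact: hM.
- by rewrite uM // sym.
- by rewrite -(sip_conj sH) uM // conjc0 eq_sym sym.
- by rewrite uu eqxx.
Qed.

Section Basis.
Variables (I : choiceType) (e : I -> H).
Hypothesis he : orthonormal_basis e.

Lemma onb_gram (F : {fset I}) : gram_le (ip : H -> H -> C) (fun i : F => e (val i)) 1.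
Proof.
have [ho _] := he; move=> c; rewrite mul1r.
set w := \sum_i _.
have hw i : ip (e (val i)) w = c i.
  rewrite /w; have -> : ip (e (val i)) (\sum_j c j *: e (val j)) = \sum_j c j * (i == j)%:R.
    elim/big_rec2: _ => [|j y1 y2 _ IH]; first by rewrite (sip0r sH).
    by rewrite ipDr ipZr ho IH (inj_eq val_inj).
  rewrite (bigD1 i) //= eqxx mulr1 big1 ?addr0 // => j ji.
  by rewrite eq_sym (negbTE ji) mulr0.
have -> : ip w w = \sum_i (nrm (c i) ^+ 2)%:C.
  rewrite {1}/w; elim/big_rec2: _ => [|j y1 y2 _ IH]; first by rewrite (sip0l sH).
  by rewrite (sipDl sH) (sipZl sH) hw mul_conj IH.
by rewrite Re_sum.
Qed.

(* The Fourier partial sums of v over finite sets that nearly maximize the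
   Bessel sum form a Cauchy sequence, whose limit is v by totality. *)
Lemma parseval (v : H) (eps : R) : 0 < eps ->
  exists F : {fset I}, nrm v ^+ 2 <= \sum_(i : F) nrm (ip (e (val i)) v) ^+ 2 + eps.
Proof.
move=> eps0; have [ho ht] := he.
pose c i := ip (e i) v; pose S (F : {fset I}) := \sum_(i <- F) nrm (c i) ^+ 2.
have SE (F : {fset I}) : \sum_(i : F) nrm (ip (e (val i)) v) ^+ 2 = S F.
  by rewrite /S big_seq_fsetE.
have Sle (F : {fset I}) : S F <= nrm v ^+ 2.
  by rewrite -SE -(ip_re v); apply: (bessel sH v (@onb_gram F)).
pose A := [set S F | F in setT].
have hA : has_sup A.
  by split; [exists (S fset0), fset0 | exists (nrm v ^+ 2) => _ [F _ <-]].
have mono (F G : {fset I}) : (F `<=` G)%fset -> S F <= S G.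
  move=> FG; rewrite /S [leRHS](big_fsetID _ (mem F)) /=.
  have -> : \sum_(i <- [fset x | x in G & x \in F]%fset) nrm (c i) ^+ 2 = \sum_(i <- F) nrm (c i) ^+ 2.
    congr (\sum_(i <- enum_fset _) _); apply/fsetP => i; rewrite !inE.
    by apply: andb_idl => /(fsubsetP FG).
  by rewrite lerDl sumr_ge0 // => i _; rewrite sqr_ge0.
pose w (F : {fset I}) := \sum_(i <- F) c i *: e i.
have ipw F i : ip (e i) (w F) = if i \in F then c i else 0.
  rewrite /w; have -> : ip (e i) (\sum_(j <- F) c j *: e j) = \sum_(j <- F) c j * (i == j)%:R.
    elim/big_rec2: _ => [|j y1 y2 _ IH]; first by rewrite (sip0r sH).
    by rewrite ipDr ipZr ho IH.
  case: ifPn => iF.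
    rewrite (big_fsetD1 i) //= eqxx mulr1 big_seq big1 ?addr0 // => j.
    by rewrite !inE => /andP[ji _]; rewrite eq_sym (negbTE ji) mulr0.
  rewrite big_seq big1 // => j jF; case: eqP => [ij|_]; last by rewrite mulr0.
  by rewrite ij jF in iF.
have ipvw F : ip (w F) v = (S F)%:C.
  rewrite /w /S; elim/big_rec2: _ => [|j y1 y2 _ IH]; first by rewrite (sip0l sH).
  by rewrite (sipDl sH) (sipZl sH) -/(c j) mul_conj IH rmorphD.
have ipww (F G : {fset I}) : (F `<=` G)%fset -> ip (w F) (w G) = (S F)%:C.
  move=> FG; rewrite {1}/w /S; rewrite !big_seq.
  elim/big_rec2: _ => [|j y1 y2 jF IH]; first by rewrite (sip0l sH).
  by rewrite (sipDl sH) (sipZl sH) ipw (fsubsetP FG) // mul_conj IH rmorphD.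
have dist (F G : {fset I}) : (F `<=` G)%fset -> nrm (w G - w F) ^+ 2 = S G - S F.
  move=> FG; rewrite -ip_re (sipDr sH) !(sipDl sH) !(sipNr sH) !(sipNl sH).
  rewrite -(sip_conj sH (w F) (w G)) !ipww ?fsubset_refl // conjc_real.
  by rewrite !(ReDc, ReNc) /=; ring.
have /choice[F0 hF0] : forall n, exists F, sup A - harm n ^+ 2 < S F.
  move=> n; have h2 : 0 < harm n ^+ 2 :> R by rewrite exprn_gt0 // harm_gt0.
  by have [_ [F _ <-] h] := sup_adherent h2 hA; exists F.
(* Unions make the sets increase, so that squared distances of partial sums are differences of S. *)
pose Fn := fix Fn n := if n is m.+1 then (Fn m `|` F0 n)%fset else F0 0%N.
have FF0 n : sup A - harm n ^+ 2 < S (Fn n).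
  apply: lt_le_trans (hF0 n) _; apply: mono.
  by case: n => [|n] /=; [exact: fsubset_refl | exact: fsubsetUr].
have FnS n m : (n <= m)%N -> (Fn n `<=` Fn m)%fset.
  elim: m => [|m IH]; first by rewrite leqn0 => /eqP->.
  rewrite leq_eqVlt ltnS => /orP[/eqP->//|/IH h].
  by apply: fsubset_trans h _; exact: fsubsetUl.
have Sup (F : {fset I}) : S F <= sup A by apply: (ub_le_sup (proj2 hA)); exists F.
have [l hl] : exists l, forall n, nrm (l - w (Fn n)) <= harm n.
  apply: (@complete_rate R H (fun n => w (Fn n)) harm); first exact: harm_small.
  move=> n m nm; rewrite -(@ler_pXn2r _ 2) ?nnegrE ?nrm_ge0 ?(ltW (harm_gt0 _)) //.
  rewrite dist ?FnS //; have := FF0 n; have := Sup (Fn m); lra.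
have lv : v - l = 0.
  apply: ht => i; apply/eqP; rewrite -nrm_eq0 eq_le nrm_ge0 andbT.
  apply: (@harm_le _ _ 2) => // n.
  have -> : ip (e i) (v - l) = (c i - ip (e i) (w (Fn n))) - ip (e i) (l - w (Fn n)).
    by rewrite !ipDr !(sipNr sH) /c; ring.
  have h1 : nrm (ip (e i) (l - w (Fn n))) <= harm n.
    apply: le_trans (ip_CS _ _) _; apply: le_trans (hl n).
    have -> : nrm (e i) = 1; last by rewrite mul1r.
    apply/eqP; rewrite -(@eqrXn2 _ 2) ?nrm_ge0 // -ip_re ho eqxx expr1n //.
  apply: le_trans (nrmB _ _) _.
  suff : nrm (c i - ip (e i) (w (Fn n))) <= harm n by move: h1; lra.
  rewrite ipw; case: ifPn => iF; first by rewrite subrr nrm0 ltW // harm_gt0.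
  rewrite subr0 -(@ler_pXn2r _ 2) ?nnegrE ?nrm_ge0 ?(ltW (harm_gt0 _)) //.
  (* An index outside a nearly maximal set can contribute only the missing amount, less than 1 / (n
     + 1)^2. *)
  have : S (i |` Fn n)%fset = nrm (c i) ^+ 2 + S (Fn n) by rewrite /S big_fsetU1.
  have := Sup (i |` Fn n)%fset; have := FF0 n; lra.
pose K := nrm v; have [n hn] := @harm_small_mul R (2 * (K + K)) eps eps0.
exists (Fn n); rewrite SE.
have e1 : nrm v ^+ 2 = S (Fn n) + complex.Re (ip (v - w (Fn n)) v).
  by rewrite (sipDl sH) (sipNl sH) ipvw ReDc ReNc /= ip_re addrC subrK.
rewrite e1 lerD2l; apply: le_trans (Re_le_nrm _) _; apply: le_trans (ip_CS _ _) _.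
apply: le_trans hn; have hv : v = l by apply/eqP; rewrite -subr_eq0 lv.
have := hl n; rewrite -hv => h.
have h2 : nrm (v - w (Fn n)) * nrm v <= harm n * nrm v by rewrite ler_wpM2r ?nrm_ge0.
have h3 : 0 <= harm n * nrm v by rewrite mulr_ge0 ?nrm_ge0 // ltW // harm_gt0.
rewrite /K; lra.
Qed.

Variables (P Q : H -> H).
Hypotheses (aQ : is_adjoint ip Q Q) (PQ : P = Q \o Q).

Let PE u : complex.Re (ip u (P u)) = nrm (Q u) ^+ 2.
Proof. by rewrite PQ /= -aQ ip_re. Qed.

Let S (F : {fset I}) := \sum_(i : F) complex.Re (ip (e (val i)) (P (e (val i)))).

Let S_mono F G : (F `<=` G)%fset -> S F <= S G.
Proof.
move=> FG; pose f i := complex.Re (ip (e i) (P (e i))).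
have -> : S F = \sum_(i <- F) f i by rewrite /S big_seq_fsetE.
have -> : S G = \sum_(i <- G) f i by rewrite /S big_seq_fsetE.
rewrite [leRHS](big_fsetID _ (mem F)) /=.
have -> : \sum_(i <- [fset x | x in G & x \in F]%fset) f i = \sum_(i <- F) f i.
  congr (\sum_(i <- enum_fset _) _); apply/fsetP => i; rewrite !inE.
  by apply: andb_idl => /(fsubsetP FG).
by rewrite lerDl sumr_ge0 // => i _; rewrite /f PE sqr_ge0.
Qed.

Let S_trset F : trset (ip : H -> H -> C) P (S F).
Proof. by exists F, (fun i : F => e (val i)); split=> //; exact: onb_gram. Qed.

(** Parseval expands |Q x_i|^2 along e up to a small error; after exchanging the sums, Bessel for
    the family x bounds the part at e_j by |Q e_j|^2. *)
Let S_cofinal s (eps : R) : 0 < eps -> trset (ip : H -> H -> C) P s ->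
  exists F, s <= S F + eps.
Proof.
move=> eps0 [J [x [hx ->]]].
have d0 : 0 < eps / (#|J|%:R + 1) by rewrite divr_gt0 // ltr_wpDl.
have [F hF] := choice (fun i => parseval (Q (x i)) d0).
pose G : {fset I} := \big[fsetU/fset0]_(i : J) F i.
have FG i : (F i `<=` G)%fset by apply: bigfcup_sup; rewrite ?mem_index_enum.
exists G.
have hG i : nrm (Q (x i)) ^+ 2 <= \sum_(j : G) nrm (ip (e (val j)) (Q (x i))) ^+ 2 + eps / (#|J|%:R + 1).
  apply: le_trans (hF i) _; rewrite lerD2r.
  pose f j := nrm (ip (e j) (Q (x i))) ^+ 2.
  have fE (F' : {fset I}) : \sum_(j : F') nrm (ip (e (val j)) (Q (x i))) ^+ 2 = \sum_(j <- F') f j.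
    by rewrite big_seq_fsetE.
  rewrite !fE.
  rewrite [leRHS](big_fsetID _ (mem (F i))) /=.
  have -> : [fset x | x in G & x \in F i]%fset = F i.
    by apply/fsetP => j; rewrite !inE; apply: andb_idl => /(fsubsetP (FG i)).
  by rewrite lerDl sumr_ge0 // => j _; rewrite sqr_ge0.
have h1 : \sum_i complex.Re (ip (x i) (P (x i))) <=
   \sum_i (\sum_(j : G) nrm (ip (e (val j)) (Q (x i))) ^+ 2 + eps / (#|J|%:R + 1)).
  by apply: ler_sum => i _; rewrite PE.
apply: le_trans h1 _; rewrite big_split /= exchange_big /=; apply: lerD.
  apply: ler_sum => j _; rewrite PE -ip_re.
  apply: le_trans (bessel sH (Q (e (val j))) hx).
  apply: ler_sum => i _; rewrite le_eqVlt; apply/orP; left; apply/eqP.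
  by rewrite -aQ (sip_nrm_sym sH).
rewrite sumr_const -[_ *+ _]mulr_natl mulrA ler_pdivrMr ?ltr_wpDl // mulrC.
by rewrite ler_wpM2l ?(ltW eps0) // lerDl.
Qed.

Let partial F : summability.partial_sum (fun i => ip (e i) (P (e i)) : C^o) F = (S F)%:C.
Proof.
rewrite /summability.partial_sum /S rmorph_sum /=; apply: eq_bigr => i _.
by rewrite PQ /= -aQ (sip_q sH).
Qed.

Lemma trace_cvg t : trlub (ip : H -> H -> C) P t ->
  summability.partial_sum (fun i => ip (e i) (P (e i)) : C^o)
    @ summability.totally --> (t%:C : C^o).
Proof.
move=> ht; apply/(@cvg_nrmP R C^o) => eps eps0.
have e20 : 0 < eps / 2 by lra.
have [s hs st] := trlub_approx ht e20.
have [F0 hF0] := S_cofinal e20 hs.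
exists F0 => // F /= FF; rewrite partial.
have -> : @nrm R C^o (t%:C - (S F)%:C) = `|t - S F| by rewrite -rmorphB; exact: nrmR.
have h1 := S_mono FF; have h2 := proj1 ht _ (S_trset F).
by rewrite ger0_norm; lra.
Qed.

Lemma trace_lub (t : C) :
  summability.partial_sum (fun i => ip (e i) (P (e i)) : C^o)
    @ summability.totally --> (t : C^o) ->
  t = (complex.Re t)%:C /\ trlub (ip : H -> H -> C) P (complex.Re t).
Proof.
move=> /(@cvg_nrmP R C^o) h.
have near (eps : R) : 0 < eps -> exists F0, forall F, (F0 `<=` F)%fset -> nrm (t - (S F)%:C) <= eps.
  move=> eps0; have [F0 _ hF0] := h _ eps0; exists F0 => F FF.
  by have := hF0 F FF; rewrite /= partial.
have im0 : complex.Im t = 0.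
  apply/eqP; rewrite -normr_eq0 eq_le normr_ge0 andbT; apply/ler_addgt0Pl => eps eps0.
  have [F hF] := near _ eps0; have := hF F (fsubset_refl F); rewrite addr0.
  by apply: le_trans; apply: le_trans (ler_Im_nrm _); rewrite ImDc ImNc subr0.
have et : t = (complex.Re t)%:C by case: t im0 {h near} => u v /= ->.
split=> //; split.
  move=> s hs; apply/ler_addgt0Pl => eps eps0; have e20 : 0 < eps / 2 by lra.
  have [F hF] := S_cofinal e20 hs; have [F0 hF0] := near _ e20.
  have h1 := S_mono (fsubsetUl F F0).
  have := hF0 _ (fsubsetUr F F0); rewrite et -rmorphB nrmR ler_norml /= => /andP[h2 _].
  by lra.
move=> u hu; apply/ler_addgt0Pl => eps eps0; have [F hF] := near _ eps0.
have := hF F (fsubset_refl F); rewrite et -rmorphB nrmR ler_norml /= => /andP[_ h2].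
by have := hu _ (S_trset F); lra.
Qed.

End Basis.

(** The right side mentions no basis, so this also contains the independence of the trace from the
    basis. *)
Lemma is_traceP (P Q : H -> H) (t : R) : is_adjoint ip Q Q -> P = Q \o Q ->
  is_trace P t%:C <-> trlub (ip : H -> H -> C) P t.
Proof.
move=> aQ PQ; split=> [h|h I e he]; last exact: (trace_cvg he aQ PQ h).
have [I [e he]] := orthonormal_basis_ex.
by have [_] := trace_lub he aQ PQ (h I e he).
Qed.

Lemma is_trace_real (P Q : H -> H) (t : C) : is_adjoint ip Q Q -> P = Q \o Q ->
  is_trace P t -> t = (complex.Re t)%:C.
Proof.
move=> aQ PQ h; have [I [e he]] := orthonormal_basis_ex.
by have [] := trace_lub he aQ PQ (h I e he).
Qed.

Lemma is_traceD (P Q : H -> H) (s t : C) : is_trace P s -> is_trace Q t ->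
  is_trace (fun v => P v + Q v) (s + t).
Proof.
move=> hP hQ I e he; have h1 := hP I e he; have h2 := hQ I e he.
have h3 := @cvgD C C^o _ _ _ _ _ _ _ h1 h2.
set g := summability.partial_sum _; suff -> : g =
  fun F => summability.partial_sum (fun i => ip (e i) (P (e i)) : C^o) F +
           summability.partial_sum (fun i => ip (e i) (Q (e i)) : C^o) F by exact: h3.
apply/funext => F; rewrite /g /summability.partial_sum -big_split /=.
by apply: eq_bigr => i _; rewrite ipDr.
Qed.

Lemma is_traceZ (c : C) (P : H -> H) (t : C) : is_trace P t ->
  is_trace (fun v => c *: P v) (c * t).
Proof.
move=> hP I e he; have h1 := hP I e he.
have h3 := @cvgM C _ _ _ _ _ _ _ (@cvg_cst C^o c _ (@summability.totally I) _) h1.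
set g := summability.partial_sum _; suff -> : g =
  fun F => c * summability.partial_sum (fun i => ip (e i) (P (e i)) : C^o) F by exact: h3.
apply/funext => F; rewrite /g /summability.partial_sum mulr_sumr.
by apply: eq_bigr => i _; rewrite ipZr.
Qed.

End HilbertTraces.

(** * Traces on localizations computed in the Hilbert module *)

Section Transfer.
Context {R : realType} {A : commCstarType R} {E : hilbertModType A}.
Local Notation C := R[i].
Local Notation phi := (@hip_phi R A E).
Let HE := hip_fam E.

Section OneCharacter.
Variables (chi : charspace A) (L : localization E chi).
Local Notation push := (@push_op R A E chi L).
Let HL := ip_fam L.
Let sE : sip (phi chi) := fam_sip HE chi.
Variables (P Q : E -> E).
Hypotheses (aQ : is_adjoint hip Q Q) (PQ : P = Q \o Q).

Let aP : is_adjoint hip P P.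
Proof. by rewrite PQ; exact: (adj_comp HE aQ aQ). Qed.

Let adQ : adjointable hip Q. Proof. by exists Q. Qed.

Let PE x : complex.Re (phi chi x (P x)) = sn (phi chi) (Q x) ^+ 2.
Proof. by rewrite PQ /= (sn_sqr sE); have /(adjP HE) <- := aQ. Qed.

Lemma push_sqr : push P = push Q \o push Q.
Proof.
have [pQ hQ] := push_opP L adQ; have [pP hP] := push_opP L (ex_intro _ P aP).
case: (pQ) => Q' aQ'; apply: (dense_eq pP) => [|x].
  by exists (Q' \o Q'); exact: (adj_comp HL aQ' aQ').
by rewrite /= hP !hQ PQ.
Qed.

(** Families in E map to families in L with the same Gram matrix. Conversely, a family u in L is
    approximated by iota x_i within d; the Gram matrix of x is then at most (1 + n d)^2, and all
    errors are multiples of d. *)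
Lemma trub_push t : ubound (trset (ip : L -> L -> C) (push P)) t <->
  ubound (trset (phi chi) P) t.
Proof.
have [_ hP] := push_opP L (ex_intro _ P aP); have [pQ hQ] := push_opP L adQ.
have aSQ : is_adjoint ip (push Q) (push Q) := push_op_adj aQ.
split=> ht.
  move=> _ [J [x [hx ->]]]; apply: ht; exists J, (fun i => iota L (x i)); split.
    move=> c; have -> : \sum_i c i *: iota L (x i) = iota L (\sum_i c i *: x i).
      elim/big_rec2: _ => [|i u y _ ->]; first by rewrite iota0.
      by rewrite iotaD iotaZ.
    by rewrite ip_iota; exact: hx.
  by apply: eq_bigr => i _; rewrite hP ip_iota.
move=> _ [J [u [hu ->]]].
have [K K0 bK] := adjointable_bnd HL pQ.
pose n : R := #|J|%:R; have n0 : 0 <= n by rewrite ler0n.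
have t0 : 0 <= t := trub_ge0 sE ht.
pose a i := nrm (push Q (u i)).
have a0 i : 0 <= a i by exact: nrm_ge0.
have eS : \sum_i complex.Re (ip (u i) (push P (u i))) = \sum_i a i ^+ 2.
  by apply: eq_bigr => i _; rewrite push_sqr /= -aSQ ip_re.
rewrite eS -subr_le0.
(* For |u_i - iota x_i| <= d <= 1, replacing u_i by x_i lowers |Q u_i|^2 by at most d times the i-th
   summand. *)
pose C1 := \sum_i (2 * K * (a i + K) + K ^+ 2).
have C10 : 0 <= C1.
  by apply: sumr_ge0 => i _; rewrite addr_ge0 ?sqr_ge0 // !mulr_ge0 // addr_ge0.
apply: (@harm_le _ _ (t * (2 * n + n ^+ 2) + C1)) => [|m].
  by rewrite addr_ge0 // mulr_ge0 // addr_ge0 ?sqr_ge0 // mulr_ge0.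
set d := harm m; have d0 : 0 < d := harm_gt0 m.
have d1 : d <= 1 by rewrite /d /harm invf_le1 ?ltr0Sn // ler1n.
have [x hx] := choice (fun i => iota_dense (u i) d0).
have hg : gram_le (phi chi) x ((1 + n * d) ^+ 2).
  move=> c; set s2 := \sum_i nrm (c i) ^+ 2.
  have s20 : 0 <= s2 by apply: sumr_ge0 => i _; rewrite sqr_ge0.
  set w := \sum_i c i *: x i; rewrite -(sn_sqr sE) -(nrm_iota L).
  have ew : iota L w = \sum_i c i *: u i - \sum_i c i *: (u i - iota L (x i)).
    rewrite -sumrB /w; elim/big_rec2: _ => [|i v y _ IH]; first by rewrite iota0.
    by rewrite iotaD iotaZ IH scalerBr subKr.
  have h1 : nrm (\sum_i c i *: u i) <= Num.sqrt s2.
    rewrite -[leLHS]ger0_norm ?nrm_ge0 // -sqrtr_sqr ler_sqrt // -ip_re.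
    by have := hu c; rewrite mul1r.
  have h2 : nrm (\sum_i c i *: (u i - iota L (x i))) <= n * d * Num.sqrt s2.
    apply: le_trans (nrm_sum _ _ _) _.
    apply: le_trans (_ : \sum_i nrm (c i) * d <= _).
      by apply: ler_sum => i _; rewrite nrmZ ler_wpM2l ?nrm_ge0.
    rewrite -mulr_suml mulrAC ler_wpM2r ?(ltW d0) //.
    rewrite -(@ler_pXn2r _ 2) ?nnegrE ?mulr_ge0 ?sqrtr_ge0 ?sumr_ge0 //; last by move=> i _; exact: nrm_ge0.
    by rewrite exprMn sqr_sqrtr // sum_sqr_bound.
  have h3 : nrm (iota L w) <= (1 + n * d) * Num.sqrt s2.
    by rewrite ew mulrDl mul1r; apply: le_trans (nrmB _ _) _; rewrite lerD.
  rewrite -[s2](sqr_sqrtr s20) -exprMn ler_pXn2r ?nnegrE ?nrm_ge0 //.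
  by rewrite mulr_ge0 ?sqrtr_ge0 // addr_ge0 // mulr_ge0 // ltW.
have B0 : 0 < (1 + n * d) ^+ 2 by rewrite exprn_gt0 // ltr_wpDr // mulr_ge0 // ltW.
have := trub_gram sE B0 (fun c y => adjZ_arg HE c y aP) ht hg.
pose b i := sn (phi chi) (Q (x i)).
have -> : \sum_i complex.Re (phi chi (x i) (P (x i))) = \sum_i b i ^+ 2.
  by apply: eq_bigr => i _; rewrite PE.
move=> hb.
have ab i : a i ^+ 2 <= b i ^+ 2 + d * (2 * K * (a i + K) + K ^+ 2).
  have b0 : 0 <= b i by exact: sn_ge0.
  have h1 : nrm (push Q (u i) - push Q (iota L (x i))) <= K * d.
    case: pQ => Q' aQ'; rewrite -(adjB_arg HL _ _ aQ').
    by apply: le_trans (bnd_nrm HL _ K0 bK) _; rewrite ler_wpM2l.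
  rewrite hQ in h1.
  have eb : b i = nrm (iota L (Q (x i))) by rewrite nrm_iota.
  have h2 : a i <= b i + K * d.
    have := nrmD (push Q (u i) - iota L (Q (x i))) (iota L (Q (x i))).
    by rewrite subrK -eb -/(a i); lra.
  have h3 : b i <= a i + K.
    have := nrmB (push Q (u i)) (push Q (u i) - iota L (Q (x i))).
    rewrite opprB addrC subrK -eb -/(a i).
    by have : K * d <= K by [rewrite ler_piMr]; lra.
  have h4 : a i ^+ 2 <= (b i + K * d) ^+ 2.
    by rewrite ler_pXn2r ?nnegrE // addr_ge0 // mulr_ge0 // ltW.
  apply: le_trans h4 _; rewrite sqrrD -addrA lerD2l mulrDr lerD //.
    rewrite -mulr_natl.
    have := ler_wpM2l (mulr_ge0 K0 (ltW d0)) h3; lra.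
  by rewrite exprMn [d * _]mulrC ler_wpM2l ?sqr_ge0 // expr2 ler_piMl // (ltW d0).
have h5 : \sum_i a i ^+ 2 <= \sum_i b i ^+ 2 + d * C1.
  by rewrite /C1 mulr_sumr -big_split; apply: ler_sum => i _; exact: ab.
have h6 : (1 + n * d) ^+ 2 * t <= t + d * (t * (2 * n + n ^+ 2)).
  have h7 : n ^+ 2 * (d * d) * t <= n ^+ 2 * d * t.
    by rewrite ler_wpM2r // ler_wpM2l ?sqr_ge0 // ler_piMl // ltW.
  rewrite sqrrD expr1n mul1r exprMn -mulr_natl [d ^+ 2]expr2; lra.
lra.
Qed.

Lemma trlub_push t : trlub (ip : L -> L -> C) (push P) t <-> trlub (phi chi) P t.
Proof.
by split=> -[h1 h2]; split; [exact/trub_push|move=> u /trub_push; exact: h2|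
  exact/trub_push|move=> u /trub_push; exact: h2].
Qed.

Lemma is_trace_push t : is_trace (push P) t%:C <-> trlub (phi chi) P t.
Proof.
have aSQ : is_adjoint ip (push Q) (push Q) := push_op_adj aQ.
rewrite (is_traceP t aSQ push_sqr); exact: trlub_push.
Qed.

End OneCharacter.

(* Near chi0 the Gram matrix of a finite family changes little, so that the
   rescaled family is admissible in the supremum defining the trace. *)
Lemma trace_lsc (P : E -> E) (chi0 : charspace A) (s eps : R) :
  (exists P', is_adjoint hip P P') -> 0 < eps -> 0 <= s ->
  trset (phi chi0) P s ->
  nbhs (set_val chi0 : {ptws A -> C^o}) [set psi | forall chi : charspace A, set_val chi = psi ->
    forall t, ubound (trset (phi chi) P) t -> s - eps <= t].
Proof.
move=> [P' aP] eps0 s0 [J [x [hx es]]].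
pose n : R := #|J|%:R; have n0 : 0 <= n by rewrite ler0n.
(* The Gram matrix grows by at most d n^2 and the sum drops by at most n d. The denominator makes d
   n^2 s + n d fall short of eps by d. *)
pose d := eps / (n ^+ 2 * s + n + 1).
have D0 : 0 < n ^+ 2 * s + n + 1 by rewrite ltr_wpDl // addr_ge0 // mulr_ge0 // sqr_ge0.
have d0 : 0 < d by rewrite divr_gt0.
pose f (ij : J * J) : set {ptws A -> C^o} :=
  [set psi | nrm (psi (hip (x ij.1) (x ij.2)) - set_val chi0 (hip (x ij.1) (x ij.2)) : C) < d].
pose g (i : J) : set {ptws A -> C^o} :=
  [set psi | nrm (psi (hip (x i) (P (x i))) - set_val chi0 (hip (x i) (P (x i))) : C) < d].
have FF := nbhs_filter (set_val chi0 : {ptws A -> C^o}).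
have hf := @filter_forall _ _ f _ FF (fun ij => nbhs_eval _ _ d0).
have hg := @filter_forall _ _ g _ FF (fun i => nbhs_eval _ _ d0).
apply: (@filterS2 _ _ FF _ _ _ _ hf hg) => psi h1 h2 chi echi t ht.
have sC : sip (phi chi) := fam_sip HE chi.
have sC0 : sip (phi chi0) := fam_sip HE chi0.
have k1 i j : nrm (phi chi (x i) (x j) - phi chi0 (x i) (x j)) <= d.
  by rewrite /hip_phi /gelfand echi ltW //; exact: (h1 (i, j)).
have k2 i : nrm (phi chi (x i) (P (x i)) - phi chi0 (x i) (P (x i))) <= d.
  by rewrite /hip_phi /gelfand echi ltW //; exact: (h2 i).
have B0 : 0 < 1 + d * n ^+ 2 by rewrite ltr_wpDr // mulr_ge0 ?sqr_ge0 // ltW.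
have expand (c : J -> C) k : phi k (\sum_i c i *: x i) (\sum_i c i *: x i) =
    \sum_i \sum_j conjc (c i) * c j * phi k (x i) (x j).
  have sk : sip (phi k) := fam_sip HE k.
  have hr (w : E) : phi k w (\sum_j c j *: x j) = \sum_j c j * phi k w (x j).
    elim/big_rec2: _ => [|j y1 y2 _ IH]; first by rewrite (sip0r sk).
    by rewrite (sipDr sk) (sipZr sk) IH.
  have hl (w : E) : phi k (\sum_j c j *: x j) w = \sum_j conjc (c j) * phi k (x j) w.
    elim/big_rec2: _ => [|j y1 y2 _ IH]; first by rewrite (sip0l sk).
    by rewrite (sipDl sk) (sipZl sk) IH.
  rewrite hl; apply: eq_bigr => i _; rewrite hr mulr_sumr.
  by apply: eq_bigr => j _; rewrite mulrA.
have hgr : gram_le (phi chi) x (1 + d * n ^+ 2).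
  move=> c; have := hx c; rewrite mul1r mulrDl mul1r.
  set s2 := \sum_i nrm (c i) ^+ 2 => h0.
  rewrite -lerBlDl; apply: le_trans (_ : d * (\sum_i nrm (c i)) ^+ 2 <= _); last first.
    by rewrite -mulrA ler_wpM2l ?(ltW d0) // sum_sqr_bound.
  apply: le_trans (lerB (lexx _) h0) _; rewrite -ReNc -ReDc.
  apply: le_trans (Re_le_nrm _) _; rewrite !expand -sumrB.
  apply: le_trans (nrm_sum _ _ _) _.
  rewrite expr2 mulr_suml mulr_sumr; apply: ler_sum => i _.
  rewrite -sumrB; apply: le_trans (nrm_sum _ _ _) _.
  rewrite !mulr_sumr; apply: ler_sum => j _.
  rewrite -mulrBr !nrmM nrm_conj mulrC ler_wpM2r ?mulr_ge0 ?nrm_ge0 //.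
have := trub_gram sC B0 (fun c y => adjZ_arg HE c y aP) ht hgr.
have h3 : s - n * d <= \sum_i complex.Re (phi chi (x i) (P (x i))).
  rewrite es lerBlDr /n mulr_natl -sumr_const -big_split /=; apply: ler_sum => i _.
  rewrite -lerBlDl -ReNc -ReDc; apply: le_trans (Re_le_nrm _) _.
  by rewrite nrm_subC.
move=> h4; rewrite leNgt; apply/negP => hlt.
have : s - n * d < (1 + d * n ^+ 2) * (s - eps).
  by apply: le_lt_trans (le_trans h3 h4) _; rewrite ltr_pM2l.
have ed : eps = d * (n ^+ 2 * s + n + 1) by rewrite /d divfK // gt_eqF.
have h5 : 0 <= d * n ^+ 2 * eps.
  by apply: mulr_ge0; [apply: mulr_ge0; [exact: ltW | exact: sqr_ge0] | exact: ltW].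
have : d * (n ^+ 2 * s + n + 1) = d * n ^+ 2 * s + n * d + d by ring.
rewrite -ed; move: d0 h5; lra.
Qed.

End Transfer.

(** * Complex powers *)

Section ComplexPowers.
Context {R : realType}.
Local Notation C := R[i].

Definition cexp (a b : R) : C := (expR a)%:C * (cos b +i* sin b).

Lemma cexpD a b a' b' : cexp (a + a') (b + b') = cexp a b * cexp a' b'.
Proof.
rewrite /cexp mulrACA -rmorphM /= -expRD; congr (_ * _).
by apply/eqP; rewrite eq_complex /= cosD sinD (addrC (sin b * _)) (mulrC (sin b)) eqxx /= addrC mulrC eqxx.
Qed.

Lemma nrm_cexp a b : nrm (cexp a b) = expR a.
Proof.
have h : nrm (cos b +i* sin b) = 1.
  by apply/eqP; rewrite -(@eqrXn2 _ 2) ?nrm_ge0 // expr1n nrm_sqr /= cos2Dsin2.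
by rewrite /cexp nrmM nrmR ger0_norm ?expR_ge0 // h mulr1.
Qed.

Lemma abs_expR_sub1 (a : R) : `|expR a - 1| <= `|a| * expR `|a|.
Proof.
have h1 := expR_ge1Dx a; have h2 := expR_ge1Dx (- a).
have e0 := expR_gt0 a; have h3 : expR a * (1 + - a) <= 1.
  by rewrite -[leRHS](@expRxMexpNx_1 R a) ler_pM2l.
have [a0|a0] := leP 0 a.
  by rewrite (ger0_norm a0) ger0_norm; nra.
have e1 : 1 <= expR `|a| by rewrite -expR0 ler_expR.
rewrite ler0_norm; first by rewrite ltr0_norm //; rewrite ltr0_norm // in e1; nra.
by rewrite subr_le0 -expR0 ler_expR ltW.
Qed.

Lemma abs_expR_sub2 (a : R) : `|expR a - 1 - a| <= a ^+ 2 * expR `|a|.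
Proof.
have h1 := expR_ge1Dx a; have h2 := expR_ge1Dx (- a).
have e0 := expR_gt0 a; have h3 : expR a * (1 + - a) <= 1.
  by rewrite -[leRHS](@expRxMexpNx_1 R a) ler_pM2l.
rewrite ger0_norm; last by lra.
have h4 : expR a - 1 - a <= a * (expR a - 1) by nra.
have h5 := abs_expR_sub1 a; apply: le_trans h4 _; apply: le_trans (ler_norm _) _.
by rewrite normrM -(real_normK (num_real a)) expr2 -mulrA ler_wpM2l.
Qed.

Lemma sin_MVT (b : R) : 0 < b -> exists2 c, 0 < c < b & sin b = b * cos c.
Proof.
move=> b0; have ds x : x \in `]0, b[ -> is_derive x 1 sin (cos x) by move=> _; exact: is_derive_sin.
have cs : {within `[0, b], continuous (@sin R)}.
  by apply: continuous_subspaceT; exact: continuous_sin.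
have [c hc h] := MVT b0 ds cs.
exists c; first by rewrite in_itv in hc.
by move: h; rewrite sin0 !subr0 mulrC.
Qed.

Lemma abs_sin_le (b : R) : `|sin b| <= `|b|.
Proof.
wlog b0 : b / 0 < b => [h|].
  have [b0|b0|->] := ltgtP b 0; [|exact: h|by rewrite sin0 normr0].
  by have := h (- b); rewrite sinN !normrN oppr_gt0; apply.
have [c _ ->] := sin_MVT b0; rewrite normrM ler_piMr //.
by rewrite ler_norml cos_geN1 cos_le1.
Qed.

Lemma one_sub_cos (b : R) : 1 - cos b = 2 * sin (b / 2) ^+ 2.
Proof.
have := cosD (b / 2) (b / 2); rewrite -splitr => ->.
have := cos2sin2 (b / 2); rewrite !expr2 => h; lra.
Qed.

Lemma one_sub_cos_le (b : R) : 0 <= 1 - cos b <= b ^+ 2 / 2.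
Proof.
rewrite one_sub_cos; have h := abs_sin_le (b / 2).
have : sin (b / 2) ^+ 2 <= (b / 2) ^+ 2.
  by rewrite -(real_normK (num_real (sin _))) -(real_normK (num_real (b / 2))) ler_pXn2r ?nnegrE.
have := sqr_ge0 (sin (b / 2)); rewrite (expr2 (b / 2)) (expr2 b); nra.
Qed.

Lemma abs_sin_sub (b : R) : `|sin b - b| <= b ^+ 2.
Proof.
wlog b0 : b / 0 < b => [h|].
  have [b0|b0|->] := ltgtP b 0; [|exact: h|by rewrite sin0 subr0 normr0 expr0n].
  by have := h (- b); rewrite sinN -opprD normrN sqrrN oppr_gt0; apply.
have [c /andP[c0 cb] ->] := sin_MVT b0.
rewrite -[X in _ - X]mulr1 -mulrBr normrM gtr0_norm // expr2 ler_pM2l // distrC.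
have /andP[h1 h2] := one_sub_cos_le c; rewrite ger0_norm //.
have [c2|c2] := leP c 2; first by move: h2; rewrite expr2; nra.
have := cos_geN1 c; lra.
Qed.

(** The remainder of exp(a + i b) splits into the real remainder, the trigonometric one scaled by
    exp(a), and the mixed term b (exp(a) - 1); each is quadratic in a and b. *)
Lemma cexp_taylor a b :
  nrm (cexp a b - 1 - (a +i* b)) <= 2 * expR `|a| * (a ^+ 2 + b ^+ 2).
Proof.
have -> : cexp a b - 1 - (a +i* b) = (expR a - 1 - a)%:C +
    (expR a)%:C * ((cos b - 1) +i* (sin b - b)) + (0 +i* (b * (expR a - 1))).
  by apply/eqP; rewrite eq_complex /cexp /=; apply/andP; split; apply/eqP; ring.
set e := expR `|a|; have e1 : 1 <= e by rewrite -expR0 ler_expR.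
have ea : expR a <= e by rewrite ler_expR ler_norm.
have ea0 := expR_ge0 a.
have n1 := abs_expR_sub2 a; rewrite -/e in n1.
have n2 : nrm ((cos b - 1) +i* (sin b - b)) <= 3 / 2 * b ^+ 2.
  apply: le_trans (nrm_le_ReIm _) _; rewrite /= distrC.
  have /andP[h1 h2] := one_sub_cos_le b; have h3 := abs_sin_sub b.
  by rewrite (ger0_norm h1); lra.
have n3 : nrm (0 +i* (b * (expR a - 1))) <= `|b| * (`|a| * e).
  apply: le_trans (nrm_le_ReIm _) _; rewrite /= normr0 add0r normrM ler_wpM2l //.
  exact: abs_expR_sub1.
have n4 : `|b| * `|a| <= (a ^+ 2 + b ^+ 2) / 2.
  rewrite -(real_normK (num_real a)) -(real_normK (num_real b)).
  by have := sqr_ge0 (`|a| - `|b|); rewrite !expr2; lra.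
have n5 : nrm ((expR a)%:C * ((cos b - 1) +i* (sin b - b))) <= e * (3 / 2 * b ^+ 2).
  by rewrite nrmM nrmR ger0_norm //; apply: ler_pM; rewrite ?nrm_ge0.
have n6 : `|b| * (`|a| * e) <= (a ^+ 2 + b ^+ 2) / 2 * e.
  by rewrite mulrA ler_wpM2r //; lra.
apply: le_trans (nrmD _ _) _; apply: le_trans (lerD (nrmD _ _) (lexx _)) _; rewrite nrmR.
have : 0 <= e * a ^+ 2 by rewrite mulr_ge0 ?sqr_ge0 //; lra.
move: n1 n3 n5 n6; set u := _ ^+ 2; set v := _ ^+ 2; lra.
Qed.

(** The square of y exp(- y) <= 1 at y = - d s / 2. With s = ln t it says that t^d absorbs two
    logarithms. *)
Lemma expR_sqr_bound (s d : R) : 0 < d -> s <= 0 -> s ^+ 2 * expR (d * s) <= 4 / d ^+ 2.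
Proof.
move=> d0 s0; rewrite -(ler_pM2r (exprn_gt0 2 d0)) divfK ?expf_neq0 ?gt_eqF //.
have h1 := expR_ge1Dx (- (d * s / 2)).
have e0 := expR_gt0 (d * s / 2).
have h2 : expR (d * s / 2) * (- (d * s / 2)) <= 1.
  by rewrite -[leRHS](@expRxMexpNx_1 R (d * s / 2)) ler_pM2l //; lra.
have h3 : 0 <= expR (d * s / 2) * (- (d * s / 2)).
  by rewrite mulr_ge0 ?expR_ge0 // oppr_ge0; nra.
have -> : expR (d * s) = expR (d * s / 2) ^+ 2.
  by rewrite expr2 -expRD -splitr.
have := h3; have : (expR (d * s / 2) * (- (d * s / 2))) ^+ 2 <= 1 by rewrite expr_le1.
by rewrite !exprMn sqrrN !exprMn exprVn => ? ?; lra.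
Qed.

Lemma expR_lin_bound (s d : R) : 0 < d -> s <= 0 -> `|s| * expR (d * s) <= d^-1.
Proof.
move=> d0 s0; rewrite ler0_norm // -(ler_pM2r d0) mulVf ?gt_eqF //.
have h1 := expR_ge1Dx (- (d * s)).
rewrite -[leRHS](@expRxMexpNx_1 R (d * s)).
have := expR_gt0 (d * s); nra.
Qed.

(** The derivative of t^z in z; at t = 0 it is 0 because [cpow] is. *)
Definition cpow_ln (z t : C) : C := cpow z t * (ln (complex.Re t))%:C.

Lemma cpowE z (t : R) : 0 < t ->
  cpow z t%:C = cexp (complex.Re z * ln t) (complex.Im z * ln t).
Proof. by move=> t0; rewrite /cpow /= t0. Qed.

Lemma cpow0 z : cpow z (0 : R)%:C = 0.
Proof. by rewrite /cpow /= ltxx. Qed.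

Lemma powR_ln (t p : R) : 0 < t -> t `^ p = expR (p * ln t).
Proof. by move=> t0; rewrite /powR gt_eqF. Qed.

Lemma nrm_cpow z (t : R) : 0 <= t -> complex.Re z != 0 -> nrm (cpow z t%:C) = t `^ complex.Re z.
Proof.
rewrite le_eqVlt => /orP[/eqP<-|t0] z0; first by rewrite cpow0 nrm0 powR0.
by rewrite cpowE // nrm_cexp powR_ln.
Qed.

(** A margin d would absorb the logarithm; the margin 2 d is the one of the Taylor estimate, so that
    both share the same d. *)
Lemma nrm_cpow_ln z (t p d : R) : 0 <= t <= 1 -> 0 < d -> 0 < p -> complex.Re z = p + 2 * d ->
  nrm (cpow_ln z t%:C) <= d^-1 * t `^ p.
Proof.
move=> /andP[]; rewrite le_eqVlt => /orP[/eqP<-|t0] t1 d0 p0 ez.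
  by rewrite /cpow_ln cpow0 mul0r nrm0 powR0 ?mulr0 ?gt_eqF.
have s0 : ln t <= 0 by apply: ln_le0.
rewrite /cpow_ln cpowE // nrmM nrm_cexp nrmR powR_ln // ez mulrDl expRD.
have h1 : expR (2 * d * ln t) <= expR (d * ln t) by rewrite ler_expR; nra.
have h2 := expR_lin_bound d0 s0.
have h3 : expR (2 * d * ln t) * `|ln t| <= d^-1.
  by apply: le_trans h2; rewrite mulrC ler_wpM2l.
by rewrite -mulrA [leRHS]mulrC ler_pM2l ?expR_gt0.
Qed.

(** Half of the margin 2 d absorbs the growth of t^h, as |h| <= d; the other half absorbs (ln t)^2
    at the price 4 / d^2. The remaining factor 2 comes from [cexp_taylor]. *)
Lemma nrm_cpow_taylor z (h : C) (t p d : R) : 0 <= t <= 1 -> 0 < d ->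
  complex.Re z = p + 2 * d -> nrm h <= d ->
  nrm (cpow (z + h) t%:C - cpow z t%:C - h * cpow_ln z t%:C) <=
    8 / d ^+ 2 * nrm h ^+ 2 * t `^ p.
Proof.
move=> /andP[]; rewrite le_eqVlt => /orP[/eqP<-|t0] t1 d0 ez hd.
  rewrite /cpow_ln !cpow0 mul0r mulr0 !subr0 nrm0.
  by apply: mulr_ge0 (powR_ge0 _ _); rewrite mulr_ge0 ?sqr_ge0 // divr_ge0 ?sqr_ge0.
have s0 : ln t <= 0 by apply: ln_le0.
rewrite /cpow_ln cpowE // cpowE // ReDc ImDc (mulrDl (complex.Re z)) (mulrDl (complex.Im z)) cexpD.
set s := ln t in s0 *; set w := cexp _ _; set u := complex.Re h; set v := complex.Im h.
have -> : w * cexp (u * s) (v * s) - w - h * (w * s%:C) =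
    w * (cexp (u * s) (v * s) - 1 - ((u * s) +i* (v * s))).
  have -> : (u * s) +i* (v * s) = h * s%:C.
    by rewrite /u /v; case: h {hd u v} => u v; apply/eqP; rewrite eq_complex /= !mulr0 subr0 add0r !eqxx.
  by rewrite /=; ring.
rewrite nrmM nrm_cexp ez (mulrDl p) expRD powR_ln // -/s.
have T := cexp_taylor (u * s) (v * s).
have e1 : (u * s) ^+ 2 + (v * s) ^+ 2 = nrm h ^+ 2 * s ^+ 2.
  by rewrite nrm_sqr !exprMn -mulrDl.
rewrite e1 in T.
have e2 : expR `|u * s| <= expR (- (d * s)).
  rewrite ler_expR normrM (ler0_norm s0) -mulrN ler_wpM2r ?oppr_ge0 //.
  exact: le_trans (ler_Re_nrm h) hd.
have e3 : expR (2 * d * s) * expR (- (d * s)) = expR (d * s) by rewrite -expRD; congr expR; ring.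
have e4 := expR_sqr_bound d0 s0.
have e5 : expR (2 * d * s) * nrm (cexp (u * s) (v * s) - 1 - ((u * s) +i* (v * s))) <=
    expR (2 * d * s) * (2 * expR (- (d * s)) * (nrm h ^+ 2 * s ^+ 2)).
  rewrite ler_pM2l ?expR_gt0 //; apply: le_trans T _.
  by apply: ler_wpM2r; [rewrite mulr_ge0 ?sqr_ge0 | rewrite ler_pM2l].
have e6 : expR (2 * d * s) * (2 * expR (- (d * s)) * (nrm h ^+ 2 * s ^+ 2)) <= 8 / d ^+ 2 * nrm h ^+ 2.
  have -> : expR (2 * d * s) * (2 * expR (- (d * s)) * (nrm h ^+ 2 * s ^+ 2)) =
     2 * (s ^+ 2 * (expR (2 * d * s) * expR (- (d * s)))) * nrm h ^+ 2 by ring.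
  rewrite e3 ler_wpM2r ?sqr_ge0 //.
  have -> : 8 / d ^+ 2 = 2 * (4 / d ^+ 2) by ring.
  by rewrite ler_pM2l.
have e7 := ler_wpM2r (expR_ge0 (p * s)) (le_trans e5 e6).
by apply: le_trans e7; rewrite -mulrA mulrC.
Qed.

Lemma powR_le_powR (t p q : R) : 0 < q -> q <= p -> 0 <= t <= 1 -> t `^ p <= t `^ q.
Proof.
move=> q0 pq /andP[]; rewrite le_eqVlt => /orP[/eqP<-|t0] t1.
  by rewrite !powR0 ?gt_eqF //; lra.
rewrite !powR_ln // ler_expR; have := ln_le0 t1; nra.
Qed.

Lemma powR_small (q e : R) : 0 < q -> 0 < e ->
  exists2 d : R, 0 < d & forall t, 0 <= t < d -> t `^ q <= e.
Proof.
move=> q0 e0; exists (e `^ q^-1); first by rewrite powR_gt0.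
move=> t /andP[t0 td].
have -> : e = (e `^ q^-1) `^ q by rewrite -powRrM mulVf ?gt_eqF // powRr1 ?ltW.
by apply: ge0_ler_powR; rewrite ?nnegrE ?powR_ge0 // ltW.
Qed.

(** For functions defined by a formula G away from 0 and by 0 at 0: continuity at 0 comes from the
    bound by c t^q. *)
Lemma cont_on_dominated (F G : R -> R) (c q : R) : 0 < q -> 0 <= c ->
  (forall t, 0 <= t <= 1 -> `|F t| <= c * t `^ q) ->
  (forall t, 0 < t -> F t = G t) -> (forall t, 0 < t -> {for t, continuous G}) ->
  cont_on itv01 F.
Proof.
move=> q0 c0 hF FG cG t /andP[]; rewrite le_eqVlt => /orP[/eqP<-|t0] t1 e e0.
  have c1 : 0 < c + 1 by lra.
  have e20 : 0 < e / 2 / (c + 1) by rewrite divr_gt0 //; lra.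
  have [d d0 hd] := powR_small q0 e20.
  have F0 : F 0 = 0.
    have := hF 0; rewrite powR0 ?gt_eqF // mulr0 lexx ler01 => /(_ isT).
    by rewrite normr_le0 => /eqP.
  apply/nbhs_ballP; exists d => //= y; rewrite /ball /= sub0r normrN => yd /andP[y0 y1].
  rewrite F0 subr0; rewrite ger0_norm // in yd.
  have h1 : y `^ q <= e / 2 / (c + 1) by apply: hd; rewrite y0.
  have h2 : `|F y| <= c * y `^ q by apply: hF; rewrite y0.
  have h3 : c * y `^ q <= (c + 1) * (e / 2 / (c + 1)).
    by apply: ler_pM; rewrite ?powR_ge0 //; lra.
  by move: h3; rewrite [X in _ <= X]mulrC divfK ?gt_eqF //; lra.
have /cvgrPdist_lt/(_ e e0) h := cG t t0.
near=> y => _ /=; rewrite distrC !FG //; last by near: y; exact: lt_nbhsr.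
by near: y.
Unshelve. all: by end_near.
Qed.

Lemma continuous_exp_ln (x y : R) (t : R) : 0 < t ->
  {for t, continuous (fun t => expR (x * ln t) * cos (y * ln t))} /\
  {for t, continuous (fun t => expR (x * ln t) * sin (y * ln t))}.
Proof.
move=> t0; have cl (a : R) : {for t, continuous (fun t => a * ln t)}.
  by apply: cvgM; [exact: cvg_cst | exact: continuous_ln].
by split; apply: cvgM; (apply: continuous_comp; [exact: cl|]);
  [exact: continuous_expR | exact: continuous_cos | exact: continuous_expR | exact: continuous_sin].
Qed.

Lemma powR_cont_on (q : R) : 0 < q -> cont_on itv01 (fun t : R => t `^ q).
Proof.
move=> q0; apply: (@cont_on_dominated _ _ 1 q q0 ler01 _ (@powR_ln ^~ q)).
  by move=> t _; rewrite mul1r ger0_norm ?powR_ge0.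
move=> t t0; apply: continuous_comp; last exact: continuous_expR.
by apply: cvgM; [exact: cvg_cst | exact: continuous_ln].
Qed.

Lemma cont_on_ReIm_cpow z (c q : R) (r : R -> R) : 0 < q -> 0 <= c ->
  (forall t, 0 < t -> {for t, continuous r}) ->
  (forall t, 0 <= t <= 1 -> nrm (cpow z t%:C * (r t)%:C) <= c * t `^ q) ->
  cont_on itv01 (fun t => complex.Re (cpow z t%:C * (r t)%:C)) /\
  cont_on itv01 (fun t => complex.Im (cpow z t%:C * (r t)%:C)).
Proof.
move=> q0 c0 cr h; set x := complex.Re z; set y := complex.Im z; split.
- apply: (@cont_on_dominated _ (fun t => expR (x * ln t) * cos (y * ln t) * r t) c q) => //.
  + by move=> t /h; exact: le_trans (ler_Re_nrm _).
  + by move=> t t0; rewrite cpowE // /cexp /=; ring.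
  + move=> t t0; have [c1 _] := continuous_exp_ln x y t0.
    by apply: cvgM => //; exact: cr.
- apply: (@cont_on_dominated _ (fun t => expR (x * ln t) * sin (y * ln t) * r t) c q) => //.
  + by move=> t /h; exact: le_trans (ler_Im_nrm _).
  + by move=> t t0; rewrite cpowE // /cexp /=; ring.
  + move=> t t0; have [_ c1] := continuous_exp_ln x y t0.
    by apply: cvgM => //; exact: cr.
Qed.

End ComplexPowers.

(** * Positive contractions and absolute powers of their functions *)

Section UnitIntervalCalculus.
Context {R : realType}.
Local Notation C := R[i].

Lemma is_trace_uniq {H : hilbertType R} (P : H -> H) (s t : C) :
  is_trace P s -> is_trace P t -> s = t.
Proof.
move=> hs ht; have [I [e he]] := @orthonormal_basis_ex R H.
have FF := fmap_proper_filter (summability.partial_sum (fun i => ip (e i) (P (e i)) : C^o)) (@summability.totally_filter I).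
exact: (@cvg_unique C^o (@norm_hausdorff C C^o) _ FF _ _ (hs I e he) (ht I e he)).
Qed.

Lemma op_pos_pos1 (A : commCstarType R) (E : hilbertModType A) (T : E -> E) :
  op_pos hip T -> op_pos hip (fun x => x - T x) -> pos1 hip (@hip_phi R A E) T.
Proof.
have HE := hip_fam E.
have pos (S : E -> E) : op_pos hip S ->
    is_adjoint hip S S /\ forall k x, 0 <= complex.Re (hip_phi k x (S x)).
  move=> [Q [Q' [aQ ->]]]; have aQ' := adj_sym HE aQ; split; first exact: (adj_comp HE aQ' aQ).
  by move/(adjP HE): aQ => aQ k x; rewrite /= -aQ (sip_q_ge0 (fam_sip HE k)).
move=> /pos[aT h] /pos[_ h']; split=> // k x; rewrite h /=.
have := h' k x; have sk := fam_sip HE k.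
by rewrite (sipDr sk) (sipNr sk) ReDc ReNc subr_ge0 (sn_sqr sk).
Qed.

Lemma cont_on_Re (f : C -> C) : {within (I01 : set C^o), continuous (f : C^o -> C^o)} ->
  cont_on itv01 (fun t : R => complex.Re (f t%:C)) /\
  cont_on itv01 (fun t : R => complex.Im (f t%:C)).
Proof.
move=> /withinP hf.
have h t : itv01 t -> forall e, 0 < e -> nbhs t [set y | itv01 y -> nrm (f y%:C - f t%:C) < e].
  move=> tI e e0; have e20 : 0 < e / 2 by lra.
  have [d d0 hd] := hf t%:C (conj erefl tI) _ e20.
  apply/nbhs_ballP; exists d => //= y hy yI.
  have := hd y%:C (conj erefl yI); rewrite -rmorphB nrmR nrm_subC => /(_ hy); lra.
split=> t tI e e0; apply: filterS (h t tI e e0) => y /= hy yI; apply: le_lt_trans (hy yI).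
  by rewrite -ReNc -ReDc ler_Re_nrm.
by rewrite -ImNc -ImDc ler_Im_nrm.
Qed.

Lemma lift_ReIm (f : C -> C) : {in I01, f =1 (fun z =>
  lift (fun t => complex.Re (f t%:C)) z + (0 +i* 1) * lift (fun t => complex.Im (f t%:C)) z)}.
Proof.
move=> z; rewrite inE => /I01P[ez _]; rewrite /lift -ez.
rewrite [LHS](_ : _ = complex.Re (f z) +i* complex.Im (f z)); last by case: (f z).
apply/eqP; rewrite eq_complex /=; apply/andP; split; apply/eqP; ring.
Qed.

Lemma within_ReIm (f : C -> C) : cont_on itv01 (fun t : R => complex.Re (f t%:C)) ->
  cont_on itv01 (fun t : R => complex.Im (f t%:C)) ->
  {within (I01 : set C^o), continuous (f : C^o -> C^o)}.
Proof.
move=> h1 h2; have := withinD (lift_within h1) (withinM (@within_cst R I01 (0 +i* 1)) (lift_within h2)).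
move=> /withinP h; apply/withinP => x Ix e e0; have [d d0 hd] := h x Ix e e0.
by exists d => // y Iy hy; rewrite (lift_ReIm f (mem_set Ix)) (lift_ReIm f (mem_set Iy)); exact: hd.
Qed.

Section AbsPow.
Context {V : completeNormedModType C} {W : Type} {form : V -> V -> W}.
Context {X : Type} {phi : X -> V -> V -> C}.
Hypothesis H : ipfam form phi.

(** Every stage of [op_abs_pow] is a function of U: |f|^2, then |f|, then |f|^q. The bound |f| <= 1
    keeps each of them within the unit interval, where the next calculus applies. *)
Lemma fcalc_abs_pow (U S : V -> V) (f : C -> C) (q : R) : pos1 form phi U -> 0 < q ->
  cont_on itv01 (fun t : R => nrm (f t%:C)) ->
  (forall t : R, itv01 t -> nrm (f t%:C) <= 1) -> fcalc phi I01 U f S ->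
  fcalc phi I01 U (lift (fun t => nrm (f t%:C) `^ q)) (op_abs_pow form S q).
Proof.
move=> hU q0 cF F1 hS; have [aU _] := hU; have sK := spectral_I01 H hU.
pose F t := nrm (f t%:C).
have F01 t : itv01 t -> itv01 (F t) by move=> tI; rewrite /itv01 /= nrm_ge0 F1.
have aS : is_adjoint form S (adjoint form S).
  by apply: (@getPex _ [set S' | is_adjoint form S S']); exact: (fcalc_adjointable H aU sK hS).
have hB : fcalc phi I01 U (lift (fun t => F t * F t)) (adjoint form S \o S).
  apply: fcalc_ext (fcalcM H aU sK (fcalc_conj H aU sK hS aS) hS) => z.
  by rewrite inE => /I01P[ez _]; rewrite /lift /F -ez mul_conj expr2.
have pB : pos1 form phi (adjoint form S \o S).
  apply: (fcalc_pos1 H hU (cont_onM cF cF) _ hB) => t /F01/andP[h0 h1].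
  by rewrite mulr_ge0 //= mulr_ile1.
have cs : cont_on itv01 (fun t : R => Num.sqrt t).
  by apply/cont_onP => x _; apply: cvg_within_filter; exact: sqrt_continuous.
have hA : fcalc phi I01 U (lift F) (op_abs form S).
  have h := calculus_I01 H pB (lift_within cs).
  have F2 t : itv01 t -> itv01 (F t * F t).
    by move=> /F01/andP[h0 h1]; rewrite /itv01 /= mulr_ge0 //= mulr_ile1.
  apply: fcalc_ext (fcalc_comp H hU hB F2 h) => z _.
  by rewrite /lift /= -expr2 sqrtr_sqr ger0_norm ?nrm_ge0.
have pA := fcalc_pos1 H hU cF F01 hA.
have h := calculus_I01 H pA (lift_within (powR_cont_on q0)).
by apply: fcalc_ext (fcalc_comp H hU hA F01 h) => z _.
Qed.

End AbsPow.
End UnitIntervalCalculus.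

(** * The zeta function *)

Section TraceFunctional.
Context {R : realType} {A : commCstarType R} {E : hilbertModType A}.
Local Notation C := R[i].
Local Notation phi := (@hip_phi R A E).
Local Notation push chi L := (@push_op R A E chi L).
Let HE := hip_fam E.
Variables (T : E -> E) (p : R) (a : A).
Hypotheses (hT : pos1 hip phi T) (p0 : 0 < p).
Local Notation calc := (calculus hip T).
Local Notation within01 f := {within (I01 : set C^o), continuous (f : C^o -> C^o)}.
Local Notation pw := (fun t : R => t `^ p).

(** For all localizations, whereas [is_tr] provides one: traces of different functions can then be
    added on a common model. *)
Definition trat (chi : charspace A) (f : C -> C) (z : C) :=
  forall L : localization E chi, is_trace (push chi L (calc f)) z.

Hypothesis ha : forall chi, exists L : localization E chi,
  is_trace (push chi L (calc (lift pw))) (gelfand a chi).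

Let aT : is_adjoint hip T T. Proof. by case: hT. Qed.
Let adT : adjointable hip T. Proof. by exists T. Qed.
Let sK := spectral_I01 HE hT.
Let cpw : cont_on itv01 pw := powR_cont_on p0.

Lemma calc_fcalc f : within01 f -> fcalc phi I01 T f (calc f).
Proof. exact: calculus_I01. Qed.

Lemma calc_adjointable f : within01 f -> adjointable hip (calc f).
Proof. by move=> /calc_fcalc h; exact: (fcalc_adjointable HE aT sK h). Qed.

Lemma push_calc chi (L : localization E chi) f : within01 f ->
  fcalc (@ip_phi R L) I01 (push chi L T) f (push chi L (calc f)).
Proof.
by move=> cf; apply: push_fcalc => //; [exact: calc_adjointable | exact: calc_fcalc].
Qed.

Let sL chi (L : localization E chi) := spectral_I01 (ip_fam L) (push_pos1 L hT).

Lemma trat_ext chi f g z : within01 f -> within01 g -> {in I01, f =1 g} ->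
  trat chi f z -> trat chi g z.
Proof.
move=> cf cg fg h L.
by rewrite -(fcalc_uniq HE sK fg (calc_fcalc cf) (calc_fcalc cg)); exact: h.
Qed.

Lemma tratD chi f g z w : within01 f -> within01 g ->
  trat chi f z -> trat chi g w -> trat chi (fun x => f x + g x) (z + w).
Proof.
move=> cf cg hf hg L; have h := fcalcD (ip_fam L) (push_calc L cf) (push_calc L cg).
rewrite (fcalc_uniq (ip_fam L) (sL L) (fun _ _ => erefl) (push_calc L (withinD cf cg)) h).
exact: is_traceD.
Qed.

Lemma tratZ chi c f z : within01 f -> trat chi f z -> trat chi (fun x => c * f x) (c * z).
Proof.
move=> cf hf L; have h := fcalcZ (ip_fam L) c (push_calc L cf).
have h' := push_calc L (withinM (@within_cst R I01 c) cf).
rewrite (fcalc_uniq (ip_fam L) (sL L) (fun _ _ => erefl) h' h).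
exact: is_traceZ.
Qed.

Lemma trat_uniq chi f z w : trat chi f z -> trat chi f w -> z = w.
Proof. by move=> h h'; have [L _] := ha chi; exact: is_trace_uniq (h L) (h' L). Qed.

(** The right side does not involve a localization, so a trace found on one model holds on all. *)
Lemma trat_lift chi F (t : R) : cont_on itv01 F -> (forall s, itv01 s -> 0 <= F s) ->
  trat chi (lift F) t%:C <-> trlub (phi chi) (calc (lift F)) t.
Proof.
move=> cF F0; have [Q [aQ PQ _]] := fcalc_sqrt HE hT cF F0 (calc_fcalc (lift_within cF)).
split=> h; first by have [L _] := ha chi; apply/(is_trace_push L aQ PQ).
by move=> L; apply/(is_trace_push L aQ PQ).
Qed.

Lemma gelfand_dom chi : gelfand a chi = (complex.Re (gelfand a chi))%:C /\
  trlub (phi chi) (calc (lift pw)) (complex.Re (gelfand a chi)).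
Proof.
have pw0 s : itv01 s -> 0 <= pw s by rewrite powR_ge0.
have [Q [aQ PQ _]] := fcalc_sqrt HE hT cpw pw0 (calc_fcalc (lift_within cpw)).
have [L h] := ha chi.
have e : gelfand a chi = (complex.Re (gelfand a chi))%:C.
  by apply: is_trace_real h; [exact: (push_op_adj aQ) | exact: push_sqr].
by split=> //; apply/(is_trace_push L aQ PQ); rewrite -e.
Qed.

Lemma trat_dom chi : trat chi (lift pw) (gelfand a chi).
Proof.
have [-> h] := gelfand_dom chi; apply/trat_lift => // s _; exact: powR_ge0.
Qed.

(** The future Gelfand transform of the trace, defined on all maps from A because
    [gelfand_surjective] works there. At characters the set is bounded and [sup] is a genuine
    supremum. *)
Let tau F (psi : {ptws A -> C^o}) : R :=
  sup (trset (fun u v : E => psi (hip u v) : C) (calc (lift F))).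

Section Dominated.
Variables (F : R -> R) (c : R).
Hypotheses (c0 : 0 <= c) (cF : cont_on itv01 F) (Fc : forall t, itv01 t -> 0 <= F t <= c * t `^ p).

Let F0 t : itv01 t -> 0 <= F t. Proof. by move/Fc => /andP[]. Qed.

Lemma trub_dominated chi : ubound (trset (phi chi) (calc (lift F))) (c * complex.Re (gelfand a chi)).
Proof.
have sE : sip (phi chi) := fam_sip HE chi.
move=> _ [J [x [hx ->]]]; have [_ [ub _]] := gelfand_dom chi.
apply: le_trans (_ : \sum_i c * complex.Re (phi chi (x i) (calc (lift pw) (x i))) <= _); last first.
  by rewrite -mulr_sumr ler_wpM2l //; apply: ub; exists J, x.
apply: ler_sum => i _; rewrite -ReMc -(sipZr sE).
have cc : cont_on itv01 (fun t => c * t `^ p) := cont_onM (@cont_on_cst _ _ itv01 c) cpw.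
have hD : fcalc phi I01 T (lift (fun t => c * t `^ p)) (fun x => c%:C *: calc (lift pw) x).
  apply: fcalc_ext (fcalcZ HE c%:C (calc_fcalc (lift_within cpw))) => z _.
  by rewrite /lift rmorphM.
apply: (fcalc_le HE chi (x i) hT cF cc _ (calc_fcalc (lift_within cF)) hD).
by move=> t /Fc/andP[].
Qed.

Lemma trlub_dominated chi : trlub (phi chi) (calc (lift F)) (tau F (set_val chi)).
Proof. exact: (trlub_sup (fam_sip HE chi) (@trub_dominated chi)). Qed.

Lemma trat_dominated chi : trat chi (lift F) (tau F (set_val chi))%:C.
Proof. by apply/trat_lift => //; exact: trlub_dominated. Qed.

Lemma tau_bound chi : 0 <= tau F (set_val chi) <= c * complex.Re (gelfand a chi).
Proof.
have [h1 h2] := trlub_dominated chi.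
by rewrite (trub_ge0 (fam_sip HE chi) h1) h2 //; exact: trub_dominated.
Qed.

Lemma tau_lsc (chi0 : charspace A) (e : R) : 0 < e ->
  nbhs (set_val chi0 : {ptws A -> C^o})
    [set psi | is_character psi -> tau F (set_val chi0) - e <= tau F psi].
Proof.
move=> e0; have e20 : 0 < e / 2 by lra.
have [s hs st] := trlub_approx (trlub_dominated chi0) e20.
have cl := lift_within cF; have [P' aP] := calc_adjointable cl.
have s0 : 0 <= s.
  move: hs => [J [x [_ ->]]]; apply: sumr_ge0 => i _.
  exact: (fcalc_ge0 HE chi0 (x i) hT cF F0 (calc_fcalc cl)).
have h := trace_lsc (ex_intro _ P' aP) e20 s0 hs.
have FF := nbhs_filter (set_val chi0 : {ptws A -> C^o}).
apply: (@filterS _ _ FF _ _ _ h) => psi hp hc.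
have [ub _] := trlub_dominated (mkchar hc).
have := hp (mkchar hc) erefl _ ub; lra.
Qed.

End Dominated.

(* The traces of [f(T)] and [c T^p - f(T)] are lower semicontinuous, and their
   sum is continuous. *)
Lemma trof_pos F c : 0 <= c -> cont_on itv01 F ->
  (forall t, itv01 t -> 0 <= F t <= c * t `^ p) ->
  exists b : A, (forall chi, trat chi (lift F) (gelfand b chi)) /\ nrm b <= c * nrm a.
Proof.
move=> c0 cF Fc; pose G t := c * t `^ p - F t.
have cG : cont_on itv01 G := cont_onB (cont_onM (@cont_on_cst _ _ itv01 c) cpw) cF.
have Gc t : itv01 t -> 0 <= G t <= c * t `^ p by move=> /Fc; rewrite /G; lra.
have FG chi : tau F (set_val chi) + tau G (set_val chi) = c * complex.Re (gelfand a chi).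
  have h1 := @tratD chi _ _ _ _ (lift_within cF) (lift_within cG) (@trat_dominated F c c0 cF Fc chi) (@trat_dominated G c c0 cG Gc chi).
  have h2 := @tratZ chi c%:C _ _ (lift_within cpw) (@trat_dom chi).
  have [ea _] := gelfand_dom chi; apply: complexI; rewrite rmorphD rmorphM /= -ea.
  apply: (@trat_uniq chi _ _ _ h1); apply: (@trat_ext chi _ _ _ _ _ _ h2) => [||z _].
  - exact: withinM (@within_cst R I01 c%:C) (lift_within cpw).
  - exact: withinD (lift_within cF) (lift_within cG).
  - by rewrite /lift /G -rmorphM -rmorphD /= addrC subrK.
have [|chi hc|b hb] := @gelfand_surjective R A (tau F) (c%:C *: a).
- move=> chi hc e e0; pose x := mkchar hc.
  have e20 : 0 < e / 2 by lra.
  (* The upper estimate of tau F is the lower one of tau G plus the continuity of c a, each with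
     error e / 2; c + 1 replaces a divisor c that may be 0. *)
  have k0 : 0 < e / 2 / (c + 1) by rewrite divr_gt0 //; lra.
  have FF := nbhs_filter (chi : {ptws A -> C^o}).
  have h1 := tau_lsc c0 cF Fc x e20; have h2 := tau_lsc c0 cG Gc x e20.
  have h3 := nbhs_eval chi a k0.
  apply: (@filterS3 _ _ FF _ _ _ _ _ h1 h2 h3) => psi /= l1 l2 l3 hp.
  have k1 := FG (mkchar hp); have k2 := FG x; rewrite /= in k1 k2.
  have {}l1 := l1 hp; have {}l2 := l2 hp.
  have k3 : `|complex.Re (psi a) - complex.Re (chi a)| <= e / 2 / (c + 1).
    by rewrite -ReNc -ReDc; apply: le_trans (ler_Re_nrm _) (ltW l3).
  have k4 : `|c * (complex.Re (psi a) - complex.Re (chi a))| < e / 2.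
    rewrite normrM ger0_norm //; apply: le_lt_trans (_ : c * (e / 2 / (c + 1)) < _).
      by rewrite ler_wpM2l.
    have : (c + 1) * (e / 2 / (c + 1)) = e / 2 by rewrite mulrC divfK // gt_eqF //; lra.
    by move: k0; set u := e / 2 / _; lra.
  have k5 : tau F psi + tau G psi = c * complex.Re (psi a) := k1.
  have k6 : tau F chi + tau G chi = c * complex.Re (chi a) := k2.
  have l1' : tau F chi - e / 2 <= tau F psi := l1.
  have l2' : tau G chi - e / 2 <= tau G psi := l2.
  move: k4; rewrite mulrBr -k5 -k6 ltr_norml ltr_norml => /andP[k7 k8].
  by apply/andP; split; lra.
- have /andP[h1 h2] := tau_bound c0 cF Fc (mkchar hc).
  have l1 : 0 <= tau F chi := h1.
  have l2 : tau F chi <= c * complex.Re (chi a) := h2.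
  rewrite (lin_Z (qcharL (is_character_qchar hc))) nrmM nrmR !ger0_norm //.
  by apply: le_trans l2 _; rewrite ler_wpM2l // Re_le_nrm.
have hb' (chi : charspace A) : gelfand b chi = (tau F (set_val chi))%:C := hb _ (charspaceP chi).
exists b; split=> [chi|]; first by rewrite hb'; exact: (@trat_dominated F c).
apply: nrm_le_gelfand => [|chi]; first by rewrite mulr_ge0 ?nrm_ge0.
have /andP[h1 h2] := tau_bound c0 cF Fc chi.
rewrite hb' nrmR ger0_norm //; apply: le_trans h2 _; rewrite ler_wpM2l //.
exact: le_trans (Re_le_nrm _) (gelfand_le _ _).
Qed.

Definition trof f b := forall chi, trat chi f (gelfand b chi).

Lemma trof_uniq f b b' : trof f b -> trof f b' -> b = b'.
Proof. by move=> h h'; apply: gelfand_inj => chi; apply: (@trat_uniq chi f). Qed.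

Lemma trof_ext f g b : within01 f -> within01 g -> {in I01, f =1 g} -> trof f b -> trof g b.
Proof. by move=> cf cg fg h chi; apply: (@trat_ext chi f g). Qed.

Lemma trofD f g b b' : within01 f -> within01 g -> trof f b -> trof g b' ->
  trof (fun z => f z + g z) (b + b').
Proof. by move=> cf cg h h' chi; rewrite gelfandD; apply: (@tratD chi). Qed.

Lemma trofZ l f b : within01 f -> trof f b -> trof (fun z => l * f z) (l *: b).
Proof. by move=> cf h chi; rewrite gelfandZ; apply: (@tratZ chi). Qed.

(** F + c t^p lies between 0 and 2 c t^p; subtracting c T^p afterwards makes the constant 2 + 1 =
    3. *)
Lemma trof_real F c : 0 <= c -> cont_on itv01 F ->
  (forall t, itv01 t -> `|F t| <= c * t `^ p) ->
  exists2 b : A, trof (lift F) b & nrm b <= 3 * c * nrm a.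
Proof.
move=> c0 cF Fc.
have cc : cont_on itv01 (fun t => c * t `^ p) := cont_onM (@cont_on_cst _ _ itv01 c) cpw.
have [||t tI|b [hb nb]] := @trof_pos (fun t => F t + c * t `^ p) (2 * c).
- by rewrite mulr_ge0.
- exact: cont_onD.
- by have := Fc t tI; rewrite ler_norml; lra.
have cd := lift_within (cont_onD cF cc).
exists (b + (- c)%:C *: a); last first.
  apply: le_trans (nrmD _ _) _; rewrite nrmZ nrmR normrN ger0_norm //.
  by move: nb; rewrite -!mulrA; set x := c * _; lra.
have h := @trofD _ _ _ _ cd (withinM (@within_cst R I01 (- c)%:C) (lift_within cpw)) hb
  (@trofZ (- c)%:C _ _ (lift_within cpw) (@trat_dom)).
apply: (@trof_ext _ _ _ _ _ _ h) => [||z _].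
- exact: withinD cd (withinM (@within_cst R I01 (- c)%:C) (lift_within cpw)).
- exact: lift_within.
- by rewrite /lift -rmorphM -rmorphD /=; congr (_%:C); ring.
Qed.

(** Real and imaginary parts cost 3 each. *)
Lemma trof_ex f c : 0 <= c -> within01 f ->
  (forall t, itv01 t -> nrm (f t%:C) <= c * t `^ p) ->
  exists2 b : A, trof f b & nrm b <= 6 * c * nrm a.
Proof.
move=> c0 cf fc; have [c1 c2] := cont_on_Re cf.
have [t /fc h|b1 h1 n1] := trof_real c0 c1.
  exact: le_trans (ler_Re_nrm _) h.
have [t /fc h|b2 h2 n2] := trof_real c0 c2.
  exact: le_trans (ler_Im_nrm _) h.
exists (b1 + (0 +i* 1) *: b2); last first.
  apply: le_trans (nrmD _ _) _; rewrite nrmZ.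
  have le1 : nrm (0 +i* 1 : C) <= 1.
    by apply: le_trans (nrm_le_ReIm _) _; rewrite /= normr0 normr1 add0r.
  have : nrm (0 +i* 1 : C) * nrm b2 <= nrm b2 by rewrite ler_piMl ?nrm_ge0.
  by move: n1 n2; rewrite -!mulrA; set x := c * _; lra.
have w2 := withinM (@within_cst R I01 (0 +i* 1)) (lift_within c2).
have h := @trofD _ _ _ _ (lift_within c1) w2 h1 (@trofZ (0 +i* 1) _ _ (lift_within c2) h2).
exact: (@trof_ext _ f _ (withinD (lift_within c1) w2) cf (fun z Iz => esym (lift_ReIm f Iz)) h).
Qed.

End TraceFunctional.

Section Zeta.
Context {R : realType} {A : commCstarType R} {E : hilbertModType A}.
Local Notation C := R[i].
Local Notation phi := (@hip_phi R A E).
Local Notation push chi L := (@push_op R A E chi L).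
Local Notation within01 f := {within (I01 : set C^o), continuous (f : C^o -> C^o)}.

Lemma within_cpow (z : C) : 0 < complex.Re z -> within01 (cpow z).
Proof.
move=> z0; have [|t /andP[t0 _]|h1 h2] := @cont_on_ReIm_cpow R z 1 (complex.Re z) (fun=> 1) z0 ler01.
- by move=> t _; exact: cvg_cst.
- by rewrite mulr1 mul1r nrm_cpow // gt_eqF.
have e : cpow z = fun w => cpow z w * 1 by apply/funext => w; rewrite mulr1.
by rewrite e; exact: within_ReIm.
Qed.

Lemma within_cpow_ln (z : C) : 0 < complex.Re z -> within01 (cpow_ln z).
Proof.
(* Re z is split as q + 2 d with equal halves: t^(2 d) pays for the logarithm, and t^q still
   vanishes at 0. *)
move=> z0; have q0 : 0 < complex.Re z / 2 by lra.
have d0 : 0 < complex.Re z / 4 by lra.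
have c0 : 0 <= (complex.Re z / 4)^-1 by rewrite invr_ge0 ltW.
have hz : complex.Re z = complex.Re z / 2 + 2 * (complex.Re z / 4) by lra.
have [|t t01|h1 h2] := @cont_on_ReIm_cpow R z _ _ (@ln R) q0 c0.
- by move=> t; exact: continuous_ln.
- exact: (nrm_cpow_ln t01 d0 q0 hz).
exact: within_ReIm.
Qed.

Variables (T : E -> E) (p : R) (a : A).
Hypotheses (hT : pos1 hip phi T) (p1 : 1 <= p).
Hypothesis ha : forall chi, exists L : localization E chi,
  is_trace (push chi L (calculus hip T (lift (fun t => t `^ p)))) (gelfand a chi).

Let p0 : 0 < p. Proof. exact: lt_le_trans ltr01 p1. Qed.

Lemma push_abs_pow chi (L : localization E chi) f (q : R) : 0 < q -> within01 f ->
  cont_on itv01 (fun t : R => nrm (f t%:C)) ->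
  (forall t : R, itv01 t -> nrm (f t%:C) <= 1) ->
  cont_on itv01 (fun t : R => nrm (f t%:C) `^ q) ->
  op_abs_pow ip (push chi L (calculus hip T f)) q =
  push chi L (calculus hip T (lift (fun t => nrm (f t%:C) `^ q))).
Proof.
move=> q0 cf cn n1 cq; have HL := ip_fam L; have hL := push_pos1 L hT.
have h1 := fcalc_abs_pow HL hL q0 cn n1 (push_calc hT L cf).
have h2 := push_calc hT L (lift_within cq).
exact: (fcalc_uniq HL (spectral_I01 HL hL) (fun _ _ => erefl) h1 h2).
Qed.

(** [zeta] is selected by [get] from a set that requires T^z to be in [schatten 1], so a member must
    be exhibited first. Uniqueness of traces then identifies the selected element with it. *)
Lemma zeta_trof (z : C) : p < complex.Re z -> trof T (cpow z) (zeta z T).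
Proof.
move=> pz; have z0 : 0 < complex.Re z := lt_trans p0 pz.
have cz := within_cpow z0.
have nz (t : R) : itv01 t -> nrm (cpow z t%:C) = t `^ complex.Re z.
  by move=> /andP[t0 _]; rewrite nrm_cpow // gt_eqF.
have czc : cont_on itv01 (fun t : R => nrm (cpow z t%:C)).
  move=> t tI e e0; apply: filterS (powR_cont_on z0 tI e0) => y /= h yI.
  by rewrite !nz //; exact: h.
have dom (t : R) : itv01 t -> nrm (cpow z t%:C) <= 1 * t `^ p.
  by move=> tI; rewrite nz // mul1r powR_le_powR // ltW.
have le1 (t : R) : itv01 t -> nrm (cpow z t%:C) <= 1.
  move=> tI; rewrite nz //; have /andP[t0 t1] := tI.
  by have := ge0_ler_powR (ltW z0) _ _ t1; rewrite powR1; apply; rewrite ?nnegrE.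
have e1 : (fun t : R => nrm (cpow z t%:C) `^ 1) = (fun t : R => nrm (cpow z t%:C)).
  by apply/funext => t; rewrite powRr1 // nrm_ge0.
have [b hb _] := trof_ex hT p0 ha ler01 cz dom.
(* For [schatten 1]: |T^z| is the function t^(Re z) of T, which is dominated by t^p as well. *)
have [a1 [ha1 _]] : exists b : A,
    (forall chi, trat T chi (lift (fun t : R => nrm (cpow z t%:C) `^ 1)) (gelfand b chi)) /\
    nrm b <= 1 * nrm a.
  rewrite e1; apply: (trof_pos hT p0 ha ler01 czc) => t tI.
  by rewrite nrm_ge0 dom.
have [|hs ht] := @getPex _ [set b | schatten 1 (op_cpow hip T z) /\
    forall chi, is_tr (op_cpow hip T z) chi (gelfand b chi)].
  exists b; split; last by move=> chi; have [L _] := ha chi; exists L; exact: (hb chi L).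
  split; first exact: (calc_adjointable hT cz).
  exists a1 => chi; have [L _] := ha chi; exists L.
  rewrite push_abs_pow //; last by rewrite e1.
  exact: (ha1 chi L).
have -> : zeta z T = b; last by [].
apply: gelfand_inj => chi; have [L hL] := ht chi.
exact: is_trace_uniq hL (hb chi L).
Qed.

(** g is the trace of T^z ln T. The remainder is the trace of a function of size |h|^2 t^p, so
    [trof_ex] bounds its norm; K combines the 6 of that lemma with the 8 / d^2 of
    [nrm_cpow_taylor]. *)
Lemma zeta_taylor (z : C) : p < complex.Re z -> exists (d K : R) (g : A),
  [/\ 0 < d, 0 <= K & forall h : C, nrm h <= d ->
    p < complex.Re (z + h) /\ nrm (zeta (z + h) T - zeta z T - h *: g) <= K * nrm h ^+ 2].
Proof.
move=> pz; pose d := (complex.Re z - p) / 2; have d0 : 0 < d by rewrite /d; lra.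
have ez : complex.Re z = p + 2 * d by rewrite /d; lra.
have z0 : 0 < complex.Re z := lt_trans p0 pz.
have id0 : 0 <= d^-1 by rewrite invr_ge0 ltW.
have [g hg _] := trof_ex hT p0 ha id0 (within_cpow_ln z0) (fun t tI => nrm_cpow_ln tI d0 p0 ez).
pose K := 6 * (8 / d ^+ 2) * nrm a; have K0 : 0 <= 8 / d ^+ 2 by rewrite divr_ge0 ?sqr_ge0.
exists d, K, g; split=> //; first exact: (mulr_ge0 (mulr_ge0 (ler0n _ 6) K0) (nrm_ge0 a)).
move=> h hd; have Rh : - d <= complex.Re h.
  by have := le_trans (ler_Re_nrm h) hd; rewrite ler_norml => /andP[].
have pzh : p < complex.Re (z + h) by rewrite ReDc; lra.
split=> //; have zh0 : 0 < complex.Re (z + h) := lt_trans p0 pzh.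
have c1 := within_cpow zh0; have c2 := within_cpow z0; have c3 := within_cpow_ln z0.
have m2 := withinM (@within_cst R I01 (-1)) c2; have m3 := withinM (@within_cst R I01 (- h)) c3.
pose f w := cpow (z + h) w + -1 * cpow z w + - h * cpow_ln z w.
have cf : within01 f by exact: withinD (withinD c1 m2) m3.
have t1 := @trofD _ _ _ _ hT _ _ _ _ c1 m2 (zeta_trof pzh) (@trofZ _ _ _ _ hT (-1) _ _ c2 (zeta_trof pz)).
have tf : trof T f (zeta (z + h) T + -1 *: zeta z T + - h *: g).
  exact: (@trofD _ _ _ _ hT _ _ _ _ (withinD c1 m2) m3 t1 (@trofZ _ _ _ _ hT (- h) _ _ c3 hg)).
have C0 : 0 <= 8 / d ^+ 2 * nrm h ^+ 2 by rewrite mulr_ge0 ?sqr_ge0.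
have [t tI|b hb nb] := trof_ex hT p0 ha C0 cf.
  by rewrite /f mulN1r mulNr; exact: nrm_cpow_taylor.
have := trof_uniq ha tf hb; rewrite scaleN1r scaleNr => ->.
by apply: le_trans nb _; rewrite /K; lra.
Qed.

Lemma zeta_derivable (z : C) : p < complex.Re z -> derivable ((fun z => zeta z T) : C^o -> A) z 1.
Proof.
move=> /zeta_taylor[d [K [g [d0 K0 hd]]]]; apply/cvg_ex; exists g.
apply/cvg_nrmP => e e0.
have r0 : 0 < Num.min d (e / (K + 1)) by rewrite lt_min d0 divr_gt0 //; lra.
have : nbhs (0 : C^o) [set h : C^o | nrm h < Num.min d (e / (K + 1))].
  apply/(@nbhs_nrmP _ C^o); exists (Num.min d (e / (K + 1))) => // y.
  by rewrite sub0r nrmN.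
rewrite /dnbhs /within /=; apply: filterS => h /=; rewrite lt_min => /andP[h1 h2] hn.
have [_ h3] := hd h (ltW h1).
have ez : h *: (1 : C^o) + z = z + h by rewrite [h *: _]mulr1 addrC.
rewrite /= ez.
have n0 : 0 < nrm h by rewrite nrm_gt0.
have -> : g - h^-1 *: (zeta (z + h) T - zeta z T) = - (h^-1 *: (zeta (z + h) T - zeta z T - h *: g)).
  by rewrite [in RHS]scalerBr scalerA mulVf // scale1r opprB.
rewrite nrmN nrmZ nrmV mulrC ler_pdivrMr //; apply: le_trans h3 _.
rewrite expr2 mulrA ler_pM2r //.
have h4 : (K + 1) * nrm h <= e by rewrite mulrC -ler_pdivlMr ?ltW //; lra.
by lra.
Qed.

Lemma zeta_continuous (z : C) (e : R) : p < complex.Re z -> 0 < e ->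
  nbhs (z : C^o) [set w | nrm (zeta w T - zeta z T) < e].
Proof.
move=> /zeta_taylor[d [K [g [d0 K0 hd]]]] e0.
pose M := K * d + nrm g + 1; have M0 : 0 < M.
  by rewrite /M ltr_wpDl // addr_ge0 ?nrm_ge0 // mulr_ge0 // ltW.
have r0 : 0 < Num.min d (e / M) by rewrite lt_min d0 divr_gt0.
apply/(@nbhs_nrmP _ C^o); exists (Num.min d (e / M)) => // w; rewrite lt_min nrm_subC => /andP[h1 h2].
have [_ h3] := hd (w - z) (ltW h1); rewrite (addrC z) subrK in h3.
set h := w - z in h1 h2 h3 *; have n0 := nrm_ge0 h.
rewrite /= -(subrK (h *: g) (zeta w T - zeta z T)).
apply: le_lt_trans (nrmD _ _) _; rewrite nrmZ.
have h4 : nrm h * M < e by rewrite -ltr_pdivlMr.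
have h5 : K * nrm h ^+ 2 <= nrm h * (K * d) by rewrite expr2 mulrCA ler_wpM2l // ler_wpM2l // ltW.
have [hz|hp] := eqVneq (nrm h) 0; first by rewrite hz expr0n /= mulr0 in h3 *; rewrite mul0r addr0; lra.
have hp' : 0 < nrm h by rewrite lt_neqAle eq_sym hp.
move: h3 h4 h5; rewrite /M; lra.
Qed.

Lemma gelfand_nbhs (x : charspace A) (b : A) (e : R) : 0 < e ->
  nbhs x [set y : charspace A | nrm (gelfand b y - gelfand b x) < e].
Proof.
move=> e0.
have cv : {for x, continuous (set_val : charspace A -> {ptws A -> C^o})} by exact: initial_continuous.
exact: (cv _ (nbhs_eval (set_val x) b e0)).
Qed.

Lemma zeta_equicontinuous (K : set C) : compact (K : set C^o) ->
  K `<=` [set z : C | p < complex.Re z] ->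
  forall (x : charspace A) (eps : R), 0 < eps ->
  exists2 U : set (charspace A), nbhs x U & forall y, U y -> forall z, K z ->
    nrm (gelfand (zeta z T) y - gelfand (zeta z T) x) <= eps.
Proof.
move=> cK Kp x eps eps0; have e0 : 0 < eps / 3 by lra.
have [z Kz|s [sK hs]] := @compact_seq C^o K (fun z => [set w | nrm (zeta w T - zeta z T) < eps / 3]) cK.
  by apply: zeta_continuous => //; exact: Kp.
exists [set y | forall i : 'I_(size s),
    nrm (gelfand (zeta (nth 0 s i) T) y - gelfand (zeta (nth 0 s i) T) x) < eps / 3].
  exact: (@filter_forall _ _ (fun (i : 'I_(size s)) => [set y : charspace A |
    nrm (gelfand (zeta (nth 0 s i) T) y - gelfand (zeta (nth 0 s i) T) x) < eps / 3])
    _ _ (fun i => gelfand_nbhs x _ e0)).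
move=> y hy z Kz; have [w ws hw] := hs z Kz.
have wi : (index w s < size s)%N by rewrite index_mem.
have := hy (Ordinal wi); rewrite /= nth_index // => h1.
(* Evaluation at a character is contractive, so replacing z by w costs less than eps / 3 at x and at
   y alike. *)
have h2 := gelfand_le y (zeta z T - zeta w T); have h3 := gelfand_le x (zeta z T - zeta w T).
rewrite gelfandB in h2; rewrite gelfandB in h3; rewrite /= in hw.
have tri (u v u' v' : C) : nrm (u - v) <= nrm (u - u') + nrm (u' - v') + nrm (v - v').
  have -> : u - v = (u - u') + (u' - v') - (v - v') by ring.
  by apply: le_trans (nrmB _ _) _; rewrite lerD2r nrmD.
apply: le_trans (tri _ _ (gelfand (zeta w T) y) (gelfand (zeta w T) x)) _.
have -> : eps = eps / 3 + eps / 3 + eps / 3 by lra.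
apply: lerD; first by apply: lerD; [exact: le_trans h2 (ltW hw) | exact: ltW].
exact: le_trans h3 (ltW hw).
Qed.

End Zeta.

(** [schatten] speaks of |chi_* T|^p, computed on a localization; the trace functional starts from
    T^p, computed on E and then localized. Both are the function t^p of chi_* T. *)
Lemma schatten_trace (R : realType) (A : commCstarType R) (E : hilbertModType A) (p : R) (T : E -> E) :
  pos1 hip (@hip_phi R A E) T -> 0 < p -> schatten p T ->
  exists a : A, forall chi, exists L : localization E chi,
    is_trace (push_op (L := L) (calculus hip T (lift (fun t => t `^ p)))) (gelfand a chi).
Proof.
move=> hT p0 [_ [a ha]]; exists a => chi; have [L hL] := ha chi; exists L.
have HL := ip_fam L; have pL := push_pos1 L hT.
have nI (t : R) : itv01 t -> nrm (t%:C : R[i]) = t by move=> /andP[t0 _]; rewrite nrmR ger0_norm.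
have cn : cont_on itv01 (fun t : R => nrm (t%:C : R[i])).
  move=> t tI e e0; apply/nbhs_ballP; exists e => //= y hy yI.
  by rewrite !nI // distrC.
have n1 (t : R) : itv01 t -> nrm (t%:C : R[i]) <= 1 by move=> tI; rewrite nI //; case/andP: tI.
have h1 := fcalc_abs_pow HL pL p0 cn n1 (fcalc_id HL _).
have h2 := push_calc hT L (lift_within (powR_cont_on p0)).
rewrite -(fcalc_uniq HL (spectral_I01 HL pL) _ h1 h2) // => z.
by rewrite inE => -[_ zI]; rewrite /lift nI.
Qed.

Theorem theorem4p19 (R : realType) (A : commCstarType R) (E : hilbertModType A)
    (p : R) (T : E -> E) :
  countably_generated E ->
  1 <= p ->
  schatten p T ->
  op_pos hip T ->
  op_pos hip (fun x => x - T x) ->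
  holomorphic_on [set z : R[i] | p < complex.Re z] (fun z => zeta z T) /\
  (forall K : set R[i],
     compact (K : set R[i]^o) -> K `<=` [set z : R[i] | p < complex.Re z] ->
     forall (x : charspace A) (eps : R), 0 < eps ->
     exists2 U : set (charspace A), nbhs x U &
       forall y, U y ->
         (ereal_sup [set (complex.Re `|gelfand (zeta z T) y
                                       - gelfand (zeta z T) x|)%:E | z in K]
            < eps%:E)%E).
Proof.
move=> _ p1 sT pT p1T; have hT := op_pos_pos1 pT p1T.
have [a ha] := schatten_trace hT (lt_le_trans ltr01 p1) sT.
split=> [z pz|K cK Kp x eps eps0]; first exact: (zeta_derivable hT p1 ha pz).
have e20 : 0 < eps / 2 by lra.
have [U nU hU] := zeta_equicontinuous hT p1 ha cK Kp x e20.
(* Strict bounds need not survive a supremum, hence the detour through eps / 2. *)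
exists U => // y Uy; apply: (@le_lt_trans _ _ (eps / 2)%:E); last by rewrite lte_fin; lra.
by apply: ge_ereal_sup => _ [z Kz <-]; rewrite lee_fin; exact: hU.
Qed.
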